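(* Let $V=\mathrm{Ind}_B^G(\chi)$. Let $D$ be a topologically étale $(\varphi,\Gamma)$-module over $\Omega(N_0)$ such that (i) $D$ is torsion-free as an $\Omega(N_0)$-module; (ii) the topology of $D$ is Hausdorff; (iii) $D$ has a basis of neighbourhoods of $0$ consisting of $\varphi$-invariant $\Omega(N_0)$-submodules (open submodules $O\le D$ with $\varphi_t(O)\subseteq O$ for all $t\in T_+$). Let $F:D(V)\to D$ be a continuous $\psi$-invariant homomorphism of $\Omega(N_0)$-modules. Then $F$ factors through the natural map $F_0:D(V)\to D(V_{n!-1})$: there exists a continuous $\psi$-invariant homomorphism $H:D(V_{n!-1})\to D$ such that $F=H\circ F_0$.
   Context: Let $F_{\mathrm{field}}$ and $K$ be finite extensions of $\mathbb{Q}_p$ with rings of integers $o,o_K$, residue fields $k,k_K$, and $\pi_K$ a uniformizer of $K$. $G=\mathrm{GL}_n(F_{\mathrm{field}})$, $G_0=\mathrm{GL}_n(o)$; $B$ is the group of upper triangular matrices, $T$ the diagonal matrices, $N$ the upper triangular unipotent matrices, $N_0=N\cap G_0$, $T_+=\{t\in T\mid tN_0t^{-1}\subset N_0\}$, $B_+=N_0T_+$, $U^{(1)}=\ker(G_0\to\mathrm{GL}_n(k))$, and $w_0$ is the longest element of the Weyl group of permutation matrices. $\Lambda(N_0)$ is the completed group ring of $N_0$ over $o_K$ and $\Omega(N_0)=\Lambda(N_0)/\pi_K\Lambda(N_0)$; for $t\in T_+$, $\varphi_t$ also denotes the ring endomorphism of $\Omega(N_0)$ induced by $u\mapsto tut^{-1}$.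 Let $\chi:T\to k_K^*$ be a locally constant character, extended to $B$ via $B\to B/[B,B]\simeq T$; $V=\mathrm{Ind}_B^G(\chi)=\{f:G\to k_K\text{ locally constant}\mid f(gb)=\chi^{-1}(b)f(g)\ \forall g\in G,b\in B\}$, with $(gf)(x)=f(g^{-1}x)$, and $V_{n!-1}=\{f\in V\mid f|_{G\setminus Bw_0B}\equiv0\}$, a $B$-subrepresentation. For a torsion $o_K$-module $Y$, $Y^*=\mathrm{Hom}_{o_K}(Y,K/o_K)$ is the Pontrjagin dual (compact topology), with $\Lambda(N_0)$-action through inversion on $N_0$. For a torsion $o_K$-module $X$ with $o_K$-linear $B$-action, $\mathcal{B}_+(X)$ is the set of $B_+$-stable $o_K$-submodules $M\subset X$ with $BM=X$, and $D(X)=\varinjlim_{M\in\mathcal{B}_+(X)}M^*$ (transition maps are restrictions), with the $T_+^{-1}$-action $\psi$ given on $M^*$ by $(\psi_tf)(x)=f(tx)$, $t\in T_+$. For $X=V$ and $X=V_{n!-1}$ the set $\mathcal{B}_+(X)$ has a smallest element: $M_0=B_+V^{U^{(1)}}$ (the $k_K$-span of all $bv$, $b\in B_+$, $v\in V^{U^{(1)}}$) for $V$, and $M_{0,n!-1}=\{f\in V\mid \mathrm{supp}(f)\subset N_0w_0B\}\simeq C^\infty(N_0)$ for $V_{n!-1}$. So $D(V)=M_0^*$ and $D(V_{n!-1})=M_{0,n!-1}^*$ with their compact topologies; $M_{0,n!-1}\subset M_0$ and $F_0$ is restriction of functionals. A topologically étale $(\varphi,\Gamma)$-module $D$ over $\Omega(N_0)$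 is a topological $\Omega(N_0)$-module with a continuous action of $B_+$ extending the action of $N_0$, elements $t\in T_+$ acting by $\varphi_t$-semilinear maps $\varphi_t:D\to D$, which is étale: for all $t\in T_+$, $\varphi_t$ is injective and $D=\bigoplus_{u\in N_0/tN_0t^{-1}}u\varphi_t(D)$, the canonical left inverse $\psi_t$ of $\varphi_t$ (with $\psi_t(\varphi_t(d))=d$ and $\psi_t(u\varphi_t(d))=0$ for $u\in N_0\setminus tN_0t^{-1}$) being continuous. Equivalently $d=\sum_{u\in N_0/tN_0t^{-1}}u\varphi_t(\psi_t(u^{-1}d))$ for all $d\in D$. A map is $\psi$-invariant if it commutes with $\psi_t$ for all $t\in T_+$. *)

(* Defs.v *)
From HB Require Import structures.
From mathcomp Require Import all_boot all_order perm all_algebra all_field zify.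
From mathcomp Require Import finmap all_classical.
From mathcomp Require Import topology.
From mathcomp.multinomials Require Import monalg.

Set Implicit Arguments.
Unset Strict Implicit.
Unset Printing Implicit Defensive.

Import Order.TTheory GRing.Theory Num.Theory.
Local Open Scope classical_set_scope.
Local Open Scope quotient_scope.
Local Open Scope ring_scope.

(* [GroupTop], [PzRingTop] and [ComRingTop] do not require the operations to be
   continuous; [TopModule] does. *)
#[short(type="groupTopType")]
HB.structure Definition GroupTop := {G of Group G & Topological G}.
HB.structure Definition ZmodTop := {M of GRing.Zmodule M & Topological M}.
HB.structure Definition LmodTop (R : pzRingType) :=
  {M of GRing.Lmodule R M & Topological M}.
#[short(type="pzRingTopType")]
HB.structure Definition PzRingTop := {R of GRing.PzRing R & Topological R}.
#[short(type="comRingTopType")]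
HB.structure Definition ComRingTop := {R of GRing.ComNzRing R & Topological R}.

HB.mixin Record isTopModule (R : pzRingTopType) M
    of Topological M & GRing.Lmodule R M := {
  tm_add_continuous : continuous (fun x : M * M => x.1 + x.2);
  tm_opp_continuous : continuous (fun x : M => - x);
  tm_scale_continuous : continuous (fun z : R * M => z.1 *: z.2)
}.
#[short(type="topModType")]
HB.structure Definition TopModule (R : pzRingTopType) :=
  {M of Topological M & GRing.Lmodule R M & isTopModule R M}.
(* A normalised discrete valuation; [vord 0] is a junk value, see [vge]. *)
HB.mixin Record Field_isValued F of GRing.Field F := {
  vord : F -> int;
  vordM : forall x y : F, x != 0 -> y != 0 -> vord (x * y) = vord x + vord y;
  vordD : forall x y : F, x != 0 -> y != 0 -> x + y != 0 ->
    Order.min (vord x) (vord y) <= vord (x + y);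
  vord_unif : exists2 x : F, x != 0 & vord x = 1
}.
#[short(type="valuedFieldType")]
HB.structure Definition ValuedField := {F of GRing.Field F & Field_isValued F}.

(* k <= v(x), with v(0) = +oo *)
Definition vge (F : valuedFieldType) (k : int) (x : F) : bool :=
  (x == 0) || (k <= vord x).

(* Q_p is the completion of the rationals for the p-adic valuation. *)
HB.mixin Record Valued_isPadic (p : nat) Q of ValuedField Q := {
  vord_nat : forall m : nat, (0 < m)%N ->
    (m%:R : Q) != 0 /\ vord (m%:R : Q) = Posz (logn p m);
  rat_dense : forall (x : Q) (k : int), exists r : rat, vge k (x - ratr r);
  padic_complete : forall u : nat -> Q,
    (forall k : int, exists N, forall i j : nat,
       (N <= i)%N -> (N <= j)%N -> vge k (u i - u j)) ->
    exists l : Q, forall k : int, exists N, forall i : nat,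
       (N <= i)%N -> vge k (u i - l)
}.
#[short(type="padicType")]
HB.structure Definition Padic p := {Q of ValuedField Q & Valued_isPadic p Q}.

(* A finite extension of Q_p, with its (unique) normalised valuation, which
   restricts to e times the one of Q_p, and the topology that it defines. *)
HB.mixin Record FieldExt_isPadicExt (p : nat) (Q : padicType p) F
    of FieldExt Q F & ValuedField F & Topological F := {
  vord_ramif : exists2 e : nat, (0 < e)%N &
    forall a : Q, a != 0 -> vord (a%:A : F) = e%:Z * vord a;
  nbhs_vord : forall (x : F) (A : set F),
    nbhs x A <-> exists k : int, forall y, vge k (y - x) -> A y
}.
#[short(type="padicExtType")]
HB.structure Definition PadicExt p (Q : padicType p) :=
  {F of FieldExt Q F & ValuedField F & Topological F
      & FieldExt_isPadicExt p Q F}.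

Section ValuedFieldTheory.
Variable F : valuedFieldType.
Implicit Types x y : F.

Lemma vord1 : vord (1 : F) = 0.
Proof.
have := vordM _ _ (oner_neq0 F) (oner_neq0 F).
by rewrite mulr1 => /esym/eqP; rewrite -subr_eq0 addrK => /eqP.
Qed.

Lemma vordN1 : vord (-1 : F) = 0.
Proof.
have n1 : (-1 : F) != 0 by rewrite oppr_eq0 oner_eq0.
have := vordM _ _ n1 n1; rewrite mulrNN mulr1 vord1 -mulr2n => /esym/eqP.
by rewrite mulrn_eq0 => /eqP.
Qed.

Lemma vge0 k : vge k (0 : F). Proof. by rewrite /vge eqxx. Qed.

Lemma vge_le k l x : k <= l -> vge l x -> vge k x.
Proof. by move=> kl /orP[/eqP->|/(le_trans kl)]; rewrite /vge ?eqxx// => ->; rewrite orbT. Qed.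

Lemma vgeM k l x y : vge k x -> vge l y -> vge (k + l) (x * y).
Proof.
rewrite /vge; have [->|x0] := eqVneq x 0; first by rewrite mul0r eqxx.
have [->|y0] := eqVneq y 0; first by rewrite mulr0 eqxx.
by rewrite /= => kx ly; rewrite vordM// lerD// orbT.
Qed.

Lemma vgeD k x y : vge k x -> vge k y -> vge k (x + y).
Proof.
have [->|x0] := eqVneq x 0; first by rewrite add0r.
have [->|y0] := eqVneq y 0; first by rewrite addr0.
rewrite /vge; have [//|xy0] := eqVneq (x + y) 0.
rewrite (negPf x0) (negPf y0) /= => kx ky.
by apply: le_trans (vordD _ _ x0 y0 xy0); rewrite le_min kx.
Qed.

Lemma vgeN k x : vge k (- x) = vge k x.
Proof.
rewrite /vge oppr_eq0; have [//|x0] := eqVneq x 0.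
by rewrite -mulN1r vordM ?vordN1 ?add0r// oppr_eq0 oner_eq0.
Qed.

Lemma vgeB k x y : vge k x -> vge k y -> vge k (x - y).
Proof. by move=> kx ky; rewrite vgeD// vgeN. Qed.

Lemma vge_sum k (I : Type) (r : seq I) (P : pred I) (f : I -> F) :
  (forall i, P i -> vge k (f i)) -> vge k (\sum_(i <- r | P i) f i).
Proof. by move=> kf; elim/big_ind: _ => //; [exact: vge0|exact: vgeD]. Qed.

Lemma vge1 : vge 0 (1 : F). Proof. by rewrite /vge vord1 lexx orbT. Qed.

Definition ointeger : {pred F} := fun x => vge 0 x.

Lemma ointeger_subring : subring_closed ointeger.
Proof.
split; rewrite ?unfold_in; first exact: vge1.
- by move=> x y; rewrite !unfold_in; exact: vgeB.
- by move=> x y; rewrite !unfold_in => x0 y0; rewrite -[0]addr0 vgeM.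
Qed.
HB.instance Definition _ := GRing.isSubringClosed.Build F ointeger
  ointeger_subring.

Record oring := Oring { oval : F; ovalP : oval \in ointeger }.
HB.instance Definition _ := [isSub for oval].
HB.instance Definition _ := [Choice of oring by <:].
HB.instance Definition _ := [SubChoice_isSubComNzRing of oring by <:].

Definition omax : {pred oring} := fun a : oring => vge 1 (val a).

Lemma omax_ideal : idealr_closed omax.
Proof.
split; rewrite ?unfold_in; first exact: vge0.
- by rewrite /vge rmorph1 vord1 oner_eq0.
- move=> a x y; rewrite !unfold_in rmorphD rmorphM => x1 y1.
  by apply: vgeD => //; rewrite -[1]add0r vgeM//; exact: (valP a).
Qed.
HB.instance Definition _ := isIdealr.Build oring omax omax_ideal.

Definition resfield := {ideal_quot omax}.
HB.instance Definition _ := GRing.ComNzRing.on resfield.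

Definition residue (a : oring) : resfield := \pi_({ideal_quot omax}) a.

Lemma residue_eq0 a : (residue a == 0) = (a \in omax).
Proof. by rewrite /residue -[0](rmorph0 \pi_({ideal_quot omax})) -Quotient.idealrBE subr0. Qed.

Definition resinv (a : resfield) : resfield :=
  if a == 0 then 0 else residue (insubd 0 (oval (repr a))^-1).

Lemma resinvV (a : resfield) : a != 0 -> resinv a * a = 1.
Proof.
move=> a0; rewrite /resinv (negPf a0).
have ra : residue (repr a) = a by exact: reprK.
move: a0; rewrite -{1 3}ra residue_eq0 unfold_in.
set x := repr a => /norP[x0]; rewrite -ltNge => x1.
have vx : vord (val x) = 0.
  by have /orP[|] := valP x; rewrite ?(negPf x0)//; lia.
have vxV : vge 0 (val x)^-1.
  apply/orP; right.
  have := vordM _ _ x0 (invr_neq0 x0); rewrite divff// vord1 vx add0r => <-.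
  exact: lexx.
rewrite /residue -[LHS](rmorphM \pi_({ideal_quot omax})).
rewrite -[RHS](rmorph1 \pi_({ideal_quot omax})); congr (\pi _).
apply: val_inj; rewrite rmorphM rmorph1 /= insubdK ?unfold_in//.
by rewrite mulVf.
Qed.

Lemma resinv0 : resinv 0 = 0. Proof. by rewrite /resinv eqxx. Qed.

HB.instance Definition _ := GRing.ComNzRing_isField.Build resfield resinvV resinv0.

Definition fracmod := Quotient.quot ointeger.
HB.instance Definition _ := GRing.Zmodule.on fracmod.

Definition fracmod_scale (a : oring) (x : fracmod) : fracmod :=
  \pi_(Quotient.quot ointeger) (val a * repr x).

Lemma fracmod_scaleE a x :
  fracmod_scale a (\pi_(Quotient.quot ointeger) x) = \pi_(Quotient.quot ointeger) (val a * x).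
Proof.
apply/eqP; rewrite -Quotient.idealrBE -mulrBr rpredM//; first exact: valP.
by rewrite Quotient.idealrBE reprK.
Qed.

Lemma fracmod_ind (P : fracmod -> Prop) :
  (forall y, P (\pi_(Quotient.quot ointeger) y)) ->
  forall x : fracmod, P x.
Proof. by move=> Py x; rewrite -[x](@reprK _ (Quotient.quot ointeger)). Qed.

Lemma fracmod_scaleA a b (x : fracmod) :
  fracmod_scale a (fracmod_scale b x) = fracmod_scale (a * b) x.
Proof. by elim/fracmod_ind: x => y; rewrite !fracmod_scaleE rmorphM mulrA. Qed.

Lemma fracmod_scale1 : left_id 1 fracmod_scale.
Proof. by elim/fracmod_ind => y; rewrite fracmod_scaleE rmorph1 mul1r. Qed.

Lemma fracmod_scaleDr : right_distributive fracmod_scale +%R.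
Proof.
move=> a x y; elim/fracmod_ind: x => x; elim/fracmod_ind: y => y.
have piD u v : (\pi_(Quotient.quot ointeger) (u + v) : fracmod) =
  (\pi_(Quotient.quot ointeger) u : fracmod) + \pi_(Quotient.quot ointeger) v.
  exact: (raddfD \pi_(Quotient.quot ointeger)).
by rewrite -piD !fracmod_scaleE mulrDr piD.
Qed.

Lemma fracmod_scaleDl (x : fracmod) : {morph fracmod_scale^~ x : a b / a + b}.
Proof.
move=> a b; elim/fracmod_ind: x => x; rewrite !fracmod_scaleE rmorphD mulrDl.
exact: (raddfD \pi_(Quotient.quot ointeger)).
Qed.

HB.instance Definition _ := GRing.Zmodule_isLmodule.Build oring fracmod
  fracmod_scaleA fracmod_scale1 fracmod_scaleDr fracmod_scaleDl.

End ValuedFieldTheory.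
Section Mint.
Variables (R : comNzRingType) (X : choiceType).
Implicit Types f g : {malg R[X]}.

Definition mint (M : lmodType R) (f : {malg R[X]}) (phi : X -> M) : M :=
  \sum_(a <- msupp f) f@_a *: phi a.

Lemma mintE (M : lmodType R) (d : {fset X}) f (phi : X -> M) :
  fsubset (msupp f) d -> mint f phi = \sum_(a <- d) f@_a *: phi a.
Proof.
move=> fd; apply: big_fset_incl => // a _ /mcoeff_outdom ->.
by rewrite scale0r.
Qed.

Lemma mintD (M : lmodType R) f g (phi : X -> M) :
  mint (f + g) phi = mint f phi + mint g phi.
Proof.
rewrite (mintE phi (msuppD_le f g)) (mintE phi (fsubsetUl (msupp f) (msupp g))).
rewrite (mintE phi (fsubsetUr (msupp f) (msupp g))) -big_split /=.
by apply: eq_bigr => a _; rewrite mcoeffD scalerDl.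
Qed.

Lemma mintZ (M : lmodType R) c f (phi : X -> M) :
  mint (c *: f) phi = c *: mint f phi.
Proof.
rewrite (mintE phi (msuppZ_le c f)) scaler_sumr.
by apply: eq_bigr => a _; rewrite mcoeffZ scalerA.
Qed.

Lemma mint0 (M : lmodType R) (phi : X -> M) : mint 0 phi = 0.
Proof. by rewrite /mint msupp0 big_seq_fset0. Qed.

Lemma mintN (M : lmodType R) f (phi : X -> M) : mint (- f) phi = - mint f phi.
Proof. by rewrite -[in LHS]scaleN1r mintZ scaleN1r. Qed.

Lemma mint_sum (M : lmodType R) (I : Type) (r : seq I) (F : I -> {malg R[X]})
    (phi : X -> M) :
  mint (\sum_(i <- r) F i) phi = \sum_(i <- r) mint (F i) phi.
Proof.
elim: r => [|i r IH]; first by rewrite !big_nil mint0.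
by rewrite !big_cons mintD IH.
Qed.

Lemma mintU (M : lmodType R) k (phi : X -> M) : mint << k >> phi = phi k.
Proof. by rewrite (mintE phi msuppU_le) big_seq_fset1 mcoeffUU scale1r. Qed.

Lemma mint_id f : mint f (fun a => << a >> : {malg R[X]}) = f.
Proof.
rewrite [RHS]monalgE; apply: eq_bigr => a _; apply/malgP => k.
by rewrite mcoeffZ !mcoeffU mulrnAr mulr1.
Qed.

Lemma mint_addr (M : lmodType R) f (phi psi : X -> M) :
  mint f (fun a => phi a + psi a) = mint f phi + mint f psi.
Proof. by rewrite /mint -big_split /=; apply: eq_bigr => a _; rewrite scalerDr. Qed.

Lemma mint_scaler (M : lmodType R) c f (phi : X -> M) :
  mint f (fun a => c *: phi a) = c *: mint f phi.
Proof.
by rewrite /mint scaler_sumr; apply: eq_bigr => a _; rewrite !scalerA mulrC.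
Qed.

Lemma eq_mint (M : lmodType R) f (phi psi : X -> M) :
  phi =1 psi -> mint f phi = mint f psi.
Proof. by move=> e; apply: eq_bigr => a _; rewrite e. Qed.

End Mint.

Lemma mint_bind (R : comNzRingType) (X Y : choiceType) (M : lmodType R)
    (f : {malg R[X]}) (F : X -> {malg R[Y]}) (phi : Y -> M) :
  mint (mint f F) phi = mint f (fun a => mint (F a) phi).
Proof. by rewrite [mint f F]/mint mint_sum; apply: eq_bigr => a _; rewrite mintZ. Qed.

Definition mpush (R : comNzRingType) (X Y : choiceType) (h : X -> Y)
    (f : {malg R[X]}) : {malg R[Y]} := mint f (fun a => << h a >>).

Lemma mint_push (R : comNzRingType) (X Y : choiceType) (M : lmodType R)
    (h : X -> Y) (f : {malg R[X]}) (phi : Y -> M) :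
  mint (mpush h f) phi = mint f (phi \o h).
Proof. by rewrite mint_bind; apply: eq_mint => a; rewrite mintU. Qed.

Lemma mpush_comp (R : comNzRingType) (X Y Z : choiceType) (h : X -> Y)
    (k : Y -> Z) (f : {malg R[X]}) : mpush k (mpush h f) = mpush (k \o h) f.
Proof. exact: mint_push. Qed.

Section GroupAlgebra.
Variables (R : comNzRingType) (Q : groupType).

Definition galg := {malg R[Q]}.
HB.instance Definition _ := GRing.Lmodule.on galg.

Definition galg1 : galg := << 1%g >>.
Definition galg_mul (f g : galg) : galg :=
  mint f (fun a => mint g (fun b => << (a * b)%g >> : galg)).

Lemma mint_mul (M : lmodType R) (f g : galg) (phi : Q -> M) :
  mint (galg_mul f g) phi = mint f (fun a => mint g (fun b => phi (a * b)%g)).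
Proof.
by rewrite mint_bind; apply: eq_mint => a; rewrite mint_bind;
  apply: eq_mint => b; rewrite mintU.
Qed.

Lemma galg_mulA : associative galg_mul.
Proof.
move=> f g h; rewrite [RHS]mint_mul [LHS]/galg_mul; apply: eq_mint => a.
by rewrite mint_mul; apply: eq_mint => b; apply: eq_mint => c; rewrite mulgA.
Qed.

Lemma galg_mul1g : left_id galg1 galg_mul.
Proof.
move=> f; rewrite /galg_mul mintU -[RHS](mint_id f).
by apply: eq_mint => a; rewrite mul1g.
Qed.

Lemma galg_mulg1 : right_id galg1 galg_mul.
Proof.
move=> f; rewrite -[RHS](mint_id f); apply: eq_mint => a.
by rewrite mintU mulg1.
Qed.

Lemma galg_mulDl : left_distributive galg_mul +%R.
Proof. by move=> f g h; exact: mintD. Qed.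

Lemma galg_mulDr : right_distributive galg_mul +%R.
Proof.
move=> f g h; rewrite -mint_addr; apply: eq_mint => a; exact: mintD.
Qed.

HB.instance Definition _ := GRing.Zmodule_isPzRing.Build galg
  galg_mulA galg_mul1g galg_mulg1 galg_mulDl galg_mulDr.

Lemma galg_scaleAl (c : R) (f g : galg) : c *: (f * g) = (c *: f) * g.
Proof. by rewrite -[RHS]/(galg_mul _ _) /galg_mul mintZ. Qed.

Lemma galg_scaleAr (c : R) (f g : galg) : c *: (f * g) = f * (c *: g).
Proof.
rewrite -[RHS]/(galg_mul _ _) /galg_mul -mint_scaler.
by apply: eq_mint => a; rewrite mintZ.
Qed.

End GroupAlgebra.

Lemma mpushM (R : comNzRingType) (Q Q' : groupType) (h : Q -> Q')
    (f g : galg R Q) : {morph h : a b / (a * b)%g} ->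
  mpush h (f * g) = (mpush h f : galg R Q') * (mpush h g : galg R Q').
Proof.
move=> hM; rewrite [LHS]mint_mul -[RHS]/(galg_mul _ _) /galg_mul mint_push.
apply: eq_mint => a /=; rewrite mint_push.
by apply: eq_mint => b /=; rewrite hM.
Qed.

Section OpenNormal.
Variable G : groupTopType.

Record onsubgroup := OnSubgroup {
  onset :> set G;
  on_open : open onset;
  on1 : onset 1%g;
  onM : forall g h, onset g -> onset h -> onset (g * h)%g;
  onV : forall g, onset g -> onset g^-1%g;
  onJ : forall g h, onset g -> onset (h^-1 * g * h)%g }.

Variable H : onsubgroup.

Definition oneqv (x y : G) : bool := `[< onset H (x^-1 * y)%g >].

Lemma oneqv_class : equiv_class_of oneqv.
Proof.
split=> [x|x y|y x z]; rewrite /oneqv.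
- by apply/asboolP; rewrite mulVg; exact: on1.
- by apply/asbool_equiv_eq; split=> /onV; rewrite invgM invgK.
- move=> /asboolP yx /asboolP xz; apply/asboolP.
  by have := onM yx xz; rewrite mulgA mulgK.
Qed.

Canonical oneqv_equiv := EquivRelPack oneqv_class.
Canonical oneqv_encModRel := defaultEncModRel oneqv.

Definition gquot := {eq_quot oneqv}.
HB.instance Definition _ := Choice.on gquot.
HB.instance Definition _ := EqQuotient.on gquot.

Lemma gquotP (x y : G) : (\pi_gquot x = \pi_gquot y) <-> onset H (x^-1 * y)%g.
Proof.
by split=> [/eqmodP/asboolP//|h]; apply/eqmodP/asboolP.
Qed.

Lemma gquot_ind (P : gquot -> Prop) :
  (forall x, P (\pi_gquot x)) -> forall q : gquot, P q.
Proof. by move=> Px q; rewrite -[q](@reprK _ gquot). Qed.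

Definition gquot1 : gquot := \pi_gquot 1%g.
Definition gquot_mul (a b : gquot) : gquot := \pi_gquot (repr a * repr b)%g.
Definition gquot_inv (a : gquot) : gquot := \pi_gquot (repr a)^-1%g.

Lemma gquot_repr x : onset H (x^-1 * repr (\pi_gquot x))%g.
Proof. by apply/gquotP; rewrite reprK. Qed.

Lemma gquot_mulE x y : gquot_mul (\pi_gquot x) (\pi_gquot y) = \pi_gquot (x * y)%g.
Proof.
apply/esym/gquotP; rewrite invgM.
set x' := repr _; set y' := repr _.
have -> : (y^-1 * x^-1 * (x' * y') =
    (y^-1 * (x^-1 * x') * y) * (y^-1 * y'))%g.
  by rewrite !mulgA mulgK.
by apply: onM; [apply: onJ; exact: gquot_repr|exact: gquot_repr].
Qed.

Lemma gquot_invE x : gquot_inv (\pi_gquot x) = \pi_gquot x^-1%g.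
Proof.
apply/gquotP; rewrite invgK.
have := onJ x^-1%g (gquot_repr x); rewrite invgK mulgA mulgV mul1g.
by [].
Qed.

Lemma gquot_mulA : associative gquot_mul.
Proof.
move=> a b c; elim/gquot_ind: a => a; elim/gquot_ind: b => b.
by elim/gquot_ind: c => c; rewrite !gquot_mulE mulgA.
Qed.

Lemma gquot_mul1 : left_id gquot1 gquot_mul.
Proof. by elim/gquot_ind => a; rewrite gquot_mulE mul1g. Qed.

Lemma gquot_mulr1 : right_id gquot1 gquot_mul.
Proof. by elim/gquot_ind => a; rewrite gquot_mulE mulg1. Qed.

Lemma gquot_mulV : left_inverse gquot1 gquot_inv gquot_mul.
Proof. by elim/gquot_ind => a; rewrite gquot_invE gquot_mulE mulVg. Qed.

Lemma gquot_mulVr : right_inverse gquot1 gquot_inv gquot_mul.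
Proof. by elim/gquot_ind => a; rewrite gquot_invE gquot_mulE mulgV. Qed.

HB.instance Definition _ := isGroup.Build gquot
  gquot_mulA gquot_mul1 gquot_mulr1 gquot_mulV gquot_mulVr.

End OpenNormal.

(* The map G / H -> G' / H' induced by theta : G -> G'
   (meaningful if theta is a group morphism that maps H to H'). *)
Definition gquot_map (G G' : groupTopType) (theta : G -> G')
    (H : onsubgroup G) (H' : onsubgroup G') (a : gquot H) : gquot H' :=
  \pi_(gquot H') (theta (repr a)).

Section GquotMap.
Variables (G G' : groupTopType) (theta : G -> G').
Variables (H : onsubgroup G) (H' : onsubgroup G').
Hypothesis thetaM : {morph theta : x y / (x * y)%g}.
Hypothesis thetaH : forall x, onset H x -> onset H' (theta x).

Lemma theta1 : theta 1%g = 1%g.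
Proof. by apply: (mulIg (theta 1%g)); rewrite -thetaM !mul1g. Qed.

Lemma thetaV x : theta x^-1%g = (theta x)^-1%g.
Proof. by apply: (mulIg (theta x)); rewrite -thetaM !mulVg theta1. Qed.

Lemma gquot_mapE x : gquot_map theta H' (\pi_(gquot H) x) = \pi_(gquot H') (theta x).
Proof.
by apply/esym/gquotP; rewrite -thetaV -thetaM; apply: thetaH; exact: gquot_repr.
Qed.

Lemma gquot_mapM : {morph @gquot_map G G' theta H H' : a b / (a * b)%g}.
Proof.
move=> a b; elim/gquot_ind: a => a; elim/gquot_ind: b => b.
by rewrite [X in gquot_map _ _ X]gquot_mulE !gquot_mapE thetaM [RHS]gquot_mulE.
Qed.
End GquotMap.

Section CompletedGroupRing.
Variables (R : comNzRingType) (G : groupTopType).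

(* The inverse limit of the R[G / H] over the open normal subgroups H. *)
Record cgring := CGRing {
  cglev : forall H : onsubgroup G, galg R (gquot H);
  cgcompat : forall H H' : onsubgroup G, H `<=` H' ->
    mpush (@gquot_map G G id H H') (cglev H) = cglev H' }.

Lemma cgringP (l m : cgring) : (forall H, cglev l H = cglev m H) -> l = m.
Proof.
case: l m => [l lc] [m mc] /= lm.
have e : l = m by apply: functional_extensionality_dep.
subst m.
by congr CGRing; exact: Prop_irrelevance.
Qed.

HB.instance Definition _ := gen_eqMixin cgring.
HB.instance Definition _ := gen_choiceMixin cgring.

Let idM : {morph (@id G) : x y / (x * y)%g}. Proof. by []. Qed.

Program Definition cg0 := @CGRing (fun H => 0) _.
Next Obligation. by move=> *; exact: mint0. Qed.
Program Definition cg1 := @CGRing (fun H => 1) _.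
Next Obligation.
by move=> H H' HH'; rewrite [LHS]mintU [X in << X >>]gquot_mapE.
Qed.
Program Definition cgopp (l : cgring) := @CGRing (fun H => - cglev l H) _.
Next Obligation. by move=> l H H' HH'; rewrite [LHS]mintN [X in - X]cgcompat. Qed.
Program Definition cgadd (l m : cgring) :=
  @CGRing (fun H => cglev l H + cglev m H) _.
Next Obligation.
by move=> l m H H' HH'; rewrite [LHS]mintD; congr (_ + _); exact: cgcompat.
Qed.
Program Definition cgmul (l m : cgring) :=
  @CGRing (fun H => cglev l H * cglev m H) _.
Next Obligation.
move=> l m H H' HH'; rewrite mpushM; last exact: gquot_mapM.
by rewrite !(cgcompat _ HH').
Qed.
Program Definition cgscale (c : R) (l : cgring) :=
  @CGRing (fun H => c *: cglev l H) _.
Next Obligation. by move=> c l H H' HH'; rewrite [LHS]mintZ [X in _ *: X]cgcompat. Qed.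

Lemma cgaddA : associative cgadd.
Proof. by move=> l m n; apply: cgringP => H /=; rewrite addrA. Qed.
Lemma cgaddC : commutative cgadd.
Proof. by move=> l m; apply: cgringP => H /=; rewrite addrC. Qed.
Lemma cgadd0 : left_id cg0 cgadd.
Proof. by move=> l; apply: cgringP => H /=; rewrite add0r. Qed.
Lemma cgaddN : left_inverse cg0 cgopp cgadd.
Proof. by move=> l; apply: cgringP => H /=; rewrite addNr. Qed.
HB.instance Definition _ := GRing.isZmodule.Build cgring cgaddA cgaddC cgadd0 cgaddN.

Lemma cgmulA : associative cgmul.
Proof. by move=> l m n; apply: cgringP => H /=; rewrite mulrA. Qed.
Lemma cgmul1 : left_id cg1 cgmul.
Proof. by move=> l; apply: cgringP => H /=; rewrite mul1r. Qed.
Lemma cgmulr1 : right_id cg1 cgmul.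
Proof. by move=> l; apply: cgringP => H /=; rewrite mulr1. Qed.
Lemma cgmulDl : left_distributive cgmul +%R.
Proof. by move=> l m n; apply: cgringP => H /=; rewrite mulrDl. Qed.
Lemma cgmulDr : right_distributive cgmul +%R.
Proof. by move=> l m n; apply: cgringP => H /=; rewrite mulrDr. Qed.
HB.instance Definition _ := GRing.Zmodule_isPzRing.Build cgring
  cgmulA cgmul1 cgmulr1 cgmulDl cgmulDr.

Lemma cgscaleA a b l : cgscale a (cgscale b l) = cgscale (a * b) l.
Proof. by apply: cgringP => H /=; rewrite scalerA. Qed.
Lemma cgscale1 : left_id 1 cgscale.
Proof. by move=> l; apply: cgringP => H /=; rewrite scale1r. Qed.
Lemma cgscaleDr : right_distributive cgscale +%R.
Proof. by move=> c l m; apply: cgringP => H /=; rewrite scalerDr. Qed.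
Lemma cgscaleDl l : {morph cgscale^~ l : a b / a + b}.
Proof. by move=> a b; apply: cgringP => H /=; rewrite scalerDl. Qed.
HB.instance Definition _ := GRing.Zmodule_isLmodule.Build R cgring
  cgscaleA cgscale1 cgscaleDr cgscaleDl.

Lemma cgscaleAl (c : R) (l m : cgring) : c *: (l * m) = (c *: l) * m.
Proof. by apply: cgringP => H; exact: galg_scaleAl. Qed.
Lemma cgscaleAr (c : R) (l m : cgring) : c *: (l * m) = l * (c *: m).
Proof. by apply: cgringP => H; exact: galg_scaleAr. Qed.

Program Definition cgdirac (g : G) : cgring :=
  @CGRing (fun H => << \pi_(gquot H) g >>) _.
Next Obligation.
by move=> g H H' HH'; rewrite [LHS]mintU; congr << _ >>; exact: gquot_mapE.
Qed.

(* The endomorphism of R[[G]] induced by a continuous endomorphism theta. *)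
Section Functoriality.
Variable theta : G -> G.
Hypothesis thetaM : {morph theta : x y / (x * y)%g}.
Hypothesis thetaC : continuous theta.

Program Definition onpreim (H : onsubgroup G) : onsubgroup G :=
  @OnSubgroup G (theta @^-1` H) _ _ _ _ _.
Next Obligation.
by move=> H; apply: open_comp; [move=> x _; exact: thetaC|exact: on_open].
Qed.
Next Obligation. by move=> H; rewrite /preimage /= (theta1 thetaM); exact: on1. Qed.
Next Obligation. by move=> H g h Hg Hh; rewrite /preimage /= thetaM; exact: onM. Qed.
Next Obligation. by move=> H g Hg; rewrite /preimage /= (thetaV thetaM); exact: onV. Qed.
Next Obligation.
move=> H g h Hg; rewrite /preimage /= !thetaM (thetaV thetaM); exact: onJ.
Qed.

Program Definition cgmap (l : cgring) : cgring :=
  @CGRing (fun H => mpush (@gquot_map G G theta (onpreim H) H)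
                      (cglev l (onpreim H))) _.
Next Obligation.
move=> l H H' HH'; rewrite mpush_comp.
have le : onpreim H `<=` onpreim H' by move=> x; exact: HH'.
rewrite -(cgcompat l le) mpush_comp; apply: eq_mint => a; congr << _ >>.
elim/gquot_ind: a => a /=.
by rewrite !gquot_mapE.
Qed.
End Functoriality.

End CompletedGroupRing.

(* The topology of the inverse limit: that of pointwise convergence of the
   coefficients on the finite free modules R[G / H]. *)
Definition cgcoef (R : comRingTopType) (G : groupTopType) (l : cgring R G) :
    prod_topology (fun _ : {H : onsubgroup G & gquot H} => R : topologicalType) :=
  fun x => (cglev l (projT1 x))@_(projT2 x).

HB.instance Definition _ (R : comRingTopType) (G : groupTopType) :=
  Topological.copy (cgring R G) (initial_topology (@cgcoef R G)).

Section Reduction.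
Variables (R : comNzRingType) (G : groupTopType) (c : R).

Definition cgideal : {pred cgring R G} :=
  fun l : cgring R G => `[< exists m : cgring R G, l = c *: m >].

Lemma cgideal_zmod : zmod_closed cgideal.
Proof.
split=> [|l m]; rewrite !unfold_in; first by apply/asboolP; exists 0; rewrite scaler0.
move=> /asboolP[l' ->] /asboolP[m' ->]; apply/asboolP; exists (l' - m').
by rewrite scalerBr.
Qed.
HB.instance Definition _ := GRing.isZmodClosed.Build (cgring R G) cgideal cgideal_zmod.

Lemma cgidealMr (l m : cgring R G) : l \in cgideal -> l * m \in cgideal.
Proof.
rewrite !unfold_in => /asboolP[l' ->]; apply/asboolP.
by exists (l' * m); rewrite cgscaleAl.
Qed.

Lemma cgidealMl (l m : cgring R G) : m \in cgideal -> l * m \in cgideal.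
Proof.
rewrite !unfold_in => /asboolP[m' ->]; apply/asboolP.
by exists (l * m'); rewrite cgscaleAr.
Qed.

Definition cgred := Quotient.quot cgideal.
HB.instance Definition _ := GRing.Zmodule.on cgred.

Definition cgproj (l : cgring R G) : cgred := \pi_(Quotient.quot cgideal) l.

Definition cgred_mul (x y : cgred) : cgred :=
  cgproj ((repr x : cgring R G) * (repr y : cgring R G)).

Lemma cgprojE (l m : cgring R G) : (cgproj l = cgproj m) <-> (l - m \in cgideal).
Proof. by rewrite /cgproj Quotient.idealrBE; split=> /eqP. Qed.

Lemma cgprojK (x : cgred) : cgproj (repr x) = x.
Proof. exact: (@reprK _ (Quotient.quot cgideal)). Qed.

Lemma cgred_ind (P : cgred -> Prop) : (forall l, P (cgproj l)) -> forall x, P x.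
Proof. by move=> Pl x; rewrite -[x]cgprojK. Qed.

Lemma cgprojD (l m : cgring R G) : cgproj (l + m) = cgproj l + cgproj m.
Proof. exact: (raddfD \pi_(Quotient.quot cgideal)). Qed.

Lemma cgred_mulE (l m : cgring R G) : cgred_mul (cgproj l) (cgproj m) = cgproj (l * m).
Proof.
apply/cgprojE; set l' := repr (cgproj l); set m' := repr (cgproj m).
have -> : (l' : cgring R G) * m' - l * m = (l' - l) * m' + l * (m' - m).
  by rewrite mulrBl mulrBr addrA subrK.
by rewrite rpredD//; [apply: cgidealMr|apply: cgidealMl]; apply/cgprojE; exact: cgprojK.
Qed.

Lemma cgred_mulA : associative cgred_mul.
Proof.
move=> x y z; elim/cgred_ind: x => x; elim/cgred_ind: y => y.
by elim/cgred_ind: z => z; rewrite !cgred_mulE mulrA.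
Qed.
Lemma cgred_mul1 : left_id (cgproj 1) cgred_mul.
Proof. by elim/cgred_ind => x; rewrite cgred_mulE mul1r. Qed.
Lemma cgred_mulr1 : right_id (cgproj 1) cgred_mul.
Proof. by elim/cgred_ind => x; rewrite cgred_mulE mulr1. Qed.
Lemma cgred_mulDl : left_distributive cgred_mul +%R.
Proof.
move=> x y z; elim/cgred_ind: x => x; elim/cgred_ind: y => y.
by elim/cgred_ind: z => z; rewrite -cgprojD !cgred_mulE mulrDl cgprojD.
Qed.
Lemma cgred_mulDr : right_distributive cgred_mul +%R.
Proof.
move=> x y z; elim/cgred_ind: x => x; elim/cgred_ind: y => y.
by elim/cgred_ind: z => z; rewrite -cgprojD !cgred_mulE mulrDr cgprojD.
Qed.
HB.instance Definition _ := GRing.Zmodule_isPzRing.Build cgred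
  cgred_mulA cgred_mul1 cgred_mulr1 cgred_mulDl cgred_mulDr.

End Reduction.

Section QuotientTopology.
Variables (R : comRingTopType) (G : groupTopType) (c : R).

Definition cgred_open (U : set (cgred G c)) : Prop :=
  open (cgproj c @^-1` U : set (cgring R G)).

Lemma cgred_openT : cgred_open setT.
Proof. exact: openT. Qed.
Lemma cgred_openI : setI_closed cgred_open.
Proof. by move=> U U' oU oU'; exact: openI. Qed.
Lemma cgred_open_bigU (I : Type) (f : I -> set (cgred G c)) :
  (forall i, cgred_open (f i)) -> cgred_open (\bigcup_i f i).
Proof. by move=> of_; apply: bigcup_open => i _; exact: of_. Qed.
HB.instance Definition _ := isOpenTopological.Build (cgred G c)
  cgred_openT cgred_openI cgred_open_bigU.

End QuotientTopology.

Record GL (n : nat) (F : fieldType) :=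
  MkGL { glmx :> 'M[F]_n; glmxP : glmx \in unitmx }.

Section GLGroup.
Variables (n : nat) (F : fieldType).
Local Notation G := (GL n F).

HB.instance Definition _ := [isSub of G for @glmx n F].
HB.instance Definition _ := [Choice of G by <:].

Definition gl1 : G := MkGL (unitmx1 F n).
Lemma gl_mul_subproof (g h : G) : glmx g *m glmx h \in unitmx.
Proof. by rewrite unitmx_mul !glmxP. Qed.
Definition gl_mul (g h : G) : G := MkGL (gl_mul_subproof g h).
Lemma gl_inv_subproof (g : G) : invmx (glmx g) \in unitmx.
Proof. by rewrite unitmx_inv glmxP. Qed.
Definition gl_inv (g : G) : G := MkGL (gl_inv_subproof g).

Lemma gl_mulA : associative gl_mul.
Proof. by move=> a b c; apply: val_inj; rewrite /= mulmxA. Qed.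
Lemma gl_mul1 : left_id gl1 gl_mul.
Proof. by move=> a; apply: val_inj; rewrite /= mul1mx. Qed.
Lemma gl_mulr1 : right_id gl1 gl_mul.
Proof. by move=> a; apply: val_inj; rewrite /= mulmx1. Qed.
Lemma gl_mulV : left_inverse gl1 gl_inv gl_mul.
Proof. by move=> a; apply: val_inj; rewrite /= mulVmx// glmxP. Qed.
Lemma gl_mulVr : right_inverse gl1 gl_inv gl_mul.
Proof. by move=> a; apply: val_inj; rewrite /= mulmxV// glmxP. Qed.
HB.instance Definition _ := isGroup.Build G
  gl_mulA gl_mul1 gl_mulr1 gl_mulV gl_mulVr.

Definition upper (g : G) : bool := is_trig_mx (glmx g)^T.
Definition borel : set G := [set g | upper g].
Definition torus : set G := [set g | is_diag_mx (glmx g)].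
Definition unipotent : set G := [set g | upper g /\ forall i, glmx g i i = 1].

(* the diagonal part of b, i.e. the map B -> B/[B,B] ~ T *)
Definition diag_part (b : G) : G :=
  insubd (1%g : G) (diag_mx (\row_i glmx b i i)).

Definition w0 : G := MkGL (unitmx_perm F (perm (@rev_ord_inj n))).

Lemma upperP (g : G) : reflect (forall i j : 'I_n, (j < i)%N -> glmx g i j = 0) (upper g).
Proof.
apply: (iffP idP) => [/is_trig_mxP H i j ji|H].
  by have := H j i ji; rewrite mxE.
by apply/is_trig_mxP => i j ij; rewrite mxE H.
Qed.

Lemma unipotentM (g h : G) : unipotent g -> unipotent h -> unipotent (g * h)%g.
Proof.
move=> [/upperP gu g1] [/upperP hu h1]; split.
  apply/upperP => i j ji; rewrite mxE big1// => k _.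
  have [ki|ik] := ltnP k i; first by rewrite gu// mul0r.
  by rewrite hu ?mulr0//; exact: leq_trans ik.
move=> i; rewrite mxE (bigD1 i)//= g1 h1 mulr1 big1 ?addr0// => k ki.
have [lt|le] := ltnP k i; first by rewrite gu// mul0r.
by rewrite hu ?mulr0// ltn_neqAle eq_sym ki.
Qed.

Lemma unipotentV (g : G) : unipotent g -> unipotent g^-1%g.
Proof.
move=> [/upperP gu g1]; set c := glmx (g^-1%g).
have cg : c *m glmx g = 1%:M by rewrite /c /= mulVmx// glmxP.
have E i j : \sum_(k < n) c i k * glmx g k j = (i == j)%:R.
  by have /matrixP/(_ i j) := cg; rewrite !mxE.
have cu : forall m (i j : 'I_n), (j < m)%N -> (j < i)%N -> c i j = 0.
  elim=> [//|m IH] i j jm ji; have := E i j.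
  rewrite (bigD1 j)//= g1 mulr1 big1 ?addr0.
    by move=> ->; case: eqVneq => // ij; rewrite ij ltnn in ji.
  move=> k kj; have [lt|le] := ltnP k j; last first.
    by rewrite gu ?mulr0// ltn_neqAle eq_sym kj.
  have km : (k < m)%N by lia.
  have ki : (k < i)%N by lia.
  by rewrite (IH _ _ km ki) mul0r.
split=> [|j]; first by apply/upperP => i j; exact: (cu n).
have := E j j; rewrite (bigD1 j)//= g1 mulr1 eqxx big1 ?addr0// => k kj.
have [lt|le] := ltnP k j; first by rewrite (cu n) ?mul0r.
by rewrite gu ?mulr0// ltn_neqAle eq_sym kj.
Qed.

End GLGroup.

Section Integral.
Variables (n : nat) (F : valuedFieldType).
Local Notation G := (GL n F).

Definition integral (g : G) : Prop := forall i j, glmx g i j \in @ointeger F.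

(* GL_n(o) and the kernel of its reduction modulo the maximal ideal *)
Definition G0 : set G := [set g | integral g /\ integral g^-1%g].
Definition U1 : set G :=
  [set g | G0 g /\ forall i j, vge 1 ((glmx g - 1%:M) i j)].

Definition N0 : set G := unipotent (n := n) (F := F) `&` G0.
Definition Tplus : set G :=
  [set t | torus t /\ forall u, N0 u -> N0 (t * u * t^-1)%g].
Definition Bplus : set G :=
  [set b | exists u t, [/\ N0 u, Tplus t & b = (u * t)%g]].

Lemma integralM (g h : G) : integral g -> integral h -> integral (g * h)%g.
Proof.
move=> gi hi i j; rewrite mxE rpred_sum// => k _.
by rewrite rpredM ?gi ?hi.
Qed.

Lemma N0_1 : N0 1%g.
Proof.
have i1 : integral 1%g by move=> i j; rewrite mxE; case: eqP => _; rewrite ?rpred1 ?rpred0.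
split; last by split; rewrite ?invg1.
split; first by apply/upperP => i j ji; rewrite mxE -val_eqE gtn_eqF.
by move=> i; rewrite mxE eqxx.
Qed.

Lemma N0_M (g h : G) : N0 g -> N0 h -> N0 (g * h)%g.
Proof.
move=> [ug [ig ig']] [uh [ih ih']]; split; first exact: unipotentM.
by split; rewrite ?invgM; exact: integralM.
Qed.

Lemma N0_V (g : G) : N0 g -> N0 g^-1%g.
Proof.
by move=> [ug [ig ig']]; split; [exact: unipotentV|split; rewrite ?invgK].
Qed.

Record N0grp := MkN0 { n0val :> G; n0valP : n0val \in N0 }.
HB.instance Definition _ := [isSub of N0grp for n0val].
HB.instance Definition _ := [Choice of N0grp by <:].

Lemma N0_group : group_closed (fun g : G => g \in N0).
Proof.
split; first by rewrite unfold_in; exact/mem_set/N0_1.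
move=> g h; rewrite !unfold_in => /set_mem Ng /set_mem Nh.
by apply/mem_set; apply: N0_M => //; exact: N0_V.
Qed.
HB.instance Definition _ := SubChoice_isSubGroup.Build G _ N0grp N0_group.

Lemma n0valM (u v : N0grp) : n0val (u * v)%g = (n0val u * n0val v)%g.
Proof. by []. Qed.

Definition conjN0 (t : G) (tP : Tplus t) (u : N0grp) : N0grp :=
  MkN0 (mem_set (tP.2 (n0val u) (set_mem (n0valP u)))).

Lemma conjN0M (t : G) (tP : Tplus t) :
  {morph conjN0 tP : u v / (u * v)%g}.
Proof.
move=> u v; apply: val_inj; rewrite /= !mulgA; congr (_ * _)%g.
by rewrite mulgVK.
Qed.

End Integral.

Section GLTopology.
Variables (p : nat) (Q : padicType p) (F : padicExtType Q).

HB.instance Definition _ :=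
  Topological.copy (oring F) (initial_topology (@oval F)).

Variable n : nat.
HB.instance Definition _ :=
  Topological.copy (GL n F) (initial_topology (@glmx n F)).
HB.instance Definition _ :=
  Topological.copy (N0grp n F) (initial_topology (@n0val n F)).

Lemma vge_vord (x : F) : vge (vord x) x.
Proof. by rewrite /vge lexx orbT. Qed.

Lemma mxtwosided_continuous (A B : 'M[F]_n) :
  continuous (fun M : 'M[F]_n => A *m M *m B).
Proof.
move=> M S [P MP PS].
have /boolp.choice[k kP] (ij : 'I_n * 'I_n) : exists k : int, forall y,
    vge k (y - (A *m M *m B) ij.1 ij.2) -> P ij.1 ij.2 y.
  exact: (nbhs_vord _ _).1 (MP ij.1 ij.2).
pose S' a b : set F := [set y | forall ij : 'I_n * 'I_n,
  vge (k ij) (A ij.1 a * (y - M a b) * B b ij.2)].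
exists S'.
  move=> a b; apply/nbhs_vord.
  exists (\sum_ij `|k ij - vord (A ij.1 a) - vord (B b ij.2)|) => y yM ij.
  pose l := k ij - vord (A ij.1 a) - vord (B b ij.2).
  have lle : l <= \sum_ij `|k ij - vord (A ij.1 a) - vord (B b ij.2)|.
    rewrite (bigD1 ij)//= -/l; apply: le_trans (ler_norm l) _.
    by rewrite lerDl sumr_ge0.
  have -> : k ij = vord (A ij.1 a) + l + vord (B b ij.2) by rewrite /l; lia.
  by apply: vgeM (vge_vord _); apply: vgeM (vge_vord _) _; exact: vge_le yM.
move=> M' M'S; apply: PS => i j; apply: (kP (i, j)) => /=.
rewrite -[X in vge _ X]/((A *m M' *m B) i j - (A *m M *m B) i j).
have -> : (A *m M' *m B) i j - (A *m M *m B) i j = (A *m (M' - M) *m B) i j.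
  by rewrite mulmxBr mulmxBl !mxE.
rewrite mxE; apply: vge_sum => b _; rewrite mxE mulr_suml.
by apply: vge_sum => a _; have := M'S a b (i, j); rewrite !mxE.
Qed.

Lemma conjN0_continuous (t : GL n F) (tP : Tplus t) : continuous (conjN0 tP).
Proof.
have cn0 : continuous (@n0val n F : N0grp n F -> GL n F).
  exact: initial_continuous.
have cgl : continuous (@glmx n F : GL n F -> 'M[F]_n).
  exact: initial_continuous.
apply: (@continuous_comp_initial _ _ _ (@n0val n F)).
apply: (@continuous_comp_initial _ _ _ (@glmx n F)).
move=> u.
apply: (@continuous_comp _ _ _ (fun u => glmx (n0val u))
  (fun M => glmx t *m M *m invmx (glmx t))); last exact: mxtwosided_continuous.
by apply: continuous_comp; [exact: cn0|exact: cgl].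
Qed.

End GLTopology.

Notation Lambda n F K := (cgring (oring K) (N0grp n F)).
Notation Omega n F piK := (cgred (N0grp n F) piK).

Section Phi.
Variables (p : nat) (Q : padicType p) (F K : padicExtType Q) (n : nat).
Variable piK : oring K.

Definition phiLambda (t : GL n F) (tP : Tplus t) (l : Lambda n F K) :
    Lambda n F K :=
  cgmap (conjN0M tP) (conjN0_continuous (tP := tP)) l.

Definition phiOmega (t : GL n F) (tP : Tplus t) (w : Omega n F piK) :
    Omega n F piK :=
  cgproj piK (phiLambda tP (repr w)).

Lemma phiOmegaE (t : GL n F) (tP : Tplus t) (l : Lambda n F K) :
  phiOmega tP (cgproj piK l) = cgproj piK (phiLambda tP l).
Proof.
apply/cgprojE; set l' := repr _.
have : l' - l \in cgideal piK by apply/cgprojE; exact: cgprojK.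
rewrite !unfold_in => /asboolP[m /eqP]; rewrite subr_eq => /eqP ->.
apply/asboolP; exists (phiLambda tP m); apply: cgringP => H /=.
by rewrite /mpush mintD mintZ addrK.
Qed.
End Phi.

Section Etale.
Variables (p : nat) (Q : padicType p) (F K : padicExtType Q) (n : nat).
Variable piK : oring K.
Local Notation G := (GL n F).

(* N_0 / t N_0 t^-1 as a set of subsets of G *)
Definition conj_cosets (t : G) : set (set G) :=
  [set [set (u * (t * v * t^-1))%g | v in @N0 n F] | u in @N0 n F].

(* [bact b], for b in B_+, is the action of b; it is phi_t for b = t in T_+.
   The values of [bact] outside B_+, and those of [psi] outside T_+, are
   irrelevant. *)
Record etale_module := EtaleModule {
  em_sort :> topModType (Omega n F piK);
  bact : G -> em_sort -> em_sort;
  psi : G -> em_sort -> em_sort;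
  bact_continuous :
    continuous (fun z : set_type (@Bplus n F) * em_sort => bact (val z.1) z.2);
  bact1 : forall d, bact 1%g d = d;
  bactM : forall b c d, Bplus b -> Bplus c ->
    bact (b * c)%g d = bact b (bact c d);
  bactD : forall b d e, Bplus b -> bact b (d + e) = bact b d + bact b e;
  bact_N0 : forall (u : N0grp n F) d,
    bact (n0val u) d = cgproj piK (cgdirac (oring K) u) *: d;
  bact_phi : forall t (tP : Tplus t) (w : Omega n F piK) d,
    bact t (w *: d) = phiOmega tP w *: bact t d;
  phi_inj : forall t, Tplus t -> injective (bact t);
  (* D is the direct sum of the u phi_t(D), u in N_0 / t N_0 t^-1 *)
  phi_etale : forall t, Tplus t -> forall d, exists! s : set G -> em_sort,
    [/\ forall C, conj_cosets t C -> exists u e, C u /\ s C = bact u (bact t e),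
        forall C, ~ conj_cosets t C -> s C = 0,
        finite_set [set C | s C != 0] &
        d = \sum_(C \in conj_cosets t) s C];
  psiD : forall t d e, Tplus t -> psi t (d + e) = psi t d + psi t e;
  psi_phi : forall t d, Tplus t -> psi t (bact t d) = d;
  psi_uphi : forall t u d, Tplus t -> N0 u ->
    ~ (exists2 v, N0 v & u = (t * v * t^-1)%g) -> psi t (bact u (bact t d)) = 0;
  psi_continuous : forall t, Tplus t -> continuous (psi t) }.

Variable D : etale_module.

Definition torsion_free : Prop :=
  forall (w : Omega n F piK) (d : D), w *: d = 0 -> w = 0 \/ d = 0.

Definition submodule (O : set D) : Prop :=
  O 0 /\ forall (w : Omega n F piK) d e, O d -> O e -> O (w *: d + e).

Definition phi_invariant_basis : Prop :=
  forall U : set D, nbhs (0 : D) U -> exists O : set D,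
    [/\ open O, O `<=` U, submodule O &
        forall t d, Tplus t -> O d -> O (bact t d)].

End Etale.

Definition locally_constant (X : topologicalType) (Y : Type) (f : X -> Y) :=
  forall x, \forall y \near x, f y = f x.

Section PrincipalSeries.
Variables (p : nat) (Q : padicType p) (F K : padicExtType Q) (n : nat).
Local Notation G := (GL n F).
Local Notation k := (resfield K).

(* The character T -> k^* is given by a function on G, of which only the values
   on T are used. *)
Definition smooth_character (chi : G -> k) : Prop :=
  [/\ forall t, torus t -> chi t != 0,
      forall s t, torus s -> torus t -> chi (s * t)%g = chi s * chi t &
      locally_constant (fun t : set_type (@torus n F) => chi (val t))].

Definition gact (g : G) (f : G -> k) : G -> k := fun x => f (g^-1 * x)%g.

Variable chi : G -> k.

Definition Ind : set (G -> k) := [set f | locally_constant f /\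
  forall g b, borel b -> f (g * b)%g = (chi (diag_part b))^-1 * f g].

Definition Ind_U1 : set (G -> k) :=
  [set f | Ind f /\ forall u, U1 u -> gact u f = f].

(* M_0 = B_+ V^{U^(1)} *)
Definition M0 : set (G -> k) := [set f | exists (m : nat) (c : 'I_m -> k)
    (b : 'I_m -> G) (v : 'I_m -> G -> k),
  [/\ forall i, Bplus (b i), forall i, Ind_U1 (v i) &
      forall x, f x = \sum_(i < m) c i * gact (b i) (v i) x]].

(* M_{0,n!-1} *)
Definition M0w : set (G -> k) := [set f | Ind f /\
  forall g, f g != 0 -> exists u b, [/\ N0 u, borel b & g = (u * @w0 n F * b)%g]].

End PrincipalSeries.

Section Dual.
Variables (p : nat) (Q : padicType p) (F K : padicExtType Q) (n : nat).
Local Notation G := (GL n F).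
Local Notation k := (resfield K).
Variable M : set (G -> k).

(* The ring oring K acts on G -> k through its residue field. *)
Definition linear_on : {pred (M -> fracmod K)} := fun f : M -> fracmod K =>
  `[< forall (a : oring K) (x y z : M),
        (forall g, val z g = residue a * val x g + val y g) ->
        f z = a *: f x + f y >].

Lemma linear_on_zmod : zmod_closed linear_on.
Proof.
split=> [|f g]; rewrite !unfold_in.
  by apply/asboolP => a x y z _; rewrite scaler0 addr0.
move=> /asboolP fl /asboolP gl; apply/asboolP => a x y z e.
rewrite -[(f - g) z]/(f z - g z) (fl _ _ _ _ e) (gl _ _ _ _ e).
by rewrite -[(f - g) x]/(f x - g x) -[(f - g) y]/(f y - g y) scalerBr opprD addrACA.
Qed.
HB.instance Definition _ := GRing.isZmodClosed.Build _ linear_on linear_on_zmod.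

(* The Pontrjagin dual M^* = Hom(M, K / oring K). As M0 and M0w are the smallest
   elements of B_+(V) and of B_+(V_{n!-1}), the limits of the M^* over these sets
   are D(V) = dual (M0 chi) and D(V_{n!-1}) = dual (M0w chi). *)
Record dual := Dual { dualval :> M -> fracmod K; dualvalP : dualval \in linear_on }.
HB.instance Definition _ := [isSub of dual for dualval].
HB.instance Definition _ := [Choice of dual by <:].
HB.instance Definition _ := [SubChoice_isSubZmodule of dual by <:].

(* Its topology: M being discrete, that of pointwise convergence in the
   discrete module K / oring K. *)
Definition dual_open (U : set dual) : Prop :=
  forall f, U f -> exists s : seq M,
    forall g : dual, (forall x, x \in s -> g x = f x) -> U g.

Lemma dual_openT : dual_open setT.
Proof. by move=> f _; exists [::]. Qed.
Lemma dual_openI : setI_closed dual_open.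
Proof.
move=> U U' oU oU' f [/oU[s sU] /oU'[s' sU']]; exists (s ++ s') => g gf.
by split; [apply: sU|apply: sU'] => x xs; apply: gf; rewrite mem_cat xs ?orbT.
Qed.
Lemma dual_open_bigU (I : Type) (U : I -> set dual) :
  (forall i, dual_open (U i)) -> dual_open (\bigcup_i U i).
Proof.
by move=> oU f [i _ /oU[s sU]]; exists s => g gf; exists i => //; exact: sU.
Qed.
HB.instance Definition _ := isOpenTopological.Build dual
  dual_openT dual_openI dual_open_bigU.

(* [f] extended by 0 outside M *)
Definition dual_ext (f : dual) (x : G -> k) : fracmod K :=
  oapp f 0 (insub x : option M).

(* (psi_t f)(x) = f(t x). Here and below, [insubd 0] turns a function on M
   into a functional: for the modules M0 and M0w the function is linear. *)
Definition dual_psi (t : G) (f : dual) : dual :=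
  insubd 0 (fun x : M => dual_ext f (gact t (val x))).

Definition fixes (H : onsubgroup (N0grp n F)) (x : G -> k) : Prop :=
  forall u, onset H u -> gact (n0val u) x = x.

(* The action of Lambda(N_0) on M^* through inversion on N_0: if l has the image
   sum_q l_q q in the group ring of N_0 / H, where H fixes x, then
   (l f)(x) = sum_q l_q f(q^-1 x). The modules M0 and M0w are smooth, so that
   every x is fixed by such an H; the sum does not depend on its choice. *)
Definition dual_scale (l : Lambda n F K) (f : dual) : dual :=
  insubd 0 (fun x : M =>
    if pselect (exists H, fixes H (val x)) is left e then
      mint (cglev l (sval (cid e)))
        (fun q => dual_ext f (gact (n0val (repr q))^-1%g (val x)))
    else 0).

End Dual.

(* Used for M' = M0w chi, which is contained in M = M0 chi. *)
Definition dual_restr (p : nat) (Q : padicType p) (F K : padicExtType Q) (n : nat)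
    (M M' : set (GL n F -> resfield K)) (f : dual M) : dual M' :=
  insubd 0 (fun x : M' => dual_ext f (val x)).

Section Homs.
Variables (p : nat) (Q : padicType p) (F K : padicExtType Q) (n : nat).
Variables (piK : oring K) (M : set (GL n F -> resfield K)).
Variables (D : etale_module F n piK) (f : dual M -> D).

(* M^* is killed by piK, so that its Omega(N_0)-action is given by that of
   Lambda(N_0). *)
Definition Omega_hom : Prop :=
  (forall x y, f (x + y) = f x + f y) /\
  (forall (l : Lambda n F K) x, f (dual_scale l x) = cgproj piK l *: f x).

Definition psi_invariant : Prop :=
  forall t x, Tplus t -> f (dual_psi t x) = psi t (f x).

End Homs.

(* Main.v *)
(* A functional on M_0 is a limit of combinations of the functionals
   delta_g : x |-> x(g), with values in the pi-torsion of K / o_K, and on finitely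
   many elements of M_0 a functional that vanishes on M_{0,n!-1} is a combination
   of delta_g with g outside N_0 w_0 B.  So the claim is that F kills these delta_g;
   then H is F composed with the transpose of x |-> x 1_{N_0 w_0 B}.

   If some u <> 1 in N_0 fixes gB, then (u - 1) delta_g = 0, and F(delta_g) = 0 as D
   is torsion-free.  Such a u exists as soon as a trailing block of X = g w_0 is
   singular, and otherwise g lies in the big cell N w_0 B.  For g = v w_0 with v in
   N but not in N_0, let O be an open phi-invariant submodule of D.  Since
   psi_t(u^-1 F(delta_g)) = F(delta_{t^-1 u^-1 g}), the etale decomposition puts
   F(delta_g) in O once all the F(delta_{t^-1 u^-1 g}) are in O.  When t contracts
   strongly, Y = t^-1 u^-1 v t has an entry of very negative valuation, and a matrix
   h close to 1 makes a trailing block of h Y singular; so delta_{Y w_0} agrees with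
   a functional killed by F on any given finite subset of M_0.

   That M_{0,n!-1} is contained in M_0 needs the compactness of N_0, which is used
   in the form of limits along an ultrafilter on nat. *)
Require Import Defs.
From mathcomp Require Import all_boot all_order perm all_algebra all_field zify ring.
From mathcomp Require Import finmap all_classical topology.
From mathcomp.multinomials Require Import monalg.

Set Implicit Arguments.
Unset Strict Implicit.
Unset Printing Implicit Defensive.

Import Order.TTheory GRing.Theory Num.Theory.
Local Open Scope classical_set_scope.
Local Open Scope quotient_scope.
Local Open Scope ring_scope.

(** * Ultralimits in p-adic fields *)

Section Valuations.
Variable F : valuedFieldType.
Implicit Types x y : F.

Lemma vge_all x : (forall k : nat, vge k%:Z x) -> x = 0.
Proof.
move=> h; apply/eqP; have [//|x0] := eqVneq x 0.
have := h `|vord x|.+1; rewrite /vge (negPf x0) /=; lia.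
Qed.

Lemma vge_exists (I : finType) (a : I -> F) :
  exists c : nat, forall i, vge (- c%:Z) (a i).
Proof.
exists (\sum_i `|vord (a i)|)%N => i.
rewrite /vge; apply/orP; right.
have : (`|vord (a i)| <= \sum_i `|vord (a i)|)%N by rewrite (bigD1 i)//= leq_addr.
lia.
Qed.

(** Valuations are integers, so the negated bound says [vord x <= - k]. *)
Lemma vge_inv x k : x != 0 -> ~~ vge (1 - k) x -> vge k x^-1.
Proof.
move=> x0; rewrite /vge (negPf x0) /= invr_eq0 (negPf x0) /= => h.
have := vordM _ _ x0 (invr_neq0 x0); rewrite divff// vord1; lia.
Qed.

Lemma vge_nat k (m : nat) : k <= 0 -> vge k (m%:R : F).
Proof.
move=> k0; elim: m => [|m IH]; first exact: vge0.
by rewrite -addn1 natrD vgeD//; apply: vge_le (vge1 F).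
Qed.

Lemma exists_vord (k : int) : exists2 x : F, x != 0 & vord x = k.
Proof.
have [x x0 x1] := @vord_unif F.
have pw (n : nat) : vord (x ^+ n) = n.
  elim: n => [|n IH]; first by rewrite expr0 vord1.
  by rewrite exprS vordM ?expf_neq0// x1 IH; lia.
case: k => [n|n]; first by exists (x ^+ n); rewrite ?expf_neq0 ?pw.
exists (x ^+ n.+1)^-1; first by rewrite invr_neq0 ?expf_neq0.
have xn : x ^+ n.+1 != 0 by rewrite expf_neq0.
have := vordM _ _ xn (invr_neq0 xn); rewrite divff// vord1 pw; lia.
Qed.

End Valuations.

Section UltraLimits.
Variables (U : set_system nat) (UU : UltraFilter U) (Uoo : \oo `<=` U).

(** Convergence along the ultrafilter [U]. Limits along one fixed [U] replace the extraction of
    convergent subsequences, so that several sequences can be treated at the same time. *)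
Definition ulim (F : valuedFieldType) (x : nat -> F) (l : F) :=
  forall k : nat, U [set i | vge k%:Z (x i - l)].

Let pU : ProperFilter U. Proof. exact: ultra_proper. Qed.

Lemma ulim_vge (F : valuedFieldType) (x : nat -> F) (l : F) (k : int) :
  ulim x l -> U [set i | vge k (x i - l)].
Proof.
move=> h; apply: filterS (h `|k|%N) => i /=; apply: vge_le; lia.
Qed.

Lemma ulim_integral (F : valuedFieldType) (x : nat -> F) (l : F) (k : int) :
  (forall i, vge k (x i)) -> ulim x l -> vge k l.
Proof.
move=> hx /(@ulim_vge _ _ _ k)/filter_ex[i /= h].
by rewrite -[l](subKr (x i)) vgeB.
Qed.

(** Pigeonhole for ultrafilters: otherwise [U] would contain the complements of all the pieces,
    whose intersection is empty. *)
Lemma ultra_fin (I : finType) (A : I -> set nat) :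
  (forall i, exists j, A j i) -> exists j, U (A j).
Proof.
move=> cov; apply: contrapT => no.
have h : \forall i \near U, forall j, ~ A j i.
  apply: filter_forall => j.
  by have [uj|//] := in_ultra_setVsetC (A j) UU; case: no; exists j.
by have [i ni] := filter_ex h; have [j /ni] := cov i.
Qed.

Section Padic.
Variables (p : nat) (p_prime : prime p) (Q : padicType p).

Lemma vge_int_padic (k : nat) (z : int) :
  (p ^ k %| `|z|)%N -> vge k%:Z (z%:~R : Q).
Proof.
move=> pz; rewrite [z]intEsign rmorphM /= rmorph_sign.
suff : vge k%:Z (`|z|%N%:R : Q).
  by case: (z < 0)%R; rewrite ?expr1 ?expr0 ?mulN1r ?vgeN ?mul1r -pmulrn.
have [->|z0] := posnP `|z|%N; first exact: vge0.
have [_ e] := @vord_nat p Q _ z0; rewrite /vge e.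
by apply/orP; right; rewrite lez_nat -pfactor_dvdn.
Qed.

Lemma vge_int_padicN (z : int) : ~~ (p %| `|z|)%N ->
  (z%:~R : Q) != 0 /\ vord (z%:~R : Q) = 0.
Proof.
move=> pz; have z0 : (0 < `|z|)%N by case: posnP pz => // ->; rewrite dvdn0.
have [n0 e] := @vord_nat p Q _ z0; have l0 : logn p `|z| = 0%N.
  by apply/eqP; rewrite eqn0Ngt -pfactor_dvdn// expn1.
rewrite [z]intEsign rmorphM /= rmorph_sign -pmulrn; case: (z < 0)%R.
  rewrite expr1 mulN1r oppr_eq0 n0; split => //.
  by rewrite -mulN1r vordM ?oppr_eq0 ?oner_neq0// vordN1 e l0.
by rewrite expr0 mul1r e l0.
Qed.

(** Approximate [x] by a rational [r]. As [r] is integral and in lowest terms, its denominator is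
    prime to p, and Bezout inverts it modulo [p ^ k]. *)
Lemma padic_digits (k : nat) (x : Q) : vge 0 x ->
  exists a : 'I_(p ^ k), vge k%:Z (x - (a : nat)%:R).
Proof.
move=> x0; have [r xr] := rat_dense x k%:Z.
have r0 : vge 0 (ratr r : Q).
  by rewrite -[ratr r](subKr x) vgeB//; apply: vge_le xr.
have pk0 : (0 < p ^ k)%N by rewrite expn_gt0 prime_gt0.
have dn : ~~ (p %| `|denq r|)%N.
  apply/negP => pd; have pn : ~~ (p %| `|numq r|)%N.
    apply/negP => pn; have := coprime_num_den r.
    rewrite /coprime => /eqP g1; have := dvdn_gcd p `|numq r| `|denq r|.
    by rewrite pd pn g1 dvdn1 => /eqP p1; move: p_prime; rewrite p1.
  have [n0 vn] := vge_int_padicN pn.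
  have d0 : ((denq r)%:~R : Q) != 0.
    have dp : (0 < `|denq r|)%N by rewrite absz_gt0 denq_neq0.
    have [+ _] := @vord_nat p Q _ dp.
    by rewrite -{2}(gez0_abs (denq_ge0 r)) -pmulrn.
  have pd1 : vge 1 ((denq r)%:~R : Q) by apply: (@vge_int_padic 1); rewrite expn1.
  have : (numq r)%:~R = ratr r * (denq r)%:~R :> Q by rewrite /ratr divfK.
  move=> e; have : vge (0 + 1) ((numq r)%:~R : Q) by rewrite e vgeM.
  by rewrite /vge (negPf n0) vn.
have [d0 vd] := vge_int_padicN dn.
have /coprimezP[[u v] /= uv] : coprimez (denq r) (p ^ k)%N.
  have : coprime `|denq r| (p ^ k) by rewrite coprimeXr// coprime_sym prime_coprime.
  by rewrite /coprime /coprimez /gcdz => /eqP/= ->.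
(* By [uv], [u] is the inverse of the denominator modulo [p ^ k], so [m] represents [r] there. *)
pose m := (numq r * u %% (p ^ k)%N)%Z.
have pz : (p ^ k)%N%:Z != 0 by lia.
have m0 : 0 <= m by exact: modz_ge0.
have mp : (`|m| < p ^ k)%N by have := ltz_mod (numq r * u) pz; rewrite -/m; lia.
exists (Ordinal mp) => /=.
rewrite -[x](subrK (ratr r)) -addrA vgeD//.
have -> : ratr r - `|m|%N%:R = (numq r - m * denq r)%:~R / (denq r)%:~R :> Q.
  rewrite rmorphB rmorphM /= mulrBl mulfK// /ratr; congr (_ - _).
  by rewrite -{2}(gez0_abs m0) -pmulrn.
rewrite -[k%:Z]addr0; apply: vgeM.
  apply: vge_int_padic.
  have -> : numq r - m * denq r
      = (numq r * v + (numq r * u %/ (p ^ k)%N)%Z * denq r) * (p ^ k)%N.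
    have := divz_eq (numq r * u) (p ^ k)%N; rewrite -/m.
    set q := (_ %/ _)%Z; set P := Posz _ => e.
    have e' : m = numq r * u - q * P by rewrite e addrC addKr.
    rewrite e' -[X in X - _]mulr1 -uv -/P; ring.
  by rewrite abszM dvdn_mull.
by apply: vge_inv; rewrite // /vge (negPf d0) vd.
Qed.

(** Compactness of Z_p. For each [k] one of the finitely many residue classes modulo [p ^ k] is met
    along [U]; the representatives chosen form a Cauchy sequence, because any two sets of [U] meet,
    and its limit is the ultralimit. *)
Lemma padic_ulim (x : nat -> Q) : (forall i, vge 0 (x i)) ->
  exists l, ulim x l.
Proof.
move=> x0.
have /boolp.choice[a aP] (k : nat) :
    exists a : nat, U [set i | vge k%:Z (x i - a%:R)].
  have [//|a aU] := @ultra_fin 'I_(p ^ k)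
    (fun a => [set i | vge k%:Z (x i - (a : nat)%:R)]).
    by move=> i; apply: padic_digits.
  by exists a.
have aC (k i j : nat) : (k <= i)%N -> (k <= j)%N ->
    vge k%:Z ((a i)%:R - (a j)%:R : Q).
  move=> ki kj; have [y [/= yi yj]] := filter_ex (filterI (aP i) (aP j)).
  have -> : (a i)%:R - (a j)%:R = (x y - (a j)%:R) - (x y - (a i)%:R) :> Q.
    by ring.
  by apply: vgeB; [apply: vge_le yj|apply: vge_le yi].
have [k|l lP] := @padic_complete p Q (fun k => (a k)%:R).
  exists `|k|%N => i j ki kj; apply: vge_le (aC `|k|%N _ _ ki kj); lia.
exists l => k; have [N NP] := lP k%:Z.
apply: filterS (aP (maxn N k)) => i /= h.
rewrite -[x i](subrK (a (maxn N k))%:R) -addrA vgeD//.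
  by apply: vge_le h; lia.
by apply: NP; lia.
Qed.

End Padic.

Section PadicExt.
Variables (p : nat) (Q : padicType p) (F : padicExtType Q).

(** The valuation gets multiplied by the ramification index, which preserves a lower bound when that
    bound is nonnegative; hence [k : nat]. *)
Lemma vge_alg (k : nat) (a : Q) : vge k%:Z a -> vge k%:Z (a%:A : F).
Proof.
have [->|a0] := eqVneq a 0; first by rewrite scale0r !vge0.
have [e e0 eP] := @vord_ramif p Q F.
rewrite /vge (negPf a0) /= eP//= => ka; apply/orP; right.
have h0 := le_trans (isT : 0 <= k%:Z) ka; nia.
Qed.

Lemma vge_scale (k : int) (l : nat) (a : Q) (y : F) :
  vge l%:Z a -> vge k y -> vge (l%:Z + k) (a *: y).
Proof. by move=> /vge_alg la ky; rewrite -mulr_algl vgeM. Qed.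

Local Notation d := (\dim {:F}).
Local Notation e := (vbasis {:F}).

Definition lincomb (a : 'I_d -> Q) : F := \sum_j a j *: e`_j.

Lemma lincomb_eq0 (a : 'I_d -> Q) : lincomb a = 0 -> forall j, a j = 0.
Proof. by move=> a0; apply: (elimT freeP (basis_free (vbasisP {:F}))) a0. Qed.

Lemma lincombB a b : lincomb (fun j => a j - b j) = lincomb a - lincomb b.
Proof. by rewrite -sumrB; apply: eq_bigr => j _; rewrite scalerBl. Qed.

Lemma lincombZ c a : lincomb (fun j => c * a j) = c *: lincomb a.
Proof. by rewrite scaler_sumr; apply: eq_bigr => j _; rewrite scalerA. Qed.

Lemma lincomb_coord (x : F) : x = lincomb (fun j => coord e j x).
Proof. exact: coord_vbasis (memvf x). Qed.

(** Continuity of [lincomb] at 0: [c] absorbs the poles of the basis vectors. *)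
Lemma lincomb_vge : exists c : nat, forall (k : nat) a,
  (forall j, vge (k + c)%N%:Z (a j)) -> vge k%:Z (lincomb a).
Proof.
have [c cP] := vge_exists (fun j : 'I_d => e`_j).
exists c => k a ha; apply: vge_sum => j _.
by rewrite (_ : k%:Z = (k + c)%N%:Z - c%:Z); [exact: vge_scale|lia].
Qed.

Lemma lincomb_ulim (a : nat -> 'I_d -> Q) (l : 'I_d -> Q) :
  (forall j, ulim (a^~ j) (l j)) -> ulim (fun i => lincomb (a i)) (lincomb l).
Proof.
move=> al k; have [c cP] := lincomb_vge.
have : \forall i \near U, forall j, vge (k + c)%N%:Z (a i j - l j).
  by apply: filter_forall => j; exact: al.
by apply: filterS => i /= h; rewrite -lincombB; exact: cP.
Qed.

Hypothesis p_prime : prime p.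

(* The p-adic unit sphere of [Q^d] is compact and [lincomb] does not vanish on
   it, so that its valuation is bounded there. *)
Lemma lincomb_sphere : exists C : nat, forall a,
  (forall j, vge 0 (a j)) -> vge C%:Z (lincomb a) -> forall j, vge 1 (a j).
Proof.
apply: contrapT => /forallNP no.
have /boolp.choice[a aP] (C : nat) : exists a : 'I_d -> Q,
    [/\ forall j, vge 0 (a j), vge C%:Z (lincomb a) & ~ forall j, vge 1 (a j)].
  apply: contrapT => /forallNP na; apply: (no C) => a a0 aC.
  by apply: contrapT => a1; apply: (na a).
have /boolp.choice[l lP] (j : 'I_d) : exists l, ulim (a^~ j) l.
  by apply: padic_ulim => // i; have [] := aP i.
(* The valuation of [lincomb (a i)] is at least [i], and [U] contains every tail. Freeness of the
   basis then gives [l = 0], so that along [U] all coordinates of [a i] are divisible by p. *)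
have l0 : lincomb l = 0.
  apply: vge_all => k; have lk := lincomb_ulim lP k.
  have Uk : U [set i | (k <= i)%N] by apply: Uoo; exists k.
  have [i [/= ki li]] := filter_ex (filterI Uk lk).
  rewrite -[lincomb l](subKr (lincomb (a i))) vgeB//.
  by have [_ + _] := aP i; apply: vge_le; lia.
have h : \forall i \near U, forall j, vge 1 (a i j).
  apply: filter_forall => j; apply: filterS (lP j 1%N) => i /=.
  by rewrite (lincomb_eq0 l0) subr0.
by have [i hi] := filter_ex h; have [_ _] := aP i.
Qed.

Lemma vord_p : (p%:R : Q) != 0 /\ vord (p%:R : Q) = 1.
Proof.
have [n0 ->] := @vord_nat p Q p (prime_gt0 p_prime).
by rewrite n0 logn_prime// eqxx.
Qed.

Lemma vord_pX (c : nat) : (p%:R ^+ c : Q) != 0 /\ vord (p%:R ^+ c : Q) = c.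
Proof.
have pc : (0 < p ^ c)%N by rewrite expn_gt0 prime_gt0.
by have := @vord_nat p Q _ pc; rewrite pfactorK// natrX.
Qed.

(** Descent on the pole order: if the poles have order at most [c + 1] with [C <= c], multiplication
    by [p ^ (c + 1)] makes the coordinates integral and the combination small, and [lincomb_sphere]
    gains one power of p. *)
Lemma lincomb_bounded : exists C : nat, forall a,
  vge 0 (lincomb a) -> forall j, vge (- C%:Z) (a j).
Proof.
have [C CP] := lincomb_sphere; exists C => a a0.
have step (c : nat) : (C <= c)%N -> (forall j, vge (- c.+1%:Z) (a j)) ->
    forall j, vge (- c%:Z) (a j).
  move=> Cc h; have [pc0 pcv] := vord_pX c.+1.
  have hp : vge c.+1%:Z (p%:R ^+ c.+1 : Q) by rewrite /vge pcv lexx orbT.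
  have h1 : forall j, vge 1 (p%:R ^+ c.+1 * a j).
    apply: CP => [j|]; first by rewrite -[0](subrr c.+1%:Z) vgeM.
    by rewrite lincombZ; apply: vge_le (vge_scale hp a0); lia.
  move=> j; have [->|aj0] := eqVneq (a j) 0; first exact: vge0.
  move: (h1 j); rewrite /vge mulf_eq0 (negPf pc0) (negPf aj0) /= vordM// pcv.
  by lia.
have [c0 c0P] := vge_exists a.
(* The truncated subtraction stops the descent at [C], which is reached for [m = c0]. *)
have : forall m j, vge (- (C + (c0 - m))%N%:Z) (a j).
  elim=> [j|m IH]; first by apply: vge_le (c0P j); lia.
  have [mc|cm] := ltnP m c0; last by move=> j; apply: vge_le (IH j); lia.
  by apply: step; [lia|move=> j; apply: vge_le (IH j); lia].
by move=> /(_ c0) h j; apply: vge_le (h j); lia.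
Qed.

(** Compactness of the ring of integers of F: after multiplication by [p ^ C] the coordinates of
    integral elements are p-adic integers, to which [padic_ulim] applies. *)
Lemma padicExt_ulim (x : nat -> F) : (forall i, vge 0 (x i)) ->
  exists l, ulim x l.
Proof.
move=> x0; have [C CP] := lincomb_bounded; have [pC0 pCv] := vord_pX C.
have /boolp.choice[l lP] (j : 'I_d) :
    exists l, ulim (fun i => p%:R ^+ C * coord e j (x i)) l.
  apply: padic_ulim => // i; rewrite -[0](subrr C%:Z); apply: vgeM.
    by rewrite /vge pCv lexx orbT.
  by apply: (CP (fun j => coord e j (x i))); rewrite -lincomb_coord.
exists (lincomb (fun j => (p%:R ^+ C)^-1 * l j)).
rewrite (_ : x = fun i => lincomb (fun j => coord e j (x i))); last first.
  by apply: funext => i; rewrite -lincomb_coord.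
apply: lincomb_ulim => j k; apply: filterS (lP j (k + C)%N) => i /= h.
have -> : coord e j (x i) = (p%:R ^+ C)^-1 * (p%:R ^+ C * coord e j (x i)).
  by rewrite mulKf.
rewrite -mulrBr (_ : k%:Z = - C%:Z + (k + C)%N%:Z); last by lia.
by apply: vgeM => //; apply: vge_inv; rewrite // /vge (negPf pC0) pCv /=; lia.
Qed.

End PadicExt.
End UltraLimits.

(** * Trailing blocks and triangular decompositions *)

Section TrailingBlocks.
Variables (F : fieldType) (n : nat).

(* The block of [X] on the rows and columns from [b] on, completed by the
   identity: it is invertible exactly when that block is. *)
Definition trail (b : nat) (X : 'M[F]_n) : 'M[F]_n :=
  \matrix_(i, j) if (b <= i)%N && (b <= j)%N then X i j else (i == j)%:R.

Lemma trail_tr b X : (trail b X)^T = trail b X^T.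
Proof. by apply/matrixP => i j; rewrite !mxE andbC eq_sym. Qed.

Lemma mul_row_trail b X (v : 'rV[F]_n) j : (v *m trail b X) 0 j =
  if (b <= j)%N then \sum_(i < n | (b <= i)%N) v 0 i * X i j else v 0 j.
Proof.
rewrite mxE; case: leqP => bj.
  rewrite [RHS]big_mkcond; apply: eq_bigr => i _; rewrite mxE bj andbT.
  case: leqP => // ib; case: eqP => [ij|]; last by rewrite mulr0.
  by rewrite ij ltnNge bj in ib.
rewrite (bigD1 j)//= mxE leqNgt bj /= eqxx mulr1 big1 ?addr0// => i ij.
by rewrite mxE [(b <= j)%N]leqNgt bj andbF (negPf ij) mulr0.
Qed.

(** The completed matrix is the identity outside the block, so a kernel vector of it vanishes there
    and is a kernel vector of the block. *)
Lemma trail_sing_row b X : trail b X \notin unitmx ->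
  exists v : 'rV[F]_n, [/\ v != 0, forall j : 'I_n, (j < b)%N -> v 0 j = 0 &
    forall j : 'I_n, (b <= j)%N -> (v *m X) 0 j = 0].
Proof.
rewrite unitmxE unitfE negbK => /det0P[v v0 vX]; exists v.
have vb (j : 'I_n) : (j < b)%N -> v 0 j = 0.
  by move=> jb; have := mul_row_trail b X v j; rewrite vX leqNgt jb mxE.
split=> // j bj; have := mul_row_trail b X v j; rewrite vX bj !mxE => {2}->.
rewrite [RHS]big_mkcond; apply: eq_bigr => i _.
by case: leqP => // /vb ->; rewrite mul0r.
Qed.

Lemma trail_sing_col b X : trail b X \notin unitmx ->
  exists v : 'cV[F]_n, [/\ v != 0, forall j : 'I_n, (j < b)%N -> v j 0 = 0 &
    forall j : 'I_n, (b <= j)%N -> (X *m v) j 0 = 0].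
Proof.
rewrite -unitmx_tr trail_tr => /trail_sing_row[v [v0 vb vX]].
exists v^T; split=> [|j jb|j jb]; first by rewrite trmx_eq0.
  by rewrite mxE vb.
by rewrite -[X]trmxK -trmx_mul mxE vX.
Qed.

(** One elimination step: [v] combines the rows from [b] on so as to clear row [i] in the columns
    from [b] on. The first equation is recorded because it bounds the poles of [v] in [lu]. *)
Lemma trail_row_sol b X (i : 'I_n) : trail b X \in unitmx -> (i < b)%N ->
  exists v : 'rV[F]_n, [/\ v *m trail b X = - \row_j (if (b <= j)%N then X i j else 0),
    forall j : 'I_n, (j < b)%N -> v 0 j = 0 &
    forall j : 'I_n, (b <= j)%N -> X i j + (v *m X) 0 j = 0].
Proof.
move=> Xb ib; set r := \row_j _.
pose v := - r *m invmx (trail b X); exists v.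
have vX : v *m trail b X = - r by rewrite /v mulmxKV.
have vb (j : 'I_n) : (j < b)%N -> v 0 j = 0.
  move=> jb; have := mul_row_trail b X v j.
  by rewrite vX leqNgt jb !mxE leqNgt jb oppr0.
split=> // j bj; have := mul_row_trail b X v j; rewrite vX bj !mxE bj => e.
apply/eqP; rewrite addr_eq0 -eqr_oppLR e; apply/eqP.
rewrite big_mkcond; apply: eq_bigr => l _.
by case: leqP => // /vb ->; rewrite mul0r.
Qed.

Lemma unimodular_upper (V : 'M[F]_n) : (forall i j : 'I_n, (j < i)%N -> V i j = 0) ->
  (forall i, V i i = 1) -> V \in unitmx.
Proof.
move=> V0 V1; rewrite -unitmx_tr unitmxE det_trig.
  by rewrite big1 ?unitr1// => i _; rewrite mxE.
by apply/is_trig_mxP => i j ij; rewrite mxE V0.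
Qed.

End TrailingBlocks.

(** * Valuations of matrices and matrices close to 1 *)

Section MatrixValuation.
Variables (F : valuedFieldType).

Definition mxvge m n (k : int) (M : 'M[F]_(m, n)) := forall i j, vge k (M i j).

Lemma mxvge_le m n k l (M : 'M[F]_(m, n)) : k <= l -> mxvge l M -> mxvge k M.
Proof. by move=> kl h i j; apply: vge_le (h i j). Qed.

Lemma mxvgeM m n q k l (A : 'M[F]_(m, n)) (B : 'M[F]_(n, q)) :
  mxvge k A -> mxvge l B -> mxvge (k + l) (A *m B).
Proof. by move=> kA lB i j; rewrite mxE vge_sum// => x _; rewrite vgeM. Qed.

Lemma mxvgeD m n k (A B : 'M[F]_(m, n)) : mxvge k A -> mxvge k B -> mxvge k (A + B).
Proof. by move=> kA kB i j; rewrite mxE vgeD. Qed.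

Lemma mxvgeN m n k (A : 'M[F]_(m, n)) : mxvge k A -> mxvge k (- A).
Proof. by move=> kA i j; rewrite mxE vgeN. Qed.

Lemma mxvge_1 n : mxvge 0 (1%:M : 'M[F]_n).
Proof. by move=> i j; rewrite mxE vge_nat. Qed.

Lemma mxvge_exists m n (M : 'M[F]_(m, n)) : exists c : nat, mxvge (- c%:Z) M.
Proof.
by have [c cP] := vge_exists (fun ij => M ij.1 ij.2); exists c => i j; exact: (cP (i, j)).
Qed.

Lemma mxvge_conj n (A B : 'M[F]_n) (r : nat) :
  exists R : nat, forall M, mxvge R%:Z M -> mxvge r%:Z (A *m M *m B).
Proof.
have [a aP] := mxvge_exists A; have [b bP] := mxvge_exists B.
exists (r + a + b)%N => M MR.
have -> : r%:Z = - a%:Z + (r + a + b)%N%:Z + - b%:Z by lia.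
by apply: mxvgeM => //; exact: mxvgeM.
Qed.

(* The pole order of [v] equals that of [v *m A]. *)
Lemma near1_integral m n (A : 'M[F]_n) (v : 'M[F]_(m, n)) :
  mxvge 1 (A - 1%:M) -> mxvge 0 (v *m A) -> mxvge 0 v.
Proof.
move=> A1 vA; have [c cP] := mxvge_exists v.
elim: c cP => [//|c IH] cP; apply: IH.
have -> : v = v *m A - v *m (A - 1%:M) by rewrite mulmxBr mulmx1 subKr.
apply: mxvgeD; first by apply: mxvge_le vA; lia.
by apply: mxvgeN; apply: mxvge_le (mxvgeM cP A1); lia.
Qed.

(** All scalar multiples of a kernel vector are kernel vectors, hence integral by [near1_integral];
    scalars with arbitrarily large poles force the vector to be 0. *)
Lemma near1_unit n (A : 'M[F]_n) : mxvge 1 (A - 1%:M) -> A \in unitmx.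
Proof.
move=> A1; rewrite unitmxE unitfE; apply/negP => /det0P[v v0 vA].
move/negP: v0; apply; apply/eqP/matrixP => i j; rewrite mxE; apply: vge_all => k.
have [x x0 xv] := exists_vord F (- k%:Z).
have : mxvge 0 (x *: v).
  by apply: near1_integral A1 _; rewrite -scalemxAl vA scaler0 => a b; rewrite mxE vge0.
move=> /(_ i j); rewrite !mxE /vge mulf_eq0 (negPf x0) /=.
by have [//|v0] := eqVneq (v i j) 0; rewrite vordM//= xv; lia.
Qed.

Lemma near1_inv n (A : 'M[F]_n) (r : nat) : (0 < r)%N ->
  mxvge r%:Z (A - 1%:M) -> mxvge r%:Z (invmx A - 1%:M).
Proof.
move=> r0 Ar; have A1 : mxvge 1 (A - 1%:M) by apply: mxvge_le Ar; lia.
have Au := near1_unit A1.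
have -> : invmx A - 1%:M = - (invmx A *m (A - 1%:M)).
  by rewrite mulmxBr mulVmx// mulmx1 opprB.
apply: mxvgeN; rewrite -[r%:Z]add0r; apply: mxvgeM => //.
by apply: near1_integral A1 _; rewrite mulVmx//; exact: mxvge_1.
Qed.

End MatrixValuation.

Section GLn.
Variables (F : fieldType) (n : nat).
Local Notation G := (GL n F).
Local Notation w0 := (w0 n F).
Implicit Types g h : G.

Lemma glM g h : glmx (g * h)%g = glmx g *m glmx h. Proof. by []. Qed.
Lemma gl1E : glmx (1%g : G) = 1%:M. Proof. by []. Qed.
Lemma gl_inj : injective (@glmx n F). Proof. exact: val_inj. Qed.

Lemma w0E (i j : 'I_n) : glmx w0 i j = (rev_ord i == j)%:R.
Proof. by rewrite /= !mxE permE. Qed.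

Lemma mul_w0 m (M : 'M[F]_(m, n)) i j : (M *m glmx w0) i j = M i (rev_ord j).
Proof.
rewrite mxE (bigD1 (rev_ord j))//= w0E rev_ordK eqxx mulr1 big1 ?addr0// => l lj.
rewrite w0E; case: eqP => [e|]; last by rewrite mulr0.
by rewrite -e rev_ordK eqxx in lj.
Qed.

Lemma w0_mul m (M : 'M[F]_(n, m)) i j : (glmx w0 *m M) i j = M (rev_ord i) j.
Proof.
rewrite mxE (bigD1 (rev_ord i))//= w0E eqxx mul1r big1 ?addr0// => l li.
by rewrite w0E eq_sym (negPf li) mul0r.
Qed.

Lemma w0w0 : (w0 * w0)%g = 1%g.
Proof.
apply: gl_inj; apply/matrixP => i j; rewrite mul_w0 w0E gl1E mxE.
by rewrite (inj_eq rev_ord_inj).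
Qed.

Lemma w0V : w0^-1%g = w0.
Proof. by apply: (mulgI w0); rewrite mulgV w0w0. Qed.

Lemma w0_conj g i j : glmx (w0 * g * w0)%g i j = glmx g (rev_ord i) (rev_ord j).
Proof. by rewrite mul_w0 w0_mul. Qed.

Definition lower_tri (g : G) := forall i j : 'I_n, (i < j)%N -> glmx g i j = 0.

End GLn.

Section IntegralLU.
Variables (F : valuedFieldType) (n : nat).
Local Notation G := (GL n F).

(** [N0] also asks for an integral inverse. Its columns are found one after the other by
    substitution, without division since the diagonal is 1. *)
Lemma unipotent_N0 (g : G) : unipotent g -> mxvge 0 (glmx g) -> N0 g.
Proof.
move=> ug gi; split=> //; split; first exact: gi.
have [/upperP gu g1] := ug.
have E i j : \sum_(k < n) glmx g^-1%g i k * glmx g k j = (i == j)%:R.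
  by have := congr1 (fun h => glmx h i j) (mulVg g); rewrite gl1E !mxE.
have : forall m (i j : 'I_n), (j < m)%N -> vge 0 (glmx g^-1%g i j).
  elim=> [//|m IH] i j jm; have := E i j; rewrite (bigD1 j)//= g1 mulr1.
  move/(canRL (addrK _)) => ->.
  rewrite vgeB ?vge_nat//; apply: vge_sum => k kj.
  have [lt|le] := ltnP k j; last first.
    by rewrite gu ?mulr0 ?vge0// ltn_neqAle eq_sym kj.
  by rewrite -[0]addr0; apply: vgeM; [apply: IH; lia|exact: gi].
by move=> h i j; apply: (h n).
Qed.

(** Gaussian elimination from the bottom right corner: row [i] of [V] clears row [i] of [X] to the
    right of the diagonal. When [X] is close to 1, so are its trailing blocks, and [near1_integral]
    shows that the elimination creates no poles. *)
Lemma lu (X : G) : (forall b : nat, trail b (glmx X) \in unitmx) ->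
  exists V : G, [/\ unipotent V, lower_tri (V * X)%g &
    mxvge 1 (glmx X - 1%:M) -> mxvge 0 (glmx V)].
Proof.
move=> Xu.
have /boolp.choice[v vP] (i : 'I_n) := trail_row_sol (Xu i.+1) (ltnSn i).
pose V : 'M[F]_n := \matrix_(i, j) ((i == j)%:R + v i 0 j).
have V0 (i j : 'I_n) : (j < i)%N -> V i j = 0.
  move=> ji; have [_ vb _] := vP i; rewrite mxE vb ?addr0; last by lia.
  by case: eqP ji => // ->; rewrite ltnn.
have V1 i : V i i = 1 by have [_ vb _] := vP i; rewrite mxE eqxx vb ?addr0.
exists (MkGL (unimodular_upper V0 V1)); split=> [|i j ij|X1 i j].
- by split; [apply/upperP|].
- have [_ _ /(_ j ij) <-] := vP i.
  rewrite glM /= mxE [in RHS]mxE.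
  under eq_bigr do rewrite mxE mulrDl.
  rewrite big_split /=; congr (_ + _).
  rewrite (bigD1 i)//= eqxx mul1r big1 ?addr0// => k ki.
  by rewrite eq_sym (negPf ki) mul0r.
rewrite mxE vgeD ?vge_nat//; have [vX _ _] := vP i.
have : mxvge 0 (v i).
  apply: (@near1_integral _ _ _ (trail i.+1 (glmx X))).
    move=> a b; have := X1 a b; rewrite !mxE; case: ifP => // _ _.
    by rewrite subrr vge0.
  rewrite vX => a b; rewrite !mxE vgeN; case: ifP; rewrite ?vge0// => ib.
  have := X1 i b; rewrite !mxE; case: eqP ib => [->|_ _]; first by rewrite ltnn.
  by rewrite subr0; apply: vge_le.
by apply.
Qed.

End IntegralLU.

(** * The big cell and unipotent stabilizers *)

Section Borel.
Variables (F : fieldType) (n : nat).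
Local Notation G := (GL n F).
Implicit Types g h b c t u : G.

Lemma unipotent_borel u : unipotent u -> borel u. Proof. by case. Qed.

Lemma torusE t : torus t <-> forall i j, i != j -> glmx t i j = 0.
Proof. by split=> [/is_diag_mxP h i j /h|h]; [|apply/is_diag_mxP => i j /h]. Qed.

Lemma torus_borel t : torus t -> borel t.
Proof.
by move=> /torusE h; apply/upperP => i j ji; apply: h; apply/eqP => ij; rewrite ij ltnn in ji.
Qed.

Lemma borelM b c : borel b -> borel c -> borel (b * c)%g.
Proof.
move=> /upperP ub /upperP uc; apply/upperP => i j ji; rewrite glM mxE big1// => k _.
have [ki|ik] := ltnP k i; first by rewrite ub// mul0r.
by rewrite uc ?mulr0//; exact: leq_trans ik.
Qed.

Lemma borelM_diag b c i : borel b -> borel c ->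
  glmx (b * c)%g i i = glmx b i i * glmx c i i.
Proof.
move=> /upperP ub /upperP uc; rewrite glM mxE (bigD1 i)//= big1 ?addr0// => k ki.
have [lt|le] := ltnP k i; first by rewrite ub// mul0r.
by rewrite uc ?mulr0// ltn_neqAle eq_sym ki.
Qed.

Lemma borel_diag_neq0 b i : borel b -> glmx b i i != 0.
Proof.
move=> ub; have := glmxP b; rewrite -unitmx_tr unitmxE det_trig//.
by rewrite unitfE => /prodf_neq0/(_ i isT); rewrite mxE.
Qed.

Lemma diag_partE b : borel b -> glmx (diag_part b) = diag_mx (\row_i glmx b i i).
Proof.
move=> ub; rewrite /diag_part insubdK//.
rewrite unfold_in unitmxE det_diag unitfE; apply/prodf_neq0 => i _.
by rewrite mxE borel_diag_neq0.
Qed.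

Lemma diag_part_ij b i j : borel b -> glmx (diag_part b) i j = glmx b i j *+ (i == j).
Proof. by move=> /diag_partE ->; rewrite !mxE; case: eqP => [->|]. Qed.

Lemma diag_part_torus b : borel b -> torus (diag_part b).
Proof. by move=> bb; apply/torusE => i j ij; rewrite diag_part_ij// (negPf ij). Qed.

Lemma diag_partM b c : borel b -> borel c ->
  diag_part (b * c)%g = (diag_part b * diag_part c)%g.
Proof.
move=> bb bc; have tb := torus_borel (diag_part_torus bb).
have tc := torus_borel (diag_part_torus bc); have bbc := borelM bb bc.
apply: gl_inj; apply/matrixP => i j; rewrite diag_part_ij//.
have [<-|ij] := eqVneq i j.
  by rewrite !borelM_diag// !diag_part_ij// eqxx.
rewrite mulr0n glM mxE big1// => k _; rewrite !diag_part_ij//.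
by case: eqP => [<-|]; rewrite ?mul0r// (negPf ij) mulr0.
Qed.

Lemma diag_part_unipotent u : unipotent u -> diag_part u = 1%g.
Proof.
move=> uu; have bu := unipotent_borel uu; apply: gl_inj; apply/matrixP => i j.
rewrite diag_part_ij// gl1E mxE; case: eqP => [<-|]//.
by have [_ ->] := uu.
Qed.

Lemma torusV t : torus t -> torus t^-1%g.
Proof.
move=> /torusE tt; apply/torusE => i j ij.
have tjj : glmx t j j != 0 by apply: borel_diag_neq0; apply/torus_borel/torusE.
have := congr1 (fun g : G => glmx g i j) (mulVg t).
rewrite gl1E glM !mxE (negPf ij) (bigD1 j)//= big1 ?addr0 => [/eqP|k kj].
  by rewrite mulf_eq0 (negPf tjj) orbF => /eqP.
by rewrite tt ?mulr0.
Qed.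

Lemma torusM s t : torus s -> torus t -> torus (s * t)%g.
Proof.
move=> /torusE ts /torusE tt; apply/torusE => i j ij; rewrite glM mxE big1// => k _.
have [ik|ik] := eqVneq i k; last by rewrite ts ?mul0r.
by rewrite tt ?mulr0// -ik.
Qed.

Lemma torus1 : torus (1%g : G).
Proof. by apply/torusE => i j ij; rewrite gl1E mxE (negPf ij). Qed.

Lemma mul_torus t g i j : torus t -> glmx (t * g)%g i j = glmx t i i * glmx g i j.
Proof.
move=> /torusE tt; rewrite glM mxE (bigD1 i)//= big1 ?addr0// => k ki.
by rewrite tt ?mul0r// eq_sym.
Qed.

Lemma mul_torusr t g i j : torus t -> glmx (g * t)%g i j = glmx g i j * glmx t j j.
Proof.
move=> /torusE tt; rewrite glM mxE (bigD1 j)//= big1 ?addr0// => k ki.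
by rewrite tt ?mulr0.
Qed.

Lemma torusV_diag t i : torus t -> glmx t^-1%g i i = (glmx t i i)^-1.
Proof.
move=> tt; have t0 : glmx t i i != 0 by apply/borel_diag_neq0/torus_borel.
apply: (mulfI t0); rewrite mulfV// -mul_torus// mulgV gl1E.
by rewrite mxE eqxx.
Qed.

Lemma torus_conj t g i j : torus t ->
  glmx (t * g * t^-1)%g i j = glmx t i i * glmx g i j / glmx t j j.
Proof. by move=> tt; rewrite mul_torusr ?mul_torus ?torusV_diag//; exact: torusV. Qed.

Lemma torus_conj_unipotent t u : torus t -> unipotent u -> unipotent (t * u * t^-1)%g.
Proof.
move=> tt [/upperP uu u1]; split=> [|i].
  by apply/upperP => i j ji; rewrite torus_conj// uu// mulr0 mul0r.
by rewrite torus_conj// u1 mulr1 divff//; apply/borel_diag_neq0/torus_borel.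
Qed.

Lemma torus_w0 t : torus t -> torus (w0 n F * t * w0 n F)%g.
Proof.
move=> /torusE tt; apply/torusE => i j ij; rewrite w0_conj tt//.
by rewrite (inj_eq rev_ord_inj).
Qed.

Lemma borelV b : borel b -> borel b^-1%g.
Proof.
move=> bb; pose t := diag_part b; have tt : torus t := diag_part_torus bb.
have -> : b^-1%g = ((t^-1 * b)^-1 * t^-1)%g by rewrite invgM invgK mulgK.
apply: borelM; last exact/torus_borel/torusV.
apply/unipotent_borel/unipotentV; split=> [|i].
  by apply: borelM => //; exact/torus_borel/torusV.
rewrite mul_torus ?torusV_diag//; last exact: torusV.
by rewrite diag_part_ij// eqxx mulVf// borel_diag_neq0.
Qed.

Lemma lower_w0 b : borel b <-> lower_tri (w0 n F * b * w0 n F)%g.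
Proof.
split=> [/upperP ub i j ij|h].
  by rewrite w0_conj ub//=; have := ltn_ord i; have := ltn_ord j; lia.
apply/upperP => i j ji; have := h (rev_ord i) (rev_ord j).
rewrite w0_conj !rev_ordK; apply => /=; have := ltn_ord i; have := ltn_ord j; lia.
Qed.

(** [v^-1 * u] is upper unipotent and, as a conjugate by [w0] of an upper triangular matrix, also
    lower triangular; so it is 1. *)
Lemma big_cell_inj u v b c : unipotent u -> unipotent v -> borel b -> borel c ->
  (u * w0 n F * b)%g = (v * w0 n F * c)%g -> u = v /\ b = c.
Proof.
move=> uu uv bb bc e.
have e' : (v^-1 * u)%g = (w0 n F * (c * b^-1) * w0 n F)%g.
  apply: (mulgI v); rewrite mulVKg; apply: (mulIg (w0 n F * b)%g).
  rewrite !mulgA e -!mulgA; congr (_ * (_ * _))%g.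
  by rewrite [(w0 n F * (w0 n F * b))%g]mulgA w0w0 mul1g mulVg mulg1.
have wu : unipotent (v^-1 * u)%g by apply: unipotentM => //; exact: unipotentV.
have wl : lower_tri (v^-1 * u)%g.
  by rewrite e'; apply/lower_w0/borelM => //; exact: borelV.
have w1 : (v^-1 * u)%g = 1%g.
  apply: gl_inj; apply/matrixP => i j; rewrite gl1E [RHS]mxE.
  have [/upperP w1 w2] := wu; case: (ltngtP i j) => [ij|ji|/val_inj <-].
  - by rewrite (wl i j ij); case: eqP ij => // ->; rewrite ltnn.
  - by rewrite w1//; case: eqP ji => // ->; rewrite ltnn.
  - by rewrite w2 eqxx.
have uv' : u = v by rewrite -[v]mulg1 -w1 mulVKg.
by split=> //; move: e; rewrite uv' => /mulgI.
Qed.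

End Borel.

Section Stabilizers.
Variables (F : valuedFieldType) (n : nat).
Local Notation G := (GL n F).
Local Notation w0 := (w0 n F).

(** Writing [u * g = g * (g^-1 * u * g)] shows that such a [u] fixes the coset gB, and since
    characters are trivial on unipotents it also fixes the evaluation at [g]. *)
Definition unip_stab (g : G) :=
  exists u, [/\ N0 u, u <> 1%g & unipotent (g^-1 * u * g)%g].

Lemma unip_stab_sing (X : G) (b : nat) :
  trail b (glmx X) \notin unitmx -> unip_stab (X * w0)%g.
Proof.
(* Kernel vectors [ga] and [be] on both sides of the singular block yield the
   rank one perturbation [1 + x (X ga) be] of 1. *)
move=> Xb; have [be [be0 beb beX]] := trail_sing_row Xb.
have [ga [ga0 gab gaX]] := trail_sing_col Xb.
pose al := glmx X *m ga.
have al0 : al != 0.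
  apply/eqP => al0; move/eqP: ga0; apply.
  by rewrite -[ga](mulKmx (glmxP X)) -/al al0 mulmx0.
(* The scalar [x] compensates the poles of [al *m be], so that the perturbation is integral. *)
have [c cP] := mxvge_exists (al *m be); have [x x0 xv] := exists_vord F c%:Z.
have beal : be *m al = 0.
  apply/matrixP => i j; rewrite !mxE big1// => k _; rewrite !ord1.
  have [/beb ->|/gaX] := ltnP k b; first by rewrite mul0r.
  by rewrite /al => ->; rewrite mulr0.
pose A := x *: (al *m be).
have AA : A *m A = 0.
  rewrite /A -scalemxAl -scalemxAr -mulmxA [be *m _]mulmxA beal mul0mx mulmx0.
  by rewrite !scaler0.
have A1 : (1%:M + A) *m (1%:M - A) = 1%:M.
  by rewrite mulmxDl !mulmxBr AA !mul1mx !mulmx1 subr0 subrK.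
have [Au _] := mulmx1_unit A1.
have Aij i j : A i j = x * (al i 0 * be 0 j) by rewrite !mxE big_ord1 !mxE.
(* [al] lives on the indices below [b] and [be] on those from [b] on, so [A] is strictly upper
   triangular. *)
have A0 (i j : 'I_n) : (j <= i)%N -> A i j = 0.
  move=> ji; rewrite Aij; have [jb|bj] := ltnP j b; first by rewrite beb// !mulr0.
  by rewrite /al gaX ?mul0r ?mulr0//; lia.
have ME (i j : 'I_n) : glmx (MkGL Au) i j = (i == j)%:R + A i j.
  by rewrite [LHS]mxE; congr (_ + _); rewrite mxE.
have Xu : unipotent (MkGL Au).
  split=> [|i]; last by rewrite ME A0// addr0 eqxx.
  apply/upperP => i j ji; rewrite ME A0 1?ltnW// addr0.
  by case: eqP ji => // ->; rewrite ltnn.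
exists (MkGL Au); split.
- apply: unipotent_N0 => //; apply: mxvgeD; first exact: mxvge_1.
  move=> i j; rewrite mxE -[0](subrr c%:Z); apply: vgeM => //.
  by rewrite /vge xv lexx orbT.
- move=> /(congr1 (@glmx n F))/(canRL (addKr _)).
  rewrite addNr => A00.
  have [i ai] : exists i, al i 0 != 0.
    by apply/existsP; apply: contraNT al0 => /existsPn h; apply/eqP/matrixP => i j;
      rewrite ord1 [RHS]mxE; apply/eqP; rewrite -[_ == _]negbK.
  have [j bj] : exists j, be 0 j != 0.
    by apply/existsP; apply: contraNT be0 => /existsPn h; apply/eqP/matrixP => k j;
      rewrite ord1 [RHS]mxE; apply/eqP; rewrite -[_ == _]negbK.
  have := Aij i j; rewrite A00 mxE => /esym/eqP.
  by rewrite !mulf_eq0 (negPf x0) (negPf ai) (negPf bj).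
have -> : ((X * w0)^-1 * MkGL Au * (X * w0))%g = (w0 * (X^-1 * MkGL Au * X) * w0)%g.
  by rewrite invgM w0V !mulgA.
have E : glmx (X^-1 * MkGL Au * X)%g = 1%:M + x *: (ga *m (be *m glmx X)).
  rewrite !glM /= mulmxDr mulmx1 mulmxDl mulVmx ?glmxP//; congr (_ + _).
  rewrite /A -scalemxAr -scalemxAl /al !mulmxA mulVmx ?glmxP// mul1mx.
  by rewrite -!mulmxA.
(* After conjugation by [X] the supports are exchanged and the perturbation is strictly lower
   triangular; [w0] turns it into a strictly upper triangular one. *)
have E0 (i j : 'I_n) : (i <= j)%N -> (x *: (ga *m (be *m glmx X))) i j = 0.
  move=> ij; rewrite mxE mxE big_ord1; have [ib|bi] := ltnP i b.
    by rewrite gab// mul0r mulr0.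
  by rewrite beX ?mulr0//; lia.
split=> [|i]; last by rewrite w0_conj E mxE E0// addr0 mxE eqxx.
apply/upperP => i j ji; rewrite w0_conj E mxE E0 /=; last by lia.
by rewrite addr0 mxE (inj_eq rev_ord_inj); case: eqP ji => // ->; rewrite ltnn.
Qed.

(** For [X = g * w0], either some trailing block is singular and [unip_stab_sing] applies, or the
    elimination of [lu] succeeds and [g = V^-1 * w0 * (w0 * (V * X) * w0)]. *)
Lemma unip_stab_or_big_cell (g : G) : unip_stab g \/
  exists u b, [/\ unipotent u, borel b & g = (u * w0 * b)%g].
Proof.
have [X gX] : exists X, g = (X * w0)%g by exists (g * w0)%g; rewrite -mulgA w0w0 mulg1.
have [sing|reg] := pselect (exists b : nat, trail b (glmx X) \notin unitmx).
  by have [b /unip_stab_sing] := sing; rewrite -gX; left.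
right; have [b|V [Vu Vl _]] := @lu F n X.
  by apply: contrapT => /negP Xb; apply: reg; exists b.
exists V^-1%g, (w0 * (V * X) * w0)%g; split; first exact: unipotentV.
  apply/lower_w0; rewrite !mulgA w0w0 mul1g -[(_ * w0 * w0)%g]mulgA w0w0 mulg1; exact: Vl.
by rewrite !mulgA -[(V^-1 * w0 * w0)%g]mulgA w0w0 mulg1 mulVg mul1g -gX.
Qed.

End Stabilizers.

(** * Congruence subgroups *)

Section Congruence.
Variables (F : valuedFieldType) (n : nat).
Local Notation G := (GL n F).
Implicit Types g h k u t : G.

(** For [r > 0] this is the principal congruence subgroup of level [r]. For [r = 0] it only says
    that the entries are integral. *)
Definition congr_sub (r : nat) : set G := [set k | mxvge r%:Z (glmx k - 1%:M)].

Lemma congr_sub_le r s k : (r <= s)%N -> congr_sub s k -> congr_sub r k.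
Proof. by move=> rs; apply: mxvge_le; lia. Qed.

Lemma congr_subV r k : (0 < r)%N -> congr_sub r k -> congr_sub r k^-1%g.
Proof. by move=> r0; exact: near1_inv. Qed.

Lemma glV_mulmx g : invmx (glmx g) *m glmx g = 1%:M.
Proof. by rewrite mulVmx// glmxP. Qed.

Lemma gl_mulmxV g : glmx g *m invmx (glmx g) = 1%:M.
Proof. by rewrite mulmxV// glmxP. Qed.

Lemma conj_sub1 g k :
  glmx (g^-1 * k * g)%g - 1%:M = glmx g^-1%g *m (glmx k - 1%:M) *m glmx g.
Proof. by rewrite mulmxBr mulmxBl mulmx1 glV_mulmx. Qed.

Lemma congr_sub_conj g r :
  exists R, forall k, congr_sub R k -> congr_sub r (g^-1 * k * g)%g.
Proof.
have [R RP] := mxvge_conj (glmx g^-1%g) (glmx g) r.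
by exists R => k /RP; rewrite /congr_sub /= conj_sub1.
Qed.

Lemma congr_sub_divr g r : exists R : nat, forall h,
  mxvge R%:Z (glmx h - glmx g) -> congr_sub r (h * g^-1)%g.
Proof.
have [R RP] := mxvge_conj (1%:M) (glmx g^-1%g) r; exists R => h /RP.
by rewrite mul1mx /congr_sub /= mulmxBl gl_mulmxV.
Qed.

Lemma U1E k : U1 k <-> congr_sub 1 k.
Proof.
split=> [[]//|k1]; split=> //; have kV := congr_subV (ltn0Sn 0) k1.
have int1 h : congr_sub 1 h -> integral h.
  move=> h1 i j; rewrite -[glmx h](subrK 1%:M); apply: mxvgeD => //.
    by apply: mxvge_le h1.
  exact: mxvge_1.
by split; exact: int1.
Qed.

Lemma N0_mxvge u : N0 u -> mxvge 0 (glmx u). Proof. by case=> _ []. Qed.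

Lemma congr_sub_conjN0 r u k : N0 u -> congr_sub r k -> congr_sub r (u^-1 * k * u)%g.
Proof.
move=> Nu kr; rewrite /congr_sub /= conj_sub1 -[r%:Z]add0r -[_ + _]addr0.
apply: mxvgeM; last exact: N0_mxvge.
by apply: mxvgeM => //; apply: N0_mxvge; exact: N0_V.
Qed.

(** The Iwahori factorization, from [lu]. Of the lower triangular factor only the diagonal is
    controlled, which is what the character sees. *)
Lemma iwahori k : congr_sub 1 k -> exists u L : G,
  [/\ N0 u, lower_tri L, forall i, vge 1 (glmx L i i - 1) & k = (u * L)%g].
Proof.
move=> k1; have [b|V [Vu Vl /(_ k1) V0]] := @lu F n k.
  apply: near1_unit => i j; have := k1 i j; rewrite !mxE; case: ifP => // _ _.
  by rewrite subrr vge0.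
have VN := unipotent_N0 Vu V0.
exists V^-1%g, (V * k)%g; split=> //; first exact: N0_V; last by rewrite mulKg.
move=> i; have [/upperP uV V1] := Vu.
(* The diagonal of [V] being 1, subtracting 1 amounts to subtracting the diagonal entry of [V]. *)
have -> : glmx (V * k)%g i i - 1 = (glmx V *m (glmx k - 1%:M)) i i.
  by rewrite mulmxBr mulmx1 [RHS]mxE glM; congr (_ + _); rewrite mxE V1.
by have := mxvgeM V0 k1; apply.
Qed.

Lemma Tplus_torus t : Tplus t -> torus t. Proof. by case. Qed.

Lemma TplusM s t : Tplus s -> Tplus t -> Tplus (s * t)%g.
Proof.
move=> [ts sP] [tt tP]; split; first exact: torusM.
by move=> u /tP/sP; rewrite invgM !mulgA.
Qed.

Lemma Tplus1 : Tplus (1%g : G).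
Proof. by split; [exact: torus1|move=> u; rewrite mul1g invg1 mulg1]. Qed.

Lemma BplusM (b c : G) : Bplus b -> Bplus c -> Bplus (b * c)%g.
Proof.
move=> [u [t [Nu Tt ->]]] [v [s [Nv Ts ->]]].
exists (u * (t * v * t^-1))%g, (t * s)%g; split.
- by apply: N0_M => //; exact: Tt.2.
- exact: TplusM.
- by rewrite !mulgA mulgVK.
Qed.

Lemma Bplus_N0 u : N0 u -> Bplus u.
Proof. by move=> Nu; exists u, 1%g; rewrite mulg1; split=> //; exact: Tplus1. Qed.

Lemma Bplus_Tplus t : Tplus t -> Bplus t.
Proof. by move=> Tt; exists 1%g, t; rewrite mul1g; split=> //; exact: N0_1. Qed.

Lemma exists_contraction (m : nat) : exists t, Tplus t /\
  forall i j, vord (glmx t i i) - vord (glmx t j j) = (m * j)%N%:Z - (m * i)%N%:Z.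
Proof.
(* The witness is diag(pi^(m n), pi^(m (n - 1)), ..., pi^m). *)
have /boolp.choice[x xP] (i : 'I_n) :
    exists x : F, x != 0 /\ vord x = (m * (n - i))%N%:Z.
  by have [x x0 xv] := exists_vord F (m * (n - i))%N%:Z; exists x.
have tu : diag_mx (\row_i x i) \in unitmx.
  rewrite unitmxE det_diag unitfE; apply/prodf_neq0 => i _.
  by rewrite mxE; have [] := xP i.
pose t : G := MkGL tu.
have tE i : glmx t i i = x i by rewrite !mxE eqxx.
have tt : torus t by apply/torusE => i j ij; rewrite mxE (negPf ij).
have tv i j : vord (glmx t i i) - vord (glmx t j j) = (m * j)%N%:Z - (m * i)%N%:Z.
  rewrite !tE; have [_ ->] := xP i; have [_ ->] := xP j.
  have mi (l : 'I_n) : (m * l <= m * n)%N by rewrite leq_mul2l ltnW ?orbT.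
  by rewrite !mulnBr; have := mi i; have := mi j; lia.
exists t; split => //; split=> // u Nu; have [[/upperP uu u1] _] := Nu.
apply: unipotent_N0; first by apply: torus_conj_unipotent => //; case: Nu.
move=> i j; rewrite torus_conj//; have [ji|ij|/val_inj <-] := ltngtP j i.
- by rewrite uu// mulr0 mul0r vge0.
- rewrite mulrAC -[0]addr0; apply: vgeM; last exact: N0_mxvge.
  have [xi0 _] := xP i; have [xj0 _] := xP j.
  have mij : (m * i <= m * j)%N by rewrite leq_mul2l ltnW ?orbT.
  rewrite !tE; have := tv i j; rewrite !tE => xij.
  apply: (@vge_le _ _ (vord (x i) + - vord (x j))); first by rewrite xij; lia.
  apply: vgeM; first by rewrite /vge lexx orbT.
  by apply: vge_inv => //; rewrite /vge (negPf xj0) /=; lia.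
- by have [xj0 _] := xP j; rewrite u1 mulr1 tE mulfV ?vge1.
Qed.

End Congruence.

(** * Neighbourhoods in GL_n in terms of valuations *)

Section Topology.
Variables (p : nat) (Q : padicType p) (F : padicExtType Q) (n : nat).
Local Notation G := (GL n F).

Lemma nbhs_mx (M : 'M[F]_n) (A : set 'M[F]_n) :
  nbhs M A <-> exists R : nat, forall M', mxvge R%:Z (M' - M) -> A M'.
Proof.
split=> [[P MP PA]|[R RA]]; last first.
  exists (fun i j => [set y | vge R%:Z (y - M i j)]).
    by move=> i j; apply/nbhs_vord; exists R%:Z.
  by move=> M' /= h; apply: RA => i j; rewrite !mxE; exact: h.
have /boolp.choice[k kP] (ij : 'I_n * 'I_n) :
    exists k : int, forall y, vge k (y - M ij.1 ij.2) -> P ij.1 ij.2 y.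
  by have := MP ij.1 ij.2; move/nbhs_vord.
exists (\sum_ij `|k ij|)%N => M' h; apply: PA => i j; apply: (kP (i, j)) => /=.
have := h i j; rewrite !mxE; apply: vge_le.
have : (`|k (i, j)| <= \sum_ij `|k ij|)%N by rewrite (bigD1 (i, j))//= leq_addr.
by lia.
Qed.

Lemma nbhs_gl (g : G) (A : set G) :
  nbhs g A <-> exists R : nat, forall h, mxvge R%:Z (glmx h - glmx g) -> A h.
Proof.
split=> [|[R RA]].
  rewrite nbhsE => -[B [[C oC CB] Bg] BA].
  have Cg : nbhs (glmx g) C by rewrite nbhsE; exists C => //; split=> //; rewrite -CB in Bg.
  have [R RP] := (nbhs_mx _ _).1 Cg; exists R => h /RP Ch.
  by apply: BA; rewrite -CB.
have cgl : continuous (@glmx n F : G -> 'M[F]_n) by exact: initial_continuous.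
have : nbhs (glmx g) [set M | mxvge R%:Z (M - glmx g)] by apply/nbhs_mx; exists R.
move=> /cgl gR; apply: (@filterS _ (nbhs g) (nbhs_filter g) _ _ _ gR) => h; exact: RA.
Qed.

Lemma congr_inv_locally_constant (Y : Type) (x : G -> Y) (r : nat) :
  (forall k g, congr_sub r k -> x (k * g)%g = x g) -> locally_constant x.
Proof.
move=> xr g; apply/nbhs_gl; have [R RP] := congr_sub_divr g r.
by exists R => h /RP hr; rewrite -(xr _ g hr) mulgVK.
Qed.

Lemma nbhs_set_type (S : set G) (g : set_type S) (A : set (set_type S)) : nbhs g A ->
  exists R : nat, forall h : set_type S, mxvge R%:Z (glmx (val h) - glmx (val g)) -> A h.
Proof.
rewrite nbhsE => -[B [[C oC CB] Bg] BA].
have Cg : nbhs (val g) C by rewrite nbhsE; exists C => //; split=> //; rewrite -CB in Bg.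
have [R RP] := (nbhs_gl _ _).1 Cg; exists R => h /RP Ch.
by apply: BA; rewrite -CB.
Qed.

Lemma nbhs_n0 (g : N0grp n F) (R : nat) :
  nbhs g [set h | mxvge R%:Z (glmx (n0val h) - glmx (n0val g))].
Proof.
have cn0 : continuous (@n0val n F : N0grp n F -> G) by exact: initial_continuous.
have : nbhs (n0val g) [set h | mxvge R%:Z (glmx h - glmx (n0val g))].
  by apply/nbhs_gl; exists R.
exact: cn0.
Qed.

End Topology.

(** * Characters of the torus *)

Section Residue.
Variable F : valuedFieldType.

Lemma residueD (a b : oring F) : residue (a + b) = residue a + residue b.
Proof. exact: (rmorphD \pi_({ideal_quot (@omax F)})). Qed.

Lemma residueM (a b : oring F) : residue (a * b) = residue a * residue b.
Proof. exact: (rmorphM \pi_({ideal_quot (@omax F)})). Qed.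

Lemma residue_nat m : residue (m%:R : oring F) = m%:R.
Proof. exact: (rmorph_nat \pi_({ideal_quot (@omax F)})). Qed.

Lemma residue_repr (c : resfield F) : residue (repr c) = c.
Proof. exact: reprK. Qed.

Lemma residueB (a b : oring F) : residue (a - b) = residue a - residue b.
Proof. exact: (rmorphB \pi_({ideal_quot (@omax F)})). Qed.

End Residue.

Section PadicExtCharacteristic.
Variables (p : nat) (p_prime : prime p) (Q : padicType p) (F : padicExtType Q).

Lemma vge_p : vge 1 (p%:R : F).
Proof.
have -> : (p%:R : F) = (p%:R : Q)%:A by rewrite scaler_nat.
by apply: (@vge_alg p Q F 1); have [_ v] := vord_p Q p_prime; rewrite /vge v lexx orbT.
Qed.

Lemma resfield_pchar : p \in [pchar resfield F].
Proof.
apply/andP; split=> //; rewrite -(residue_nat F p) residue_eq0 unfold_in.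
by rewrite rmorph_nat /= vge_p.
Qed.

(** In characteristic p, [x ^ (p ^ N) - 1 = (x - 1) ^ (p ^ N)]. *)
Lemma resfield_unip (x : resfield F) (N : nat) : x ^+ (p ^ N)%N = 1 -> x = 1.
Proof.
have ch := resfield_pchar => xN.
have pn : [pchar resfield F].-nat (p ^ N)%N.
  by rewrite pnatX (eq_pnat _ (pcharf_eq ch)) pnat_id.
have := exprDn_pchar 1 (x - 1) pn.
rewrite addrC subrK xN expr1n => /eqP; rewrite -subr_eq0 opprD addrA subrr sub0r.
by rewrite oppr_eq0 expf_eq0 => /andP[_ /eqP/(canRL (subrK _))]; rewrite add0r.
Qed.

(** Each p-th power gains one unit of valuation: in [y ^ p - 1 = (y - 1) * (1 + y + ... + y ^ (p -
    1))] the second factor is congruent to p, hence to 0, modulo the maximal ideal. *)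
Lemma vge_pX (x : F) (N : nat) : vge 1 (x - 1) -> vge N.+1%:Z (x ^+ (p ^ N)%N - 1).
Proof.
move=> x1; elim: N => [|N IH]; first by rewrite expn0 expr1.
rewrite expnSr exprM; set y := x ^+ _ in IH *.
have y1 : vge 1 (y - 1) by apply: vge_le IH; lia.
have yi i : vge 1 (y ^+ i - 1).
  elim: i => [|i IHi]; first by rewrite expr0 subrr vge0.
  have -> : y ^+ i.+1 - 1 = (y - 1) * (y ^+ i - 1) + (y - 1) + (y ^+ i - 1).
    by rewrite exprS; ring.
  by apply: vgeD => //; apply: vgeD => //; apply: vge_le (vgeM y1 IHi); lia.
rewrite subrX1 (_ : N.+2%:Z = N.+1%:Z + 1); last by lia.
apply: vgeM => //.
have -> : \sum_(i < p) y ^+ i = \sum_(i < p) (y ^+ i - 1) + p%:R.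
  by rewrite sumrB sumr_const card_ord subrK.
by rewrite vgeD ?vge_p//; apply: vge_sum.
Qed.

End PadicExtCharacteristic.

Section Character.
Variables (p : nat) (p_prime : prime p) (Q : padicType p) (F K : padicExtType Q).
Variables (n : nat) (chi : GL n F -> resfield K) (chi_char : smooth_character chi).
Local Notation G := (GL n F).
Implicit Types b c t u : G.

Lemma chi1 : chi 1%g = 1.
Proof.
have [c0 cM _] := chi_char; have n1 := c0 1%g (torus1 F n).
by apply: (mulfI n1); rewrite -cM ?mulg1 ?mulr1//; exact: torus1.
Qed.

Lemma chiX t m : torus t -> torus (t ^+ m)%g /\ chi (t ^+ m)%g = chi t ^+ m.
Proof.
have [_ cM _] := chi_char => tt.
elim: m => [|m [tm IH]]; first by rewrite expg0 expr0 chi1; split=> //; exact: torus1.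
by rewrite expgS exprS cM// IH; split=> //; exact: torusM.
Qed.

Lemma torusX_diag t m i : torus t -> glmx (t ^+ m)%g i i = glmx t i i ^+ m.
Proof.
move=> tt; elim: m => [|m IH]; first by rewrite expg0 expr0 gl1E mxE eqxx.
by rewrite expgS exprS mul_torus// IH.
Qed.

(* [1 + pi o] is a pro-p group and [chi] takes values in a field of characteristic p. *)
Lemma chi_congr t : torus t -> (forall i, vge 1 (glmx t i i - 1)) -> chi t = 1.
Proof.
move=> tt t1; have [_ _ clc] := chi_char.
have t1S : (1%g : G) \in torus (n := n) (F := F) by apply/mem_set/torus1.
have [R RP] := nbhs_set_type (clc (SigSub t1S)).
(* [R] serves both as the radius on which [chi] is 1 and as the exponent that brings [t ^ (p ^ R)]
   within that radius. *)
have [tX cX] := chiX (p ^ R) tt; have tXS := mem_set tX.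
have := RP (SigSub tXS); rewrite /= cX chi1 => h.
apply: (resfield_unip p_prime (N := R)); apply: h => i j; rewrite !mxE.
have [<-|ij] := eqVneq i j; last first.
  by rewrite ((torusE _).1 tX)// mulr0n subr0 vge0.
by rewrite torusX_diag//; apply: vge_le (vge_pX p_prime R (t1 i)); lia.
Qed.

Definition bchi b := chi (diag_part b).

Lemma bchi_neq0 b : borel b -> bchi b != 0.
Proof. by have [c0 _ _] := chi_char => bb; apply/c0/diag_part_torus. Qed.

Lemma bchiM b c : borel b -> borel c -> bchi (b * c)%g = bchi b * bchi c.
Proof.
by have [_ cM _] := chi_char => bb bc; rewrite /bchi diag_partM// cM//;
  apply: diag_part_torus.
Qed.

Lemma bchi_unipotent u : unipotent u -> bchi u = 1.
Proof. by move=> uu; rewrite /bchi diag_part_unipotent// chi1. Qed.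

Lemma bchi_congr b : borel b -> (forall i, vge 1 (glmx b i i - 1)) -> bchi b = 1.
Proof.
move=> bb b1; apply: chi_congr; first exact: diag_part_torus.
by move=> i; rewrite diag_part_ij// eqxx; exact: b1.
Qed.

End Character.

(** * Compactness of N_0 *)

Lemma sub1E (R : pzRingType) n (M : 'M[R]_n) i j : (M - 1%:M) i j = M i j - (i == j)%:R.
Proof. by rewrite !mxE. Qed.

Lemma mxvge_trans (F : valuedFieldType) m n k (A B C : 'M[F]_(m, n)) :
  mxvge k (A - B) -> mxvge k (B - C) -> mxvge k (A - C).
Proof. by move=> /mxvgeD h /h; rewrite addrA subrK. Qed.

Lemma mxvge_sym (F : valuedFieldType) m n k (A B : 'M[F]_(m, n)) :
  mxvge k (A - B) -> mxvge k (B - A).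
Proof. by move=> /mxvgeN; rewrite opprB. Qed.

(** * Contracting elements of T_+ *)

Section Contraction.
Variables (F : valuedFieldType) (n : nat).
Local Notation G := (GL n F).

(** Above the diagonal, conjugation by [t] raises valuations by at least [m] and conjugation by
    [t^-1] lowers them by as much, so that a nonintegral entry ends at [- m - 1] or below. That
    bound has the shape required by [vge_inv]. *)
Lemma exists_contraction_N0 (m : nat) : exists t : G, [/\ Tplus t,
  forall v, N0 v -> congr_sub m (t * v * t^-1)%g &
  forall y, unipotent y -> ~ N0 y -> exists i j : 'I_n, (i < j)%N /\
    ~~ vge (1 - m.+1%:Z) (glmx (t^-1 * y * t)%g i j)].
Proof.
have [t [Tt tv]] := exists_contraction F n m; have tt := Tplus_torus Tt.
have t0 i : glmx t i i != 0 by apply/borel_diag_neq0/torus_borel.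
exists t; split=> // [v Nv i j|y uy yN].
  have [vu _] := Nv; have [/upperP vl v1] := vu.
  have [/upperP tl t1] := torus_conj_unipotent tt vu; rewrite sub1E.
  have [ji|ij|/val_inj <-] := ltngtP j i.
  - by rewrite tl//; case: eqP ji => [->|_ _]; rewrite ?ltnn// subr0 vge0.
  - rewrite torus_conj//; case: eqP ij => [->|_ ij]; first by rewrite ltnn.
    rewrite subr0 mulrAC -[m%:Z]addr0; apply: vgeM; last exact: N0_mxvge.
    apply: (@vge_le _ _ (vord (glmx t i i) + - vord (glmx t j j))).
      by rewrite tv; have : (m * i.+1 <= m * j)%N; [rewrite leq_mul2l ij orbT|rewrite mulnS; lia].
    apply: vgeM; first by rewrite /vge lexx orbT.
    by apply: vge_inv => //; rewrite /vge (negPf (t0 j)) /=; lia.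
  - by rewrite t1 eqxx subrr vge0.
have [i [j yij]] : exists i j, ~~ vge 0 (glmx y i j).
  apply: contrapT => no; apply: yN; apply: unipotent_N0 => // i j.
  by apply: contrapT => /negP yij; apply: no; exists i, j.
have [/upperP yl y1] := uy.
have ij : (i < j)%N.
  have [ji|//|/val_inj ij] := ltngtP j i; first by rewrite yl// vge0 in yij.
  by rewrite ij y1 vge1 in yij.
exists i, j; split=> //; apply: contra yij => h.
have -> : glmx y i j = glmx t i i * glmx (t^-1 * y * t)%g i j * (glmx t j j)^-1.
  by rewrite -torus_conj// !mulgA mulgV mul1g mulgK.
apply: (@vge_le _ _ (vord (glmx t i i) + (1 - m.+1%:Z) + - vord (glmx t j j))).
  have := tv i j; have : (m * i.+1 <= m * j)%N by rewrite leq_mul2l ij orbT.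
  by rewrite mulnS; lia.
apply: vgeM; first by apply: vgeM => //; rewrite /vge lexx orbT.
by apply: vge_inv => //; rewrite /vge (negPf (t0 j)) /=; lia.
Qed.

End Contraction.

(** * Ultralimits in N_0 and the cosets of t N_0 t^-1 *)

Section N0Compact.
Variables (p : nat) (p_prime : prime p) (Q : padicType p) (F : padicExtType Q).
Variable n : nat.
Local Notation G := (GL n F).

Lemma N0_ulim (U : set_system nat) (UU : UltraFilter U) (Uoo : \oo `<=` U)
    (u : nat -> G) : (forall i, N0 (u i)) ->
  exists2 l : G, N0 l & forall R : nat, U [set i | mxvge R%:Z (glmx (u i) - glmx l)].
Proof.
move=> Nu; have pU : ProperFilter U by exact: ultra_proper.
have /boolp.choice[l lP] (ab : 'I_n * 'I_n) :
    exists l, ulim U (fun i => glmx (u i) ab.1 ab.2) l.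
  by apply: (padicExt_ulim UU Uoo p_prime) => i; exact: N0_mxvge.
(* The entries on and below the diagonal are prescribed, so that the limit is unipotent by
   construction. *)
pose L : 'M[F]_n := \matrix_(a, b) if (b < a)%N then 0 else if a == b then 1 else l (a, b).
have L0 (a b : 'I_n) : (b < a)%N -> L a b = 0 by move=> ba; rewrite mxE ba.
have L1 a : L a a = 1 by rewrite mxE ltnn eqxx.
have uL a b : ulim U (fun i => glmx (u i) a b) (L a b).
  move=> R; rewrite /L mxE; case: ifP => [ba|_].
    apply: filterE => i /=; have [[/upperP ul _] _] := Nu i.
    by rewrite ul// subrr vge0.
  case: eqP => [->|_]; last exact: (lP (a, b)).
  by apply: filterE => i /=; have [[_ ->] _] := Nu i; rewrite subrr vge0.
exists (MkGL (unimodular_upper L0 L1)) => [|R].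
  apply: unipotent_N0; first by split=> //; apply/upperP.
  move=> a b; apply: (ulim_integral UU _ (uL a b)) => i.
  exact: N0_mxvge.
have : \forall i \near U, forall ab : 'I_n * 'I_n,
    vge R%:Z (glmx (u i) ab.1 ab.2 - L ab.1 ab.2).
  by apply: filter_forall => ab; exact: uL.
by apply: filterS => i h a b; have := h (a, b); rewrite !mxE.
Qed.

Lemma exists_ultra : exists U : set_system nat, UltraFilter U /\ \oo `<=` U.
Proof. exact: ultraFilterLemma. Qed.

(** Uniformity by compactness: otherwise pairs with distinct values and distances tending to 0 have
    a common ultralimit, near which [x] is constant. *)
Lemma locally_constant_N0 (Y : Type) (x : G -> Y) : locally_constant x ->
  exists m : nat, forall u v, N0 u -> N0 v ->
    mxvge m%:Z (glmx v - glmx u) -> x (v * w0 n F)%g = x (u * w0 n F)%g.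
Proof.
move=> xlc; apply: contrapT => /forallNP no.
have /boolp.choice[uv uvP] (m : nat) : exists uv : G * G,
    [/\ N0 uv.1, N0 uv.2, mxvge m%:Z (glmx uv.2 - glmx uv.1) &
      x (uv.2 * w0 n F)%g <> x (uv.1 * w0 n F)%g].
  apply: contrapT => /forallNP nm; apply: (no m) => u v Nu Nv uvm.
  by apply: contrapT => xuv; apply: (nm (u, v)).
have [U [UU Uoo]] := exists_ultra; have pU : ProperFilter U by exact: ultra_proper.
have [|l Nl lP] := @N0_ulim U UU Uoo (fun m => (uv m).1).
  by move=> m; have [] := uvP m.
have [R RP] := (nbhs_gl _ _).1 (xlc (l * w0 n F)%g).
have UR : U [set m | (R <= m)%N] by apply: Uoo; exists R.
have [m [/= Rm lm]] := filter_ex (filterI UR (lP R)).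
have [Nu Nv uvm xuv] := uvP m; apply: xuv.
(* Right multiplication by [w0] permutes the columns and preserves distances. *)
rewrite [LHS]RP ?[RHS]RP//; rewrite !glM -mulmxBl => i j; rewrite mul_w0.
  exact: lm.
apply: (mxvge_trans _ (lm : mxvge _ _)).
by apply: mxvge_le uvm; lia.
Qed.

(** Equality of the cosets of [u] and [v] modulo t N_0 t^-1. *)
Definition conj_equiv (t u v : G) := N0 (t^-1 * (u^-1 * v) * t)%g.

(** The index is finite: in a sequence of representatives of distinct cosets, two terms close to the
    ultralimit would be equivalent, as t N_0 t^-1 is open in N_0. *)
Lemma N0_cosets (t : G) : Tplus t -> exists s : seq G, [/\ uniq s,
  forall u, u \in s -> N0 u,
  forall u v, u \in s -> v \in s -> conj_equiv t u v -> u = v &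
  forall v, N0 v -> exists2 u, u \in s & conj_equiv t u v].
Proof.
move=> Tt; have equivV u v : conj_equiv t u v -> conj_equiv t v u.
  by move=> /N0_V; rewrite /conj_equiv !invgM !invgK !mulgA.
have equivM u v w : conj_equiv t u v -> conj_equiv t v w -> conj_equiv t u w.
  move=> uv vw; have := N0_M uv vw; rewrite /conj_equiv !mulgA.
  by rewrite mulgK mulgK.
pose C u := [set v | N0 v /\ conj_equiv t u v].
have Cu u : N0 u -> C u u.
  move=> Nu; split=> //; rewrite /conj_equiv mulVg mulg1 mulVg; exact: N0_1.
(* Equivalent elements have the same set [C u], hence the same chosen representative. The default is
   never taken on N_0, where [C u] contains [u]. *)
pose c u : G := xget 1%g (C u).
have cC u : N0 u -> C u (c u) by move=> Nu; apply: (xgetPex 1%g); exists u; exact: Cu.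
have ceq u v : conj_equiv t u v -> c u = c v.
  move=> uv; congr xget; apply/seteqP; split=> w [Nw] h; split=> //.
    exact: equivM (equivV _ _ uv) h.
  exact: equivM uv h.
have fin : finite_set [set c u | u in @N0 n F].
  apply: contrapT => /infiniteP/card_leP[h].
  pose f (i : nat) : G := val (h (SigSub (mem_set I : i \in [set: nat]))).
  have /boolp.choice[u uP] (i : nat) : exists u, N0 u /\ c u = f i.
    have [u Nu cu] := set_mem (valP (h (SigSub (mem_set I : i \in [set: nat])))).
    by exists u.
  have [U [UU Uoo]] := exists_ultra; have pU : ProperFilter U by exact: ultra_proper.
  have [|l Nl lP] := @N0_ulim U UU Uoo u; first by move=> i; have [] := uP i.
  (* Level 0 suffices: a conjugate by [t^-1] that is integral and unipotent is in N_0. *)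
  have [R RP] := congr_sub_conj t 0.
  have [i /= li] := filter_ex (lP R).
  have Ui : U [set j | (i < j)%N] by apply: Uoo; exists i.+1.
  have [j [/= ij lj]] := filter_ex (filterI Ui (lP R)).
  have [Nui ci] := uP i; have [Nuj cj] := uP j.
  have Nw : N0 ((u i)^-1 * u j)%g by apply: N0_M => //; exact: N0_V.
  have uij : conj_equiv t (u i) (u j).
    rewrite /conj_equiv; apply: unipotent_N0.
      rewrite -{2}[t]invgK; apply: torus_conj_unipotent; last by case: Nw.
      exact/torusV/Tplus_torus.
    rewrite -[glmx _](subrK 1%:M); apply: mxvgeD; last exact: mxvge_1.
    have E : glmx ((u i)^-1 * u j)%g - 1%:M =
        glmx (u i)^-1%g *m (glmx (u j) - glmx (u i)).
      by rewrite mulmxBr glV_mulmx.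
    apply: RP; rewrite /congr_sub /mkset E -[R%:Z]add0r; apply: mxvgeM; first exact/N0_mxvge/N0_V.
    by apply: mxvge_trans lj _; exact: mxvge_sym.
  have : f i = f j by rewrite -ci -cj; exact: ceq.
  move/val_inj/(@inj _ _ _ h _ _ (mem_set I) (mem_set I))/(congr1 val) => /= e.
  by rewrite e ltnn in ij.
have [s us] : exists2 s : seq G, uniq s & [set c u | u in @N0 n F] = [set` s].
  by have [s sP] := (finite_seqP _).1 fin; exists (undup s); rewrite ?undup_uniq//;
     rewrite sP; apply/seteqP; split=> x /=; rewrite mem_undup.
move=> sP; have sE u : u \in s -> exists2 v, N0 v & c v = u.
  by move=> us'; have : [set` s] u by []; rewrite -sP.
exists s; split=> // [u /sE[v Nv <-]|u v /sE[u' Nu <-] /sE[v' Nv <-]|v Nv].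
- by case: (cC v Nv).
- have [_ cu] := cC _ Nu; have [_ cv] := cC _ Nv => cuv.
  by apply: ceq; apply: (equivM _ _ _ cu); apply: (equivM _ _ _ cuv); exact: equivV.
- exists (c v); first by have : [set` s] (c v) by rewrite -sP; exists v.
  by apply: equivV; case: (cC v Nv).
Qed.

End N0Compact.

(** * The modules M_0 and M_{0,n!-1} *)

Section PrincipalSeries.
Variables (p : nat) (p_prime : prime p) (Q : padicType p) (F K : padicExtType Q).
Variables (n : nat) (chi : GL n F -> resfield K) (chi_char : smooth_character chi).
Local Notation G := (GL n F).
Local Notation k := (resfield K).
Local Notation w0 := (w0 n F).
Implicit Types (g h b c t u v : G) (x y z : G -> k).

Definition N0cell : set G :=
  [set g | exists u b, [/\ N0 u, borel b & g = (u * w0 * b)%g]].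

Lemma N0cell_borel g b : borel b -> N0cell g -> N0cell (g * b)%g.
Proof.
move=> bb [u [c [Nu bc ->]]]; exists u, (c * b)%g; rewrite mulgA.
by split=> //; exact: borelM.
Qed.

Lemma N0cell_borelE g b : borel b -> N0cell (g * b)%g <-> N0cell g.
Proof.
move=> bb; split; last exact: N0cell_borel.
by move=> /(N0cell_borel (borelV bb)); rewrite mulgK.
Qed.

Lemma N0cell_N0 g v : N0 v -> N0cell g -> N0cell (v * g)%g.
Proof.
move=> Nv [u [c [Nu bc ->]]]; exists (v * u)%g, c; rewrite !mulgA.
by split=> //; exact: N0_M.
Qed.

Lemma N0cell_Tplus g t : Tplus t -> N0cell g -> N0cell (t * g)%g.
Proof.
move=> Tt [u [c [Nu bc ->]]]; have tt := Tplus_torus Tt.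
exists (t * u * t^-1)%g, (w0 * t * w0 * c)%g; split.
- exact: Tt.2.
- by apply: borelM => //; exact/torus_borel/torus_w0.
- rewrite !mulgA -[X in _ = (X * c)%g]mulgA; congr (_ * _)%g.
  by rewrite -!mulgA (mulgA w0 w0) w0w0 mul1g (mulgA t^-1%g) mulVg mul1g.
Qed.

Lemma N0cell_Bplus g b : Bplus b -> N0cell g -> N0cell (b * g)%g.
Proof.
by move=> [u [t [Nu Tt ->]]] h; rewrite -mulgA; exact/N0cell_N0/N0cell_Tplus.
Qed.

(** Factor [u^-1 * h * u] by [iwahori]. Its lower triangular factor becomes upper triangular on
    crossing [w0], with diagonal entries close to 1, on which [chi] is trivial. *)
Lemma congr_sub_N0w0 h u : congr_sub 1 h -> N0 u -> exists v c,
  [/\ N0 v, borel c, bchi chi c = 1 & (h * u * w0)%g = (v * w0 * c)%g].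
Proof.
move=> h1 Nu; have [v [L [Nv Ll L1 e]]] := iwahori (congr_sub_conjN0 Nu h1).
have bL : borel (w0 * L * w0)%g.
  by apply/lower_w0; rewrite !mulgA w0w0 mul1g -mulgA w0w0 mulg1.
exists (u * v)%g, (w0 * L * w0)%g; split=> //; first exact: N0_M.
  by apply: bchi_congr => // i; rewrite w0_conj; exact: L1.
rewrite !mulgA -(mulgA _ w0 w0) w0w0 mulg1 -(mulgA u) -e.
by rewrite !mulgA mulgV mul1g.
Qed.

Lemma N0cell_congr g h : congr_sub 1 h -> N0cell (h * g)%g <-> N0cell g.
Proof.
have imp g' h' : congr_sub 1 h' -> N0cell g' -> N0cell (h' * g')%g.
  move=> h1 [u [b [Nu bb ->]]]; have [v [c [Nv bc _ e]]] := congr_sub_N0w0 h1 Nu.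
  exists v, (c * b)%g; split=> //; first exact: borelM.
  by rewrite !mulgA e.
move=> h1; split; last exact: imp.
by move=> /(imp _ _ (congr_subV (ltn0Sn 0) h1)); rewrite mulKg.
Qed.

Definition equivariant x := forall g b, borel b -> x (g * b)%g = (bchi chi b)^-1 * x g.

(** The radius is uniform in [g], whereas [locally_constant] allows it to vary from point to
    point. *)
Definition smooth x := exists r, forall h g, congr_sub r h -> x (h * g)%g = x g.

Lemma smooth_le x : smooth x ->
  exists2 r, (0 < r)%N & forall h g, congr_sub r h -> x (h * g)%g = x g.
Proof.
move=> [r rP]; exists r.+1 => // h g hr; apply: rP; exact: congr_sub_le hr.
Qed.

Lemma IndP x : smooth x -> equivariant x -> Ind chi x.
Proof. by move=> [r xr] xe; split=> //; exact: congr_inv_locally_constant xr. Qed.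

Lemma smooth_lin (a : k) x y : smooth x -> smooth y -> smooth (fun g => a * x g + y g).
Proof.
move=> [r rP] [s sP]; exists (maxn r s) => h g hrs.
by rewrite rP ?sP//; apply: congr_sub_le hrs; rewrite ?leq_maxl ?leq_maxr.
Qed.

Lemma smooth_gact b x : smooth x -> smooth (gact b x).
Proof.
move=> [r rP]; have [R RP] := congr_sub_conj b r.
exists R => h g /RP hr; rewrite /gact -(rP _ (b^-1 * g)%g hr).
by rewrite !mulgA mulgK.
Qed.

Lemma gactM b c x : gact (b * c)%g x = gact b (gact c x).
Proof. by apply: funext => g; rewrite /gact invgM mulgA. Qed.

Lemma gact1 x : gact 1%g x = x.
Proof. by apply: funext => g; rewrite /gact invg1 mul1g. Qed.

Lemma Ind_U1_smooth x : Ind_U1 chi x -> smooth x.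
Proof.
move=> [_ xU]; exists 1%N => h g h1.
have /xU/(congr1 (fun y => y g)) : U1 h^-1%g.
  by apply/U1E/congr_subV.
by rewrite /gact invgK.
Qed.

Lemma M0P x : M0 chi x -> smooth x /\ equivariant x.
Proof.
move=> [m [c [b [v [bB vI xE]]]]].
have vs i : smooth (v i) by exact: Ind_U1_smooth.
split; last first.
  move=> g d bd; rewrite !xE mulr_sumr; apply: eq_bigr => i _.
  have [[_ ve] _] := vI i; rewrite /gact mulgA ve// mulrCA.
  by [].
rewrite (funext xE); elim: m c b v {bB vI xE} vs => [|m IH] c b v vs.
  by exists 0%N => h g _; rewrite !big_ord0.
have -> : (fun g => \sum_(i < m.+1) c i * gact (b i) (v i) g) = (fun g =>
    c ord0 * gact (b ord0) (v ord0) g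
    + \sum_(i < m) c (lift ord0 i) * gact (b (lift ord0 i)) (v (lift ord0 i)) g).
  by apply: funext => g; rewrite big_ord_recl.
apply: smooth_lin; first exact: smooth_gact.
by apply: (IH (fun i => c (lift ord0 i)) (fun i => b (lift ord0 i))
  (fun i => v (lift ord0 i))) => i; exact: vs.
Qed.

Lemma M0_lin (a : k) x y : M0 chi x -> M0 chi y -> M0 chi (fun g => a * x g + y g).
Proof.
move=> [m [c [b [v [bB vI xE]]]]] [m' [c' [b' [v' [bB' vI' yE]]]]].
pose pick T (f : 'I_m -> T) (f' : 'I_m' -> T) (i : 'I_(m + m')) :=
  match fintype.split i with inl j => f j | inr j => f' j end.
exists (m + m')%N, (pick _ (fun i => a * c i) c'), (pick _ b b'), (pick _ v v').
split=> [i|i|g]; first by rewrite /pick; case: fintype.split.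
  by rewrite /pick; case: fintype.split.
rewrite xE yE big_split_ord /= mulr_sumr /pick; congr (_ + _); apply: eq_bigr => i _.
  by rewrite (_ : fintype.split (lshift m' i) = inl i) ?mulrA//; exact: (unsplitK (inl i)).
by rewrite (_ : fintype.split (rshift m i) = inr i)//; exact: (unsplitK (inr i)).
Qed.

Lemma M0_0 : M0 chi (fun=> 0).
Proof.
exists 0%N, (fun=> 0), (fun=> 1%g), (fun _ _ => 0); split=> [[]//|[]//|g].
by rewrite big_ord0.
Qed.

Lemma M0_sum (I : Type) (s : seq I) (P : pred I) (a : I -> k) (x : I -> G -> k) :
  (forall i, P i -> M0 chi (x i)) -> M0 chi (fun g => \sum_(i <- s | P i) a i * x i g).
Proof.
move=> xM; elim: s => [|i s IH].
  by rewrite (_ : (fun g => _) = fun=> 0); [exact: M0_0|apply: funext => g; rewrite big_nil].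
have [Pi|nPi] := boolP (P i).
  rewrite (_ : (fun g => _) = fun g => a i * x i g + \sum_(j <- s | P j) a j * x j g).
    by apply: M0_lin => //; exact: xM.
  by apply: funext => g; rewrite big_cons Pi.
rewrite (_ : (fun g => _) = fun g => \sum_(j <- s | P j) a j * x j g)//.
by apply: funext => g; rewrite big_cons (negPf nPi).
Qed.

Lemma M0_gact b x : Bplus b -> M0 chi x -> M0 chi (gact b x).
Proof.
move=> Bb [m [c [d [v [dB vI xE]]]]].
exists m, c, (fun i => (b * d i)%g), v; split=> // [i|g]; first exact: BplusM.
by rewrite -[LHS]/(x _) xE; apply: eq_bigr => i _; rewrite gactM.
Qed.

Lemma M0_Ind_U1 x : Ind_U1 chi x -> M0 chi x.
Proof.
move=> xI; exists 1%N, (fun=> 1), (fun=> 1%g), (fun=> x); split=> // [_|g].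
  exact/Bplus_N0/N0_1.
by rewrite big_ord1 mul1r gact1.
Qed.

Lemma equivariant_gact b x : equivariant x -> equivariant (gact b x).
Proof. by move=> xe g c bc; rewrite /gact mulgA xe. Qed.

Lemma equivariant_lin (a : k) x y :
  equivariant x -> equivariant y -> equivariant (fun g => a * x g + y g).
Proof. by move=> xe ye g b bb; rewrite xe// ye// mulrDr mulrCA. Qed.

(** The constant function 1 of C^oo(N_0), seen on G. It is well defined by uniqueness in the big
    cell, and [congr_sub_N0w0] makes it U^(1)-invariant. *)
Lemma exists_cell_function : exists x : G -> k,
  [/\ Ind_U1 chi x, forall u b, N0 u -> borel b -> x (u * w0 * b)%g = (bchi chi b)^-1 &
    forall g, ~ N0cell g -> x g = 0].
Proof.
have /boolp.choice[x xP] (g : G) : exists a : k,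
    (forall u b, N0 u -> borel b -> g = (u * w0 * b)%g -> a = (bchi chi b)^-1) /\
    (~ N0cell g -> a = 0).
  have [[u [b [Nu bb ->]]]|ng] := pselect (N0cell g); last first.
    exists 0; split=> // u b Nu bb gE; case: ng; by exists u, b.
  exists (bchi chi b)^-1; split=> [v c [uv _] bc|[]]; last by exists u, b.
  by have [uu _] := Nu; move/(big_cell_inj uu uv bb bc) => [_ ->].
have xE u b : N0 u -> borel b -> x (u * w0 * b)%g = (bchi chi b)^-1.
  by move=> Nu bb; exact: ((xP _).1 u b Nu bb erefl).
have x0 g : ~ N0cell g -> x g = 0 by exact: (xP g).2.
have xe : equivariant x.
  move=> g b bb; have [[u [c [Nu bc ->]]]|ng] := pselect (N0cell g); last first.
    by rewrite !x0 ?mulr0// => /(N0cell_borelE g bb).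
  by rewrite -mulgA !xE ?bchiM ?invfM 1?mulrC//; exact: borelM.
have xU h g : congr_sub 1 h -> x (h * g)%g = x g.
  move=> h1; have [[u [b [Nu bb ->]]]|ng] := pselect (N0cell g); last first.
    by rewrite !x0// => /(N0cell_congr g h1).
  have [v [c [Nv bc c1 e]]] := congr_sub_N0w0 h1 Nu.
  rewrite !mulgA e -mulgA !xE ?bchiM ?c1 ?mul1r//; exact: borelM.
exists x; split=> //; split; first by apply: IndP => //; exists 1%N.
move=> u /U1E/(congr_subV (ltn0Sn 0)) u1; apply: funext => g; exact: xU.
Qed.

(** For a sufficiently contracting [t], the function [x] is constant on the cosets of t N_0 t^-1
    (times [w0]), and the translates of [f0] by the [u * t] are supported on one coset each; so [x]
    is a combination of them. *)
Lemma M0w_M0 x : M0w chi x -> M0 chi x.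
Proof.
move=> [[xlc xe] xs].
have [m mP] := locally_constant_N0 p_prime xlc.
have [t [Tt tm _]] := exists_contraction_N0 F n m.
have [s [us sN sinj scov]] := N0_cosets p_prime Tt.
have [f0 [fI fE f0out]] := exists_cell_function.
(* [t^-1 * w0 = w0 * d]; the factor [bchi chi d] in [y] cancels the value of [f0] that this
   produces. *)
have tt := Tplus_torus Tt; pose d := (w0 * t^-1 * w0)%g.
have bd : borel d by exact/torus_borel/torus_w0/torusV.
pose y g := \sum_(u <- s | u \in s) (x (u * w0)%g * bchi chi d) * gact (u * t)%g f0 g.
have yM : M0 chi y.
  apply: M0_sum => u us'; apply: M0_gact; last exact: M0_Ind_U1.
  by exists u, t; split=> //; exact: sN.
suff -> : x = y by [].
apply: funext => g; rewrite /y.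
have [[v [b [Nv bb ->]]]|ng] := pselect (N0cell g); last first.
  rewrite big1_seq => [|u /andP[us' _]].
    by apply/eqP/negPn/negP => /eqP xg; apply: ng; apply: xs; exact/eqP.
  rewrite /gact f0out ?mulr0// => h; apply: ng.
  have := @N0cell_Bplus _ (u * t)%g _ h; rewrite mulVKg; apply.
  by exists u, t; split=> //; exact: sN.
have actE u : gact (u * t)%g f0 (v * w0 * b)%g =
    f0 (t^-1 * (u^-1 * v) * t * w0 * (d * b))%g.
  rewrite /gact; congr f0; rewrite /d invgM !mulgA; congr (_ * _)%g.
  rewrite -!mulgA; congr (_ * (_ * (_ * _)))%g.
  by rewrite (mulgA w0 w0) w0w0 mul1g mulVKg.
have [u0 u0s u0v] := scov v Nv.
(* Only the coset of [v] contributes: if [f0] does not vanish on the term of [u], uniqueness in the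
   big cell puts [t^-1 * u^-1 * v * t] in N_0. *)
rewrite -big_seq (bigD1_seq u0)//= big1_seq ?addr0 => [|u /andP[uu0 us']]; last first.
  rewrite actE f0out ?mulr0// => -[u' [b' [Nu' bb' e]]].
  move/negP: uu0; apply; apply/eqP/esym; apply: (sinj _ _ u0s us').
  have bdb : borel (d * b)%g by exact: borelM.
  have [[[uv _] [uu _]] [uu' _]] := (Nv, sN _ us', Nu').
  have uni : unipotent (t^-1 * (u^-1 * v) * t)%g.
    rewrite -{2}[t]invgK; apply: torus_conj_unipotent; first exact: torusV.
    by apply: unipotentM => //; exact: unipotentV.
  have [e1 _] := big_cell_inj uni uu' bdb bb' e.
  have Nuv : N0 (t^-1 * (u^-1 * v) * t)%g by rewrite e1.
  have := N0_M u0v (N0_V Nuv); rewrite /conj_equiv !invgM !invgK !mulgA.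
  by rewrite !mulgK.
rewrite actE fE//; last exact: borelM.
rewrite bchiM// invfM mulrA mulfK ?bchi_neq0// mulrC xe//; congr (_ * _).
(* [v] and [u0] differ by an element of t N_0 t^-1, which is congruent to 1 to the order [m] at
   which [x] is constant. *)
have Nu0 := sN _ u0s; have := tm _ u0v => tu.
have vE : v = (u0 * (t * (t^-1 * (u0^-1 * v) * t) * t^-1))%g.
  by rewrite !mulgA !mulgK mulgV mul1g.
apply: mP => //; set a := (t * _ * _)%g in vE tu.
have -> : glmx v - glmx u0 = glmx u0 *m (glmx a - 1%:M).
  by rewrite vE mulmxBr mulmx1.
by rewrite -[m%:Z]add0r; apply: mxvgeM => //; exact: N0_mxvge.
Qed.

Lemma M0w_gact b x : Bplus b -> M0w chi x -> M0w chi (gact b x).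
Proof.
move=> Bb xM; have [xs xe] := M0P (M0w_M0 xM); have [_ supp] := xM.
split; first by apply: IndP; [exact: smooth_gact|exact: equivariant_gact].
by move=> g /supp/(N0cell_Bplus Bb); rewrite mulVKg.
Qed.

Lemma M0w_lin (a : k) x y : M0w chi x -> M0w chi y -> M0w chi (fun g => a * x g + y g).
Proof.
move=> xM yM; have [xs xe] := M0P (M0w_M0 xM); have [ys ye] := M0P (M0w_M0 yM).
split; first by apply: IndP; [exact: smooth_lin|exact: equivariant_lin].
move=> g; have [_ suppx] := xM; have [_ suppy] := yM.
have [x0|/suppx//] := eqVneq (x g) 0.
by rewrite x0 mulr0 add0r => /suppy.
Qed.

(** Truncation to N_0 w_0 B, a linear projection of M_0 onto M_{0,n!-1}. *)
Definition cut x : G -> k := fun g => if pselect (N0cell g) then x g else 0.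

Lemma cut_in x g : N0cell g -> cut x g = x g.
Proof. by rewrite /cut; case: pselect. Qed.

Lemma cut_out x g : ~ N0cell g -> cut x g = 0.
Proof. by rewrite /cut; case: pselect. Qed.

Lemma cut_M0w x : M0 chi x -> M0w chi (cut x).
Proof.
move=> /M0P[xs xe]; split; last first.
  move=> g; have [//|ng] := pselect (N0cell g).
  by rewrite cut_out// eqxx.
apply: IndP.
  have [r r0 rP] := smooth_le xs; exists r => h g hr.
  have e := N0cell_congr g (congr_sub_le r0 hr).
  have [gc|gc] := pselect (N0cell g); first by rewrite !cut_in ?rP//; exact/e.
  by rewrite !cut_out// => /e.
move=> g b bb; have e := N0cell_borelE g bb.
have [gc|gc] := pselect (N0cell g); first by rewrite !cut_in ?xe//; exact/e.
by rewrite !cut_out ?mulr0// => /e.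
Qed.

Lemma cut_id x : M0w chi x -> cut x = x.
Proof.
move=> [_ supp]; apply: funext => g.
have [gc|gc] := pselect (N0cell g); first by rewrite cut_in.
by rewrite cut_out//; apply/esym/eqP/negPn/negP => /supp.
Qed.

End PrincipalSeries.

(** * Dual modules *)

Section Socle.
Variables (K : valuedFieldType) (piK : oring K).
Hypotheses (piK_neq0 : val piK != 0) (piK_unif : vord (val piK) = 1).
Local Notation pr := (\pi_(Quotient.quot (@ointeger K))).

Lemma fracmod_eq (a b : K) : vge 0 (a - b) -> pr a = pr b.
Proof. by move=> ab; apply/eqP; rewrite -Quotient.idealrBE. Qed.

(* The isomorphism of the residue field with the pi-torsion of K / o. *)
Definition socle (c : resfield K) : fracmod K := pr (val (repr c) / val piK).

Lemma vge_div_pi (a : K) : vge 1 a = vge 0 (a / val piK).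
Proof.
have [->|a0] := eqVneq a 0; first by rewrite mul0r !vge0.
have := vordM _ _ a0 piK_neq0.
have e : a = a / val piK * val piK by rewrite divfK.
have d0 : a / val piK != 0 by rewrite mulf_neq0 ?invr_neq0.
have := vordM _ _ d0 piK_neq0; rewrite -e piK_unif.
by rewrite /vge (negPf a0) (negPf d0) /=; lia.
Qed.

(** Independence of the lift: two lifts differ by a multiple of [piK]. *)
Lemma socle_residue (a : oring K) : socle (residue a) = pr (val a / val piK).
Proof.
apply: fracmod_eq; rewrite -mulrBl -vge_div_pi.
have : residue (repr (residue a) - a) == 0 by rewrite residueB residue_repr subrr.
by rewrite residue_eq0 unfold_in rmorphB.
Qed.

Lemma socleD c d : socle (c + d) = socle c + socle d.
Proof.
rewrite -[c]residue_repr -[d]residue_repr -residueD !socle_residue rmorphD mulrDl.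
exact: (raddfD pr).
Qed.

Lemma socleZ (a : oring K) c : socle (residue a * c) = a *: socle c.
Proof.
rewrite -[c]residue_repr -residueM !socle_residue rmorphM -mulrA.
by rewrite -[RHS]/(fracmod_scale _ _) fracmod_scaleE.
Qed.

Lemma socle_eq0 c : socle c = 0 -> c = 0.
Proof.
rewrite -[c]residue_repr socle_residue -[0](raddf0 pr) => /eqP.
rewrite -Quotient.idealrBE subr0 => h; apply/eqP.
by rewrite residue_eq0 unfold_in vge_div_pi.
Qed.

Lemma socle_torsion (y : fracmod K) : piK *: y = 0 -> exists c, y = socle c.
Proof.
elim/fracmod_ind: y => z; rewrite -[_ *: _]/(fracmod_scale _ _) fracmod_scaleE.
rewrite -[0](raddf0 pr) => /eqP; rewrite -Quotient.idealrBE subr0 => h.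
by exists (residue (Oring h)); rewrite socle_residue /= mulrAC mulfV// mul1r.
Qed.

End Socle.

(** * Functionals and their Lambda(N_0)-action *)

Section Duals.
Variables (p : nat) (Q : padicType p) (F K : padicExtType Q) (n : nat).
Local Notation G := (GL n F).
Local Notation k := (resfield K).
Implicit Types (x y : G -> k).

Lemma dual_extE (M : set (G -> k)) (f : dual M) (z : M) : dual_ext f (val z) = f z.
Proof. by rewrite /dual_ext valK. Qed.

Lemma dual_ext_in (M : set (G -> k)) (f : dual M) x (Mx : M x) :
  dual_ext f x = f (SigSub (mem_set Mx)).
Proof. by rewrite -dual_extE. Qed.

Lemma dual_eq (M : set (G -> k)) (f g : dual M) :
  (forall x, M x -> dual_ext f x = dual_ext g x) -> f = g.
Proof.
move=> h; apply: val_inj; apply: funext => z /=.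
by have := h (val z) (set_mem (valP z)); rewrite !dual_extE.
Qed.

Lemma dual_ext_out (M : set (G -> k)) (f : dual M) x : ~ M x -> dual_ext f x = 0.
Proof.
by move=> Mx; rewrite /dual_ext insubN//; apply/negP => /set_mem.
Qed.

Lemma dual_extD (M : set (G -> k)) (f g : dual M) x :
  dual_ext (f + g) x = dual_ext f x + dual_ext g x.
Proof.
have [Mx|Mx] := pselect (M x); last by rewrite !dual_ext_out ?addr0.
by rewrite !dual_ext_in.
Qed.

Lemma dual_extN (M : set (G -> k)) (f : dual M) x : dual_ext (- f) x = - dual_ext f x.
Proof.
have [Mx|Mx] := pselect (M x); last by rewrite !dual_ext_out ?oppr0.
by rewrite !dual_ext_in.
Qed.

Lemma dual_ext0 (M : set (G -> k)) x : dual_ext (0 : dual M) x = 0.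
Proof.
have [Mx|Mx] := pselect (M x); last by rewrite !dual_ext_out.
by rewrite !dual_ext_in.
Qed.

Lemma dual_ext_lin (M : set (G -> k)) (f : dual M) (a : oring K) x y :
  M x -> M y -> M (fun g => residue a * x g + y g) ->
  dual_ext f (fun g => residue a * x g + y g) = a *: dual_ext f x + dual_ext f y.
Proof.
move=> Mx My Mz; rewrite !dual_ext_in; have := dualvalP f.
by move=> /asboolP; apply.
Qed.

(** Excludes the default 0 of [insubd] once the formula is linear. [Phi] is defined on all
    functions, so that it can be evaluated without carrying membership proofs. *)
Lemma insubd_dual (M : set (G -> k)) (phi : M -> fracmod K) (Phi : (G -> k) -> fracmod K) :
  (forall z, phi z = Phi (val z)) ->
  (forall (a : oring K) x y, M x -> M y -> M (fun g => residue a * x g + y g) ->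
    Phi (fun g => residue a * x g + y g) = a *: Phi x + Phi y) ->
  forall x, M x -> dual_ext (insubd 0 phi : dual M) x = Phi x.
Proof.
move=> phiE Plin x Mx; rewrite dual_ext_in.
have lin : phi \in @linear_on p Q F K n M.
  apply/asboolP => a u v w e; rewrite !phiE.
  have ew : val w = (fun g => residue a * val u g + val v g) by apply: funext.
  rewrite ew; apply: Plin; [exact: set_mem (valP u)|exact: set_mem (valP v)|].
  by rewrite -ew; exact: set_mem (valP w).
by rewrite /= (insubdK _ lin) phiE.
Qed.

Lemma gact_lin b (a : k) x y :
  gact b (fun g => a * x g + y g) = (fun g => a * gact b x g + gact b y g).
Proof. by []. Qed.

Definition lin_closed (M : set (G -> k)) :=
  forall (a : k) x y, M x -> M y -> M (fun g => a * x g + y g).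

Lemma dual_psiE (M : set (G -> k)) t (f : dual M) x :
  lin_closed M -> (forall x, M x -> M (gact t x)) -> M x ->
  dual_ext (dual_psi t f) x = dual_ext f (gact t x).
Proof.
move=> Ml Mt Mx.
apply: (insubd_dual (Phi := fun x => dual_ext f (gact t x))) => // a u v Mu Mv Mw.
by rewrite gact_lin dual_ext_lin//; [exact: Mt|exact: Mt|exact/Ml/Mt/Mv/Mt].
Qed.

Lemma dual_restrE (M M' : set (G -> k)) (f : dual M) x : lin_closed M' -> M' `<=` M ->
  M' x -> dual_ext (dual_restr M' f) x = dual_ext f x.
Proof.
move=> Ml M'M M'x.
apply: (insubd_dual (Phi := fun x => dual_ext f x)) => // a u v Mu Mv Mw.
by rewrite dual_ext_lin//; exact: M'M.
Qed.

Section N0Subgroups.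
Variable r : nat.

Definition n0_congr : set (N0grp n F) := [set u | congr_sub r (n0val u)].

Lemma n0_N0 (u : N0grp n F) : N0 (n0val u). Proof. exact: set_mem (n0valP u). Qed.

Lemma n0_congr_open : open n0_congr.
Proof.
rewrite openE => u ur; apply: (@filterS _ (nbhs u) (nbhs_filter u) _ _ _ (nbhs_n0 u r)).
by move=> v vu; exact: mxvge_trans vu ur.
Qed.

Lemma n0_congr1 : n0_congr 1%g.
Proof. by move=> i j; rewrite subrr mxE vge0. Qed.

Lemma n0_congrM u v : n0_congr u -> n0_congr v -> n0_congr (u * v)%g.
Proof.
move=> ur vr; rewrite /n0_congr /= /congr_sub /=.
have -> : glmx (n0val u) *m glmx (n0val v) - 1%:M =
    glmx (n0val u) *m (glmx (n0val v) - 1%:M) + (glmx (n0val u) - 1%:M).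
  by rewrite mulmxBr mulmx1 addrA subrK.
apply: mxvgeD => //; rewrite -[r%:Z]add0r; apply: mxvgeM => //.
exact/N0_mxvge/n0_N0.
Qed.

Lemma n0_congrV u : n0_congr u -> n0_congr u^-1%g.
Proof.
move=> ur; rewrite /n0_congr /= /congr_sub /=.
have -> : invmx (glmx (n0val u)) - 1%:M =
    - (glmx (n0val u)^-1%g *m (glmx (n0val u) - 1%:M)).
  by rewrite mulmxBr mulmx1 glV_mulmx opprB.
apply: mxvgeN; rewrite -[r%:Z]add0r; apply: mxvgeM => //.
exact/N0_mxvge/N0_V/n0_N0.
Qed.

Lemma n0_congrJ u v : n0_congr u -> n0_congr (v^-1 * u * v)%g.
Proof. by move=> ur; apply: congr_sub_conjN0 => //; exact: n0_N0. Qed.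

Definition n0_congr_subgroup : onsubgroup (N0grp n F) :=
  OnSubgroup n0_congr_open n0_congr1 n0_congrM n0_congrV n0_congrJ.

End N0Subgroups.

Lemma smooth_fixes x : smooth x -> exists H : onsubgroup (N0grp n F), fixes H x.
Proof.
move=> /smooth_le[r r0 rP]; exists (n0_congr_subgroup r) => u ur.
by apply: funext => g; apply: rP; exact: congr_subV.
Qed.

Program Definition onsubgroupI (H H' : onsubgroup (N0grp n F)) :=
  @OnSubgroup _ (onset H `&` onset H') _ _ _ _ _.
Next Obligation. by move=> H H'; apply: openI; exact: on_open. Qed.
Next Obligation. by move=> H H'; split; exact: on1. Qed.
Next Obligation. by move=> H H' g h [? ?] [? ?]; split; exact: onM. Qed.
Next Obligation. by move=> H H' g [? ?]; split; exact: onV. Qed.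
Next Obligation. by move=> H H' g h [? ?]; split; exact: onJ. Qed.

Section Scale.
Variables (M : set (G -> k)).
Hypotheses (M_lin : lin_closed M) (M_smooth : forall x, M x -> smooth x).
Hypothesis (M_N0 : forall u x, N0 u -> M x -> M (gact u x)).
Variables (l : Lambda n F K) (f : dual M).

Definition scale_at (H : onsubgroup (N0grp n F)) x : fracmod K :=
  mint (cglev l H) (fun q => dual_ext f (gact (n0val (repr q))^-1%g x)).

(** By normality [u * v^-1] is also in [H], and therefore fixes [x]. *)
Lemma fixes_repr (H : onsubgroup (N0grp n F)) x (u v : N0grp n F) : fixes H x ->
  onset H (u^-1 * v)%g -> gact (n0val v)^-1%g x = gact (n0val u)^-1%g x.
Proof.
move=> Hx /(onJ u^-1%g); rewrite invgK mulgA mulgV mul1g => /onV.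
rewrite invgM invgK => /Hx e.
by rewrite -[in RHS]e -gactM n0valM mulgA mulVg mul1g.
Qed.

Lemma scale_at_le (H H' : onsubgroup (N0grp n F)) x :
  onset H `<=` onset H' -> fixes H' x -> scale_at H x = scale_at H' x.
Proof.
move=> HH' H'x; rewrite /scale_at -(cgcompat l HH') mint_push; apply: eq_mint => q.
elim/gquot_ind: q => u /=; rewrite (gquot_mapE (theta := id) (fun _ _ => erefl) HH').
have Hx : fixes H x by move=> v /HH'; exact: H'x.
by rewrite (fixes_repr Hx (gquot_repr H u)) (fixes_repr H'x (gquot_repr H' u)).
Qed.

Lemma scale_at_indep (H H' : onsubgroup (N0grp n F)) x :
  fixes H x -> fixes H' x -> scale_at H x = scale_at H' x.
Proof.
move=> Hx H'x; have le : onset (onsubgroupI H H') `<=` onset H by move=> u [].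
have le' : onset (onsubgroupI H H') `<=` onset H' by move=> u [].
by rewrite -(scale_at_le le Hx) (scale_at_le le' H'x).
Qed.

Lemma fixes_lin (H : onsubgroup (N0grp n F)) (a : k) x y : fixes H x -> fixes H y ->
  fixes H (fun g => a * x g + y g).
Proof. by move=> Hx Hy u Hu; rewrite gact_lin Hx// Hy. Qed.

Lemma scale_at_lin (H : onsubgroup (N0grp n F)) (a : oring K) x y : M x -> M y ->
  scale_at H (fun g => residue a * x g + y g) = a *: scale_at H x + scale_at H y.
Proof.
move=> Mx My; rewrite /scale_at -mint_scaler -mint_addr; apply: eq_mint => q.
have Nq : N0 (n0val (repr q))^-1%g by exact/N0_V/n0_N0.
by rewrite gact_lin dual_ext_lin//; [exact: M_N0|exact: M_N0|apply: M_lin; exact: M_N0].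
Qed.

(** Replaces the subgroup chosen inside [dual_scale] by any [H] that fixes [x]; two such subgroups
    are compared through their intersection, which also gives linearity in [x]. *)
Lemma dual_scaleE (H : onsubgroup (N0grp n F)) x : M x -> fixes H x ->
  dual_ext (dual_scale l f) x = scale_at H x.
Proof.
move=> Mx Hx.
pose Phi x := if pselect (exists H, fixes H x) is left e
  then scale_at (sval (cid e)) x else 0.
have PhiE H' y : fixes H' y -> Phi y = scale_at H' y.
  move=> H'y; rewrite /Phi; case: pselect => [e|[]]; last by exists H'.
  by apply: scale_at_indep => //; exact: (svalP (cid e)).
rewrite -(PhiE _ _ Hx); apply: insubd_dual => // a y z My Mz _.
have [Hy yH] := smooth_fixes (M_smooth My); have [Hz zH] := smooth_fixes (M_smooth Mz).
have yI : fixes (onsubgroupI Hy Hz) y by move=> u [/yH].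
have zI : fixes (onsubgroupI Hy Hz) z by move=> u [_ /zH].
by rewrite (PhiE _ _ yI) (PhiE _ _ zI) (PhiE _ _ (fixes_lin (residue a) yI zI)) scale_at_lin.
Qed.

End Scale.
End Duals.

(** * Etale modules *)

Section SpanPred.
Variables (k : fieldType) (m : nat) (S : set 'rV[k]_m).
Hypotheses (S0 : S 0) (S_lin : forall a u v, S u -> S v -> S (a *: u + v)).

Lemma lin_sum (I : Type) (s : seq I) (a : I -> k) (v : I -> 'rV[k]_m) :
  (forall i, S (v i)) -> S (\sum_(i <- s) a i *: v i).
Proof.
move=> Sv; elim: s => [|i s IH]; first by rewrite big_nil.
by rewrite big_cons; exact: S_lin.
Qed.

(** A vector killed by every linear form that kills [R] lies in the span of [R], hence in the
    subspace [S]. *)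
Lemma bidual_span (R : set 'rV[k]_m) (c : 'rV[k]_m) : R `<=` S ->
  (forall a : 'cV[k]_m, (forall v, R v -> v *m a = 0) -> c *m a = 0) -> S c.
Proof.
move=> RS kill.
pose P q := `[< exists2 B : 'M[k]_m, (forall i, S (row i B)) & \rank B = q >].
have P0 : exists q, P q.
  exists 0%N; apply/asboolP; exists 0; last by rewrite mxrank0.
  by move=> i; rewrite row0.
have Pm q : P q -> (q <= m)%N by move=> /asboolP[B _ <-]; exact: rank_leq_row.
(* Maximality of the rank makes the row space of [B] contain [R]: a row of [R] outside it could be
   added to [B]. *)
have [q /asboolP[B BS Bq] qmax] := ex_maxnP P0 Pm.
have SB u : S (u *m B).
  by rewrite mulmx_sum_row; exact: lin_sum.
have RB v : R v -> (v <= B)%MS.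
  move=> Rv; apply: contrapT => /negP vB.
  have : (B < B + v)%MS by rewrite ltmxE addsmxSl addsmx_sub submx_refl.
  rewrite ltmxErank => /andP[_]; rewrite Bq ltnNge => /negP; apply.
  apply: qmax; apply/asboolP; exists (B + v)%MS => // i.
  have /sub_addsmxP[[u w] /= ->] := row_sub i (B + v)%MS.
  by rewrite [w]mx11_scalar mul_scalar_mx addrC; apply: S_lin => //; exact: RS.
suff /submxP[u ->] : (c <= B)%MS by exact: SB.
rewrite submxE; apply/eqP/matrixP => i j.
(* The columns of the cokernel matrix are linear forms that kill [R]. *)
have /colP/(_ i) : col j (c *m cokermx B) = 0.
  rewrite colE -mulmxA -colE; apply: kill => v /RB.
  by rewrite submxE => /eqP vB; rewrite colE mulmxA vB mul0mx.
by rewrite !mxE.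
Qed.

End SpanPred.

(** * The etale decomposition and phi-stable submodules *)

Section EtaleModules.
Variables (p : nat) (Q : padicType p) (F K : padicExtType Q) (n : nat).
Variables (piK : oring K) (D : etale_module F n piK).
Local Notation G := (GL n F).
Implicit Types (t u v : G) (d : D) (O : set D).

Lemma submodule_sum O (I : Type) (s : seq I) (P : pred I) (E : I -> D) :
  submodule O -> (forall i, P i -> O (E i)) -> O (\sum_(i <- s | P i) E i).
Proof.
move=> [O0 Ol] PO; elim/big_rec: _ => [//|i d Pi Od].
by rewrite -[E i]scale1r; apply: Ol => //; exact: PO.
Qed.

Lemma bact_submodule O u d : submodule O -> N0 u -> O d -> O (bact u d).
Proof.
move=> [O0 Ol] Nu Od; have := bact_N0 (MkN0 (mem_set Nu)) d => /= ->.
by rewrite -[_ *: _]addr0; exact: Ol.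
Qed.

Lemma conj_cosets_N0 t C u : Tplus t -> conj_cosets t C -> C u -> N0 u.
Proof.
by move=> Tt [v Nv <-] [w Nw <-]; apply: N0_M => //; exact: Tt.2.
Qed.

Lemma conj_cosets_eq t C C' u u' v : Tplus t -> conj_cosets t C -> conj_cosets t C' ->
  C u -> C' u' -> N0 v -> (u^-1 * u')%g = (t * v * t^-1)%g -> C = C'.
Proof.
move=> Tt [a Na <-] [a' Na' <-] [b Nb ub] [b' Nb' ub'] Nv e.
have ea : a' = (a * (t * (b * v * b'^-1) * t^-1))%g.
  have -> : a' = (u' * (t * b'^-1 * t^-1))%g.
    by rewrite -ub' !mulgA mulgVK !mulgK.
  have -> : u' = (u * (t * v * t^-1))%g by rewrite -e mulVKg.
  by rewrite -ub !mulgA !mulgVK.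
have Nc : N0 (b * v * b'^-1)%g by apply: N0_M; [exact: N0_M|exact: N0_V].
rewrite ea; move: (b * v * b'^-1)%g Nc => c Nc.
apply/seteqP; split=> g [w Nw <-].
  exists (c^-1 * w)%g; first by apply: N0_M => //; exact: N0_V.
  by rewrite !mulgA mulgVK mulgK.
exists (c * w)%g; first exact: N0_M.
by rewrite !mulgA mulgVK.
Qed.

(** The etale decomposition is [d = sum of u phi_t(psi_t(u^-1 d))]: applying [psi t] after [u^-1] to
    it isolates the term of the coset of [u]. So every term is in [O]. *)
Lemma etale_submodule O t d : submodule O -> (forall d, O d -> O (bact t d)) ->
  Tplus t -> (forall u, N0 u -> O (psi t (bact u^-1%g d))) -> O d.
Proof.
move=> Osub Ot Tt Opsi.
have [s [[sin sout sfin dE] _]] := phi_etale Tt d.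
have /finite_seqP[r0 r0E] := sfin.
(* The sum over all cosets becomes a sum over a list, which contains those with a nonzero term. *)
pose r := undup [seq C <- r0 | C \in conj_cosets t].
have rE C : (C \in r) = (C \in r0) && (C \in conj_cosets t).
  by rewrite mem_undup mem_filter andbC.
have dr : d = \sum_(C <- r) s C.
  rewrite dE (fsbigE r); last 3 first.
  - exact: undup_uniq.
  - by move=> C /=; rewrite rE => /andP[_ /set_mem].
  - move=> C /mem_set Cc; rewrite rE Cc andbT => Cr.
    have : ~ [set` r0] C by apply/negP.
    by rewrite -r0E /= => /negP; rewrite negbK => /eqP.
  rewrite big_seq_cond [RHS]big_seq_cond; apply: eq_bigl => C; rewrite rE.
  by case: (C \in r0); case: (C \in _).
rewrite dr big_seq; apply: submodule_sum => // C Cr.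
have Cc : conj_cosets t C by move: Cr; rewrite rE => /andP[_ /set_mem].
have [u [e [Cu sC]]] := sin C Cc; have Nu := conj_cosets_N0 Tt Cc Cu.
rewrite sC; apply: bact_submodule => //; apply: Ot.
have Bu : Bplus u^-1%g by exact/Bplus_N0/N0_V.
pose T d' := psi t (bact u^-1%g d').
have TD : {morph T : d' e' / d' + e'} by move=> d' e'; rewrite /T bactD// psiD.
have T0 : T 0 = 0.
  by apply: (@addrI _ (T 0)); rewrite -TD !addr0.
suff <- : T d = e by exact: Opsi.
rewrite dr (big_morph T TD T0) (bigD1_seq C) ?undup_uniq//= big1_seq ?addr0.
  rewrite /T sC -bactM//; last exact: Bplus_N0.
  by rewrite mulVg bact1 psi_phi.
move=> C' /andP[CC' C'r].
have Cc' : conj_cosets t C' by move: C'r; rewrite rE => /andP[_ /set_mem].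
have [u' [e' [Cu' sC']]] := sin C' Cc'; have Nu' := conj_cosets_N0 Tt Cc' Cu'.
rewrite /T sC' -bactM//; last exact: Bplus_N0.
apply: psi_uphi => //; first by apply: N0_M => //; exact: N0_V.
move=> [v Nv uv]; move/eqP: CC'; apply; apply/esym.
exact: conj_cosets_eq Tt Cc Cc' Cu Cu' Nv uv.
Qed.

End EtaleModules.

(** * The image of the Dirac functionals *)

Lemma malg_diracB_scale (R : comNzRingType) (X : choiceType) (a b : X) (c : R)
    (m : {malg R[X]}) : a <> b -> << a >> - << b >> = c *: m -> 1 = c * m@_a.
Proof.
move=> ab /(congr1 (fun m => m@_a)); rewrite mcoeffB mcoeffZ mcoeffUU mcoeffU.
by case: eqP => [/esym//|_]; rewrite subr0.
Qed.

Lemma socle0 (K : valuedFieldType) (piK : oring K) :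
  val piK != 0 -> vord (val piK) = 1 -> socle piK 0 = 0.
Proof.
by move=> p0 p1; apply: (@addrI _ (socle piK 0)); rewrite -socleD// !addr0.
Qed.

Section DiracFunctionals.
Variables (p : nat) (p_prime : prime p) (Q : padicType p) (F K : padicExtType Q).
Variables (n : nat) (piK : oring K).
Hypotheses (piK_neq0 : val piK != 0) (piK_unif : vord (val piK) = 1).
Variables (chi : GL n F -> resfield K) (chi_char : smooth_character chi).
Local Notation G := (GL n F).
Local Notation k := (resfield K).
Local Notation w0 := (w0 n F).
Local Notation M := (M0 chi).
Implicit Types (g b t u v : G) (x y : G -> k) (c : k).

Let M_lin : lin_closed M. Proof. by move=> a x y; exact: M0_lin. Qed.
Let M_smooth x : M x -> smooth x. Proof. by case/M0P. Qed.
Let M_N0 u x : N0 u -> M x -> M (gact u x).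
Proof. by move=> Nu; apply: M0_gact; exact: Bplus_N0. Qed.

(** [c] times the evaluation at [g], moved into K / o_K by [socle]. The coefficient [c] absorbs the
    values of the character in [dirac_borel]. *)
Definition dirac c g : dual M := insubd 0 (fun z : M => socle piK (c * val z g)).

Lemma diracE c g x : M x -> dual_ext (dirac c g) x = socle piK (c * x g).
Proof.
apply: (insubd_dual (Phi := fun x => socle piK (c * x g))) => // a y z _ _ _.
rewrite -(socleZ piK_neq0 piK_unif) -(socleD piK_neq0 piK_unif); congr socle.
by rewrite mulrDr mulrCA.
Qed.

Lemma dirac_borel c g b : borel b -> dirac c (g * b)%g = dirac (c * (bchi chi b)^-1) g.
Proof.
move=> bb; apply: dual_eq => x Mx; rewrite !diracE// -mulrA; congr (socle _ (_ * _)).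
by have [_ ->] := M0P Mx.
Qed.

Lemma dirac_psi c g t : Tplus t -> dual_psi t (dirac c g) = dirac c (t^-1 * g)%g.
Proof.
move=> Tt; have Mt x : M x -> M (gact t x) by apply: M0_gact; exact: Bplus_Tplus.
by apply: dual_eq => x Mx; rewrite dual_psiE// !diracE//; exact: Mt.
Qed.

Lemma dirac_scale c g (u : N0grp n F) :
  dual_scale (cgdirac (oring K) u) (dirac c g) = dirac c (n0val u * g)%g.
Proof.
apply: dual_eq => x Mx; have [H Hx] := smooth_fixes (M_smooth Mx).
rewrite (dual_scaleE M_lin M_smooth M_N0 _ _ Mx Hx) /scale_at mintU.
rewrite (fixes_repr Hx (gquot_repr H u)) !diracE//; last exact/M_N0/Mx/N0_V/n0_N0.
by rewrite /gact invgK.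
Qed.

(** Some congruence subgroup separates [u] from 1. At that level the difference of the two group
    elements has a coefficient 1, which is not divisible by [piK]. *)
Lemma cgproj_dirac_neq1 (u : N0grp n F) : n0val u <> 1%g ->
  cgproj piK (cgdirac (oring K) u) != 1.
Proof.
move=> u1; apply/eqP => /cgprojE; rewrite unfold_in => /asboolP[l lE].
have [r ur] : exists r : nat, ~ congr_sub r (n0val u).
  apply: contrapT => /forallNP h; apply: u1; apply: gl_inj; apply/matrixP => i j.
  apply/eqP; rewrite -subr_eq0; apply/eqP/vge_all => r.
  by have /contrapT/(_ i j) := h r; rewrite sub1E gl1E mxE.
pose H := n0_congr_subgroup F n r.
pose q : gquot H := \pi_(gquot H) u; pose q1 : gquot H := \pi_(gquot H) 1%g.
pose m : {malg (oring K)[gquot H]} := cglev l H.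
have e : << q >> - << q1 >> = piK *: m := congr1 (fun l' => cglev l' H) lE.
have qq1 : q <> q1 by move=> /esym/gquotP; rewrite invg1 mul1g.
have /(congr1 val) := malg_diracB_scale qq1 e; rewrite rmorph1 rmorphM /= => {}e.
have : vge 1 (1 : K).
  by rewrite e -[1]addr0; apply: vgeM (valP _); rewrite /vge piK_unif lexx orbT.
by rewrite /vge oner_eq0 vord1.
Qed.

Variables (D : etale_module F n piK) (D_torsion_free : torsion_free D).
Variables (f : dual M -> D) (f_continuous : continuous f).
Hypotheses (f_psi : psi_invariant f) (f_hom : Omega_hom f).

Lemma Omega_homB (x y : dual M) : f (x - y) = f x - f y.
Proof. by have [fD _] := f_hom; apply/eqP; rewrite eq_sym subr_eq -fD subrK. Qed.

Lemma Omega_hom0 : f 0 = 0. Proof. by rewrite -(subrr 0) Omega_homB subrr. Qed.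

Lemma f_dirac_stab c g : unip_stab g -> f (dirac c g) = 0.
Proof.
move=> [u [Nu u1 uu]]; pose u' := MkN0 (mem_set Nu).
have [_ fL] := f_hom; have := fL (cgdirac (oring K) u') (dirac c g).
rewrite dirac_scale /= (_ : (u * g)%g = (g * (g^-1 * u * g))%g); last first.
  by rewrite !mulgA mulgV mul1g.
rewrite dirac_borel; last exact: unipotent_borel.
rewrite bchi_unipotent// invr1 mulr1 => e.
have : (cgproj piK (cgdirac (oring K) u') - 1) *: f (dirac c g) = 0.
  by rewrite scalerBl scale1r -e subrr.
case/D_torsion_free => // /eqP; rewrite subr_eq0.
by rewrite (negPf (cgproj_dirac_neq1 _)).
Qed.

(** Continuity of [f] at 0, in terms of finitely many test functions. The default 0 of [nth] belongs
    to M_0, so membership holds for every index. *)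
Lemma f_near (O : set D) : open O -> O 0 -> exists s : seq (G -> k),
  (forall i, M (nth (fun=> 0) s i)) /\
  forall xi, (forall i, (i < size s)%N -> dual_ext xi (nth (fun=> 0) s i) = 0) -> O (f xi).
Proof.
move=> oO O0; have /continuousP/(_ _ oO) : continuous f by [].
move=> oU; have [|s sP] := (oU : dual_open _) 0; first by rewrite /preimage /= Omega_hom0.
exists [seq val z | z <- s]; rewrite size_map; split=> [i|xi xi0].
  have [si|si] := ltnP i (size s).
    rewrite (nth_map (SigSub (mem_set (M0_0 chi))))//.
    exact: set_mem (valP _).
  by rewrite nth_default ?size_map//; exact: M0_0.
apply: sP => x xs; have xi_lt : (index x s < size s)%N by rewrite index_mem.
have := xi0 _ xi_lt; rewrite (nth_map x)// nth_index// dual_extE => ->.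
by rewrite -dual_extE dual_ext0.
Qed.

Lemma smooth_seq (s : seq (G -> k)) : (forall i, M (nth (fun=> 0) s i)) ->
  exists2 r, (0 < r)%N & forall i h g, congr_sub r h ->
    nth (fun=> 0) s i (h * g)%g = nth (fun=> 0) s i g.
Proof.
elim: s => [|x s IH] sM; first by exists 1%N => // i h g _; rewrite nth_nil.
have [r r0 rP] := IH (fun i => sM i.+1).
have [q qP] := M_smooth (sM 0%N).
exists (maxn r q) => [|[|i] h g hr]; first by rewrite leq_max r0.
  by apply: qP; apply: congr_sub_le hr; rewrite leq_maxr.
by apply: rP; apply: congr_sub_le hr; rewrite leq_maxl.
Qed.

Lemma f_dirac_far (O : set D) c v : open O -> submodule O ->
  (forall t d, Tplus t -> O d -> O (bact t d)) -> unipotent v -> ~ N0 v ->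
  O (f (dirac c (v * w0)%g)).
Proof.
move=> oO Osub Ophi vu vN; have [O0 Ol] := Osub.
have [s [sM sP]] := f_near oO O0; have [r r0 rP] := smooth_seq sM.
(* [t] is adapted to the level [r] under which all test functions are invariant. *)
have [t [Tt _ tP]] := exists_contraction_N0 F n r; have tt := Tplus_torus Tt.
apply: (etale_submodule Osub (fun d => Ophi t d Tt) Tt) => u Nu.
have [uu _] := Nu; have NuV := N0_V Nu; have uuV := unipotentV uu.
have yu : unipotent (u^-1 * v)%g by exact: unipotentM.
have yN : ~ N0 (u^-1 * v)%g by move=> /(N0_M Nu); rewrite mulVKg.
have := bact_N0 (MkN0 (mem_set NuV)) (f (dirac c (v * w0)%g)) => /= ->.
have [_ fL] := f_hom; rewrite -fL -f_psi// dirac_scale dirac_psi//=.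
have [i [j [ij aij]]] := tP _ yu yN; set Y := (t^-1 * (u^-1 * v) * t)%g in aij.
have Yu : unipotent Y.
  by rewrite /Y -{2}[t]invgK; apply: torus_conj_unipotent => //; exact: torusV.
(* The torus part crosses [w0] and only changes the coefficient [c]. *)
have -> : (t^-1 * (u^-1 * (v * w0)))%g = (Y * w0 * (w0 * t^-1 * w0))%g.
  by rewrite /Y !mulgA -[(_ * w0 * w0)%g]mulgA w0w0 mulg1 mulgK.
rewrite dirac_borel; last exact/torus_borel/torus_w0/torusV.
set c' := c * _; set a := glmx Y i j in aij.
have a0 : a != 0 by apply: contraNneq aij => ->; rewrite vge0.
have aV : vge r%:Z a^-1 by apply: vge_le (vge_inv a0 aij); lia.
(* Left multiplication by [1 + E] subtracts [a^-1] times row [i] from row [j], which turns the entry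
   1 of [Y] at [(j, j)] into 0. As [a] has a large pole, [1 + E] is close to 1. *)
pose E : 'M[F]_n := - a^-1 *: delta_mx j i.
have Er : mxvge r%:Z E.
  by move=> i' j'; rewrite !mxE -[r%:Z]addr0; apply: vgeM; rewrite ?vgeN ?vge_nat.
have E1 : mxvge r%:Z ((1%:M + E) - 1%:M) by rewrite addrC addKr.
have Eu : 1%:M + E \in unitmx by apply: near1_unit; apply: mxvge_le E1; lia.
pose h : G := MkGL Eu; have hr : congr_sub r h by [].
(* The block from [j] on now has a zero first column, so the basis vector of index [j] is in the
   kernel. *)
have sing : trail j (glmx (h * Y)%g) \notin unitmx.
  apply/negP => U; have /matrixP/(_ j 0) : (delta_mx j 0 : 'cV[F]_n) = 0.
    apply: (can_inj (mulKmx U)); rewrite mulmx0 -colE.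
    apply/matrixP => l z; rewrite 2!mxE leqnn andbT [RHS]mxE.
    have [/upperP Yl Y1] := Yu.
    have hY l' : glmx (h * Y)%g l' j = glmx Y l' j - a^-1 * (l' == j)%:R * a.
      rewrite glM /= mulmxDl mul1mx mxE; congr (_ + _).
      rewrite -scalemxAl mxE mulNr; congr (- _); rewrite -mulrA; congr (_ * _).
      rewrite mxE (bigD1 i)//= mxE eqxx andbT big1 ?addr0// => l0 l0i.
      by rewrite mxE (negPf l0i) andbF mul0r.
    case: leqP => [jl|lj]; last by case: eqP lj => // ->; rewrite ltnn.
    rewrite hY; have [->|lj] := eqVneq l j; first by rewrite Y1 mulr1 mulVf// subrr.
    by rewrite Yl ?mulr0 ?mul0r ?subr0//; rewrite ltn_neqAle eq_sym lj.
  by rewrite !mxE !eqxx => /eqP; rewrite oner_eq0.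
have -> : f (dirac c' (Y * w0)%g) =
    f (dirac c' (Y * w0)%g - dirac c' (h * Y * w0)%g).
  by rewrite Omega_homB (f_dirac_stab _ (unip_stab_sing sing)) subr0.
apply: sP => l _; rewrite dual_extD dual_extN !diracE// -[(h * Y * w0)%g]mulgA.
by rewrite (rP l _ _ hr) subrr.
Qed.

Lemma f_dirac_out (O : set D) c g : open O -> submodule O ->
  (forall t d, Tplus t -> O d -> O (bact t d)) -> ~ N0cell g -> O (f (dirac c g)).
Proof.
move=> oO Osub Ophi gN.
have [/f_dirac_stab ->|[u [b [uu bb gE]]]] := unip_stab_or_big_cell g; first by case: Osub.
rewrite gE dirac_borel//; apply: f_dirac_far => // Nu.
by apply: gN; exists u, b.
Qed.

Lemma dual_torsion (xi : dual M) x : M x -> piK *: dual_ext xi x = 0.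
Proof.
move=> Mx; have r0 : residue piK = 0.
  by apply/eqP; rewrite residue_eq0 unfold_in /vge piK_unif lexx orbT.
(* Linearity applied to [piK x + x = x] leaves [piK] times the value equal to 0. *)
have e : (fun g => residue piK * x g + x g) = x.
  by apply: funext => g; rewrite r0 mul0r add0r.
have := @dual_ext_lin _ _ _ _ _ _ xi piK x x Mx Mx; rewrite e => /(_ Mx).
by move=> h; apply: (@addIr _ (dual_ext xi x)); rewrite add0r -h.
Qed.

Lemma dual_ext_comb (xi : dual M) (I : Type) (s : seq I) (a c : I -> k) (x : I -> G -> k) :
  (forall i, M (x i)) -> (forall i, dual_ext xi (x i) = socle piK (c i)) ->
  dual_ext xi (fun g => \sum_(i <- s) a i * x i g) = socle piK (\sum_(i <- s) a i * c i).
Proof.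
move=> xM xc; elim: s => [|i s IH].
  rewrite big_nil (socle0 piK_neq0 piK_unif).
  rewrite (_ : (fun g => _) = fun=> 0); last by apply: funext => g; rewrite big_nil.
  have e : (fun g : G => residue (-1 : oring K) * 0 + 0) = fun=> 0.
    by apply: funext => g; rewrite mulr0 addr0.
  have := @dual_ext_lin _ _ _ _ _ _ xi (-1) _ _ (M0_0 chi) (M0_0 chi).
  by rewrite e => /(_ (M0_0 chi)); rewrite scaleN1r addNr.
rewrite (_ : (fun g => _) =
  fun g => residue (repr (a i)) * x i g + \sum_(j <- s) a j * x j g); last first.
  by apply: funext => g; rewrite big_cons residue_repr.
have sM : M (fun g => \sum_(j <- s) a j * x j g) by exact: M0_sum.
rewrite dual_ext_lin//; last exact: M_lin.
rewrite IH xc big_cons -(socleZ piK_neq0 piK_unif) residue_repr.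
by rewrite (socleD piK_neq0 piK_unif).
Qed.

Hypotheses (D_hausdorff : hausdorff_space D) (D_basis : phi_invariant_basis D).

(* By [bidual_span], on finitely many elements of M_0 a functional that vanishes
   on M_{0,n!-1} is a combination of evaluations outside N_0 w_0 B. *)
Lemma f_eq0 (xi : dual M) : (forall x, M0w chi x -> dual_ext xi x = 0) -> f xi = 0.
Proof.
(* It suffices that [f xi] lies in every neighbourhood of 0, hence in every submodule [O] of the
   basis. *)
move=> xi0; apply: D_hausdorff => A B Af B0.
have [O [oO OB Osub Ophi]] := D_basis B0; have [O0 Ol] := Osub.
exists (f xi); split; first exact: nbhs_singleton.
apply: OB; have [s [sM sP]] := f_near oO O0.
pose m := size s; pose x (i : 'I_m) := nth (fun=> 0) s i.
have /boolp.choice[c cP] (i : 'I_m) : exists c, dual_ext xi (x i) = socle piK c.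
  by apply: (socle_torsion piK_neq0 piK_unif); apply: dual_torsion; exact: sM.
(* The value vectors, on the test functions, of the functionals that [f] sends into [O]. The aim is
   to find that of [xi] among them. *)
pose S : set 'rV[k]_m := [set v | exists eta : dual M, O (f eta) /\
  forall i, dual_ext eta (x i) = socle piK (v 0 i)].
have [fD fL] := f_hom.
have [eta [Oeta etaP]] : S (\row_i c i).
  apply: (@bidual_span _ _ S _ _ [set v | exists2 g, ~ N0cell g & v = \row_i x i g]).
  - exists 0; rewrite Omega_hom0; split=> // i; rewrite dual_ext0 mxE.
    by rewrite (socle0 piK_neq0 piK_unif).
  - move=> a v v' [eta [Oeta etaP]] [eta' [Oeta' etaP']].
    (* Scalars of the residue field act through a lift times the identity of N_0. *)
    pose l := repr a *: cgdirac (oring K) 1%g : Lambda n F K.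
    exists (dual_scale l eta + eta'); split.
      by rewrite fD fL; exact: Ol.
    move=> i; have Mx : M (x i) by exact: sM.
    have [H Hx] := smooth_fixes (M_smooth Mx).
    rewrite dual_extD (dual_scaleE M_lin M_smooth M_N0 _ _ Mx Hx) /scale_at.
    rewrite [cglev l H]/(_ *: _) mintZ mintU (fixes_repr Hx (gquot_repr H 1%g)).
    rewrite invg1 gact1 etaP etaP' !mxE (socleD piK_neq0 piK_unif).
    by rewrite -(socleZ piK_neq0 piK_unif) residue_repr.
  - move=> v [g gN ->]; exists (dirac 1 g); split; first exact: f_dirac_out.
    by move=> i; rewrite diracE ?mul1r ?mxE//; exact: sM.
  (* A form [a] that kills all evaluations outside N_0 w_0 B makes the combination of test functions
     with coefficients [a] an element of M_{0,n!-1}, where [xi] vanishes. *)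
  move=> a aP; apply/matrixP => i j; rewrite !ord1 [RHS]mxE mxE.
  apply: (socle_eq0 piK_neq0 piK_unif).
  under eq_bigr do rewrite mxE mulrC.
  rewrite -(dual_ext_comb _ _ (fun l => sM l : M (x l)) cP).
  apply: xi0; set y := fun g => _.
  have yM : M y by apply: M0_sum => l _; exact: sM.
  have [ys ye] := M0P yM; split; first exact: IndP.
  move=> g; apply: contraNP => gN; apply/eqP.
  have := aP (\row_l x l g); rewrite /= => /(_ (ex_intro2 _ _ g gN erefl)).
  move=> /matrixP/(_ 0 0); rewrite [LHS]mxE [RHS]mxE => h.
  rewrite -[RHS]h; apply: eq_bigr => l _.
  by rewrite mxE mulrC.
(* [xi - eta] vanishes on the test functions, so [f] sends it into [O], as it does [eta]. *)
rewrite -[xi](subrK eta) fD -[f (xi - eta)]scale1r; apply: Ol => //.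
apply: sP => i im; have := etaP (Ordinal im); have := cP (Ordinal im).
by rewrite /x /= dual_extD dual_extN mxE => -> ->; rewrite subrr.
Qed.

End DiracFunctionals.

(** * The factorization *)

Section CutDual.
Variables (p : nat) (p_prime : prime p) (Q : padicType p) (F K : padicExtType Q).
Variables (n : nat) (chi : GL n F -> resfield K) (chi_char : smooth_character chi).
Local Notation G := (GL n F).

(** The transpose of [cut], a section of the restriction of functionals. *)
Definition cut_dual (f : dual (M0w chi)) : dual (M0 chi) :=
  insubd 0 (fun z : M0 chi => dual_ext f (cut (val z))).

Lemma cut_lin (a : resfield K) (x y : G -> resfield K) :
  cut (fun g => a * x g + y g) = (fun g => a * cut x g + cut y g).
Proof.
apply: funext => g; have [gc|gc] := pselect (N0cell g); first by rewrite !cut_in.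
by rewrite !cut_out// mulr0 addr0.
Qed.

Lemma cut_dual_M0 f x : M0 chi x -> dual_ext (cut_dual f) x = dual_ext f (cut x).
Proof.
apply: (insubd_dual (Phi := fun x => dual_ext f (cut x))) => // a y z My Mz Mw.
rewrite cut_lin dual_ext_lin//; [exact: cut_M0w|exact: cut_M0w|].
by rewrite -cut_lin; exact: cut_M0w.
Qed.

Lemma cut_dualE f x : M0w chi x -> dual_ext (cut_dual f) x = dual_ext f x.
Proof. by move=> Mx; rewrite cut_dual_M0 ?(cut_id Mx)//; exact: M0w_M0. Qed.

Lemma cut_dualD f g : cut_dual (f + g) = cut_dual f + cut_dual g.
Proof. by apply: dual_eq => x Mx; rewrite dual_extD !cut_dual_M0// dual_extD. Qed.

Lemma cut_dual_continuous : continuous cut_dual.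
Proof.
apply/continuousP => U oU.
suff : dual_open (cut_dual @^-1` U) by [].
move=> f /(oU : dual_open U)[s sP].
pose c (z : M0 chi) : M0w chi := SigSub (mem_set (cut_M0w p_prime chi_char (set_mem (valP z)))).
exists (map c s) => g gf; apply: sP => z zs.
have := gf (c z) (map_f c zs); rewrite -!dual_extE /= => e.
by rewrite !cut_dual_M0//; exact: set_mem (valP z).
Qed.

End CutDual.

Theorem theorem5p2 (p : nat) (p_prime : prime p) (Q : padicType p)
    (F K : padicExtType Q) (n : nat) (n_gt0 : (0 < n)%N)
    (piK : oring K) (piK_neq0 : val piK != 0) (piK_unif : vord (val piK) = 1)
    (chi : GL n F -> resfield K) (chi_char : smooth_character chi)
    (D : etale_module F n piK)
    (D_torsion_free : torsion_free D)
    (D_hausdorff : hausdorff_space D)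
    (D_basis : phi_invariant_basis D)
    (f : dual (M0 chi) -> D)
    (f_continuous : continuous f)
    (f_psi : psi_invariant f)
    (f_hom : Omega_hom f) :
  exists h : dual (M0w chi) -> D,
    [/\ continuous h, psi_invariant h, Omega_hom h &
        forall x, f x = h (dual_restr (M0w chi) x)].
Proof.
(* [f] depends only on restrictions to M_{0,n!-1}. The compatibilities of [f] composed with
   [cut_dual] can thus be checked there, where [cut] is the identity and the B_+-action is the one
   of M_0. *)
have f_eq (xi eta : dual (M0 chi)) :
    (forall x, M0w chi x -> dual_ext xi x = dual_ext eta x) -> f xi = f eta.
  move=> e; apply/eqP; rewrite -subr_eq0 -(Omega_homB f_hom); apply/eqP.
  apply: (f_eq0 p_prime piK_neq0 piK_unif) => // x Mx.
  by rewrite dual_extD dual_extN e// subrr.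
have w_lin : lin_closed (M0w chi) by move=> a x y; exact: M0w_lin.
have lin : lin_closed (M0 chi) by move=> a x y; exact: M0_lin.
have w_sub : M0w chi `<=` M0 chi by move=> x; exact: M0w_M0.
have smo x : M0 chi x -> smooth x by case/M0P.
have N0_stable u x : N0 u -> M0 chi x -> M0 chi (gact u x).
  by move=> Nu; apply: M0_gact; exact: Bplus_N0.
have N0_stablew u x : N0 u -> M0w chi x -> M0w chi (gact u x).
  by move=> Nu; apply: M0w_gact => //; exact: Bplus_N0.
have [fD fL] := f_hom.
exists (f \o cut_dual (chi := chi)); split.
- move=> x; apply: continuous_comp; last exact: f_continuous.
  exact: cut_dual_continuous.
- move=> t y Tt; rewrite /= -f_psi//; apply: f_eq => x Mx.
  have Bt := Bplus_Tplus Tt.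
  rewrite cut_dualE// !dual_psiE//; last 3 first.
  + by move=> z; exact: M0_gact.
  + exact: w_sub.
  + by move=> z; exact: M0w_gact.
  by rewrite cut_dualE//; exact: M0w_gact.
- split=> [y z|l y] /=; first by rewrite -fD cut_dualD.
  rewrite -fL; apply: f_eq => x Mx; have Mx' := w_sub _ Mx.
  have [H Hx] := smooth_fixes (smo _ Mx').
  rewrite cut_dualE// (dual_scaleE lin smo N0_stable _ _ Mx' Hx).
  rewrite (dual_scaleE w_lin (fun x Mx => smo x (w_sub x Mx)) N0_stablew _ _ Mx Hx).
  apply: eq_mint => q; rewrite cut_dualE//; apply: N0_stablew => //.
  exact/N0_V/n0_N0.
- by move=> y; apply: f_eq => x Mx; rewrite cut_dualE// dual_restrE.
Qed.
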